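(* Let $k$ be a field. The (reduced) space of measures for the class $\mathfrak{P}$ of finite posets over $k$ is the union of one plane, eight lines, and 15 isolated points. The plane and three of the lines intersect at a common point, and there are no other intersections.
   Context: All posets are finite; the empty poset is allowed. An embedding of posets is an injective map $\alpha\colon P\to Q$ with $x\le y\iff\alpha(x)\le\alpha(y)$. Given embeddings $\alpha\colon P\to Q$ and $\beta\colon P\to P'$, an amalgamation of $Q$ and $P'$ over $P$ is a triple $(Q',\alpha',\beta')$ where $Q'$ is a poset and $\alpha'\colon P'\to Q'$, $\beta'\colon Q\to Q'$ are embeddings with $\beta'\circ\alpha=\alpha'\circ\beta$ and $Q'=\mathrm{im}(\alpha')\cup\mathrm{im}(\beta')$; amalgamations are considered up to the evident notion of isomorphism. A measure for $\mathfrak{P}$ valued in a commutative ring $R$ is a rule $\nu$ assigning to each embedding $\alpha\colon P\to Q$ of finite posets a value $\nu(\alpha)\in R$ such that: (a) $\nu(\alpha)=1$ if $\alpha$ is an isomorphism; (b) $\nu(\beta\circ\alpha)=\nu(\beta)\nu(\alpha)$ when the composition is defined; (c) given embeddings $\alpha\colon P\to Q$ and $\beta\colon P\to P'$, with $(Q'_i,\alpha'_i,\beta'_i)$, $1\le i\le r$, the various amalgamations up to isomorphism, $\nu(\alpha)=\sum_{i=1}^r\nu(\alpha'_i)$. There is a universal measure, valued in the commutative ring $\Theta(\mathfrak{P})$: the quotient of the polynomial ring over $\mathbf{Z}$ in symbols $[\alpha]$, one for each embedding $\alpha$ of finite posets, by the relations encoding (a), (b), (c). Measures valued in $R$ correspond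 to ring homomorphisms $\Theta(\mathfrak{P})\to R$. The space of measures over $k$ is the scheme $\operatorname{Spec}(k\otimes_{\mathbf{Z}}\Theta(\mathfrak{P}))$, whose $k$-points are the $k$-valued measures; here only its reduced subscheme is described. It is identified with a closed subvariety of the affine space $\mathbf{A}^{3\times 3}$ of $3\times3$ matrices by $\nu\mapsto(\nu(J_{p,q}\setminus\{\ast\}\to J_{p,q}))_{0\le p,q\le 2}$, where $J_{p,q}$ is the poset on $\{a_1,\dots,a_p,\ast,b_1,\dots,b_q\}$ with order generated by $a_i<\ast<b_j$. ''Plane'', ''line'' and ''point'' refer to closed subvarieties of $\mathbf{A}^{3\times 3}$ that are affine-linear of dimension 2, 1, 0. *)

(* Defs.v *)
From HB Require Import structures.
From mathcomp Require Import all_boot all_order all_algebra.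
From mathcomp Require Import finmap boolp.
From mathcomp Require Export monalg.

Set Implicit Arguments.
Unset Strict Implicit.
Unset Printing Implicit Defensive.

Import GRing.Theory.
Local Open Scope ring_scope.

(* Every finite poset is isomorphic to one carried by some 'I_n. Restricting to
   these carriers makes the embeddings of finite posets form a (small) type,
   which can index the variables of a polynomial ring; since isomorphisms have
   value 1 and values are multiplicative, the rings below are unaffected.     *)
Record poset := Poset {
  pcard : nat;
  ple : rel 'I_pcard;
  ple_refl : reflexive ple;
  ple_anti : antisymmetric ple;
  ple_trans : transitive ple
}.

Record embedding (P Q : poset) := Embedding {
  emap :> 'I_(pcard P) -> 'I_(pcard Q);
  emap_inj : injective emap;
  emap_le : forall x y, ple x y = ple (emap x) (emap y)
}.

Section Embeddings.

Lemma comp_emb_le (P Q S : poset) (b : embedding Q S) (a : embedding P Q) x y :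
  ple x y = ple ((b \o a) x) ((b \o a) y).
Proof. by rewrite (emap_le a) (emap_le b). Qed.

Definition comp_emb (P Q S : poset) (b : embedding Q S) (a : embedding P Q) :
    embedding P S :=
  Embedding (inj_comp (@emap_inj _ _ b) (@emap_inj _ _ a)) (comp_emb_le b a).

Variables (Q : poset) (n : nat) (f : 'I_n -> 'I_(pcard Q)).
Hypothesis f_inj : injective f.

Let fle : rel 'I_n := fun x y => ple (f x) (f y).

Lemma fle_refl : reflexive fle. Proof. by move=> x; apply: ple_refl. Qed.

Lemma fle_anti : antisymmetric fle.
Proof. by move=> x y xy; apply: f_inj; apply: ple_anti. Qed.

Lemma fle_trans : transitive fle.
Proof. by move=> y x z; apply: ple_trans. Qed.

Definition induced_poset : poset := Poset fle_refl fle_anti fle_trans.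

Definition induced_emb : embedding induced_poset Q :=
  @Embedding induced_poset Q f f_inj (fun _ _ => erefl).

End Embeddings.

Record amalgamation (P Q P' : poset) (a : embedding P Q) (b : embedding P P') :=
  Amalgamation {
    am_poset : poset;
    am_a : embedding P' am_poset;
    am_b : embedding Q am_poset;
    am_comm : forall x, am_b (a x) = am_a (b x);
    am_cover : forall z, (exists x, z = am_a x) \/ (exists y, z = am_b y)
  }.

Definition amalgamation_iso (P Q P' : poset) (a : embedding P Q)
    (b : embedding P P') (A B : amalgamation a b) : Prop :=
  exists f : embedding (am_poset A) (am_poset B),
    [/\ bijective f,
        forall x, f (am_a A x) = am_a B x
      & forall y, f (am_b A y) = am_b B y].

Definition all_amalgamations (P Q P' : poset) (a : embedding P Q)
    (b : embedding P P') (r : nat) (A : 'I_r -> amalgamation a b) : Prop :=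
  forall B : amalgamation a b, exists! i, amalgamation_iso B (A i).

Notation polyring R I := {malg R[{cmonom I}]}.

Definition pvar (R : comNzRingType) (I : choiceType) (i : I) : polyring R I :=
  << ucm i >>.

Definition peval (R : comNzRingType) (I : choiceType) (A : comAlgType R)
    (h : I -> A) (p : polyring R I) : A :=
  \sum_(m <- msupp p) p@_m *: \prod_(i <- finsupp m) h i ^+ m i.

Definition ideal_gen (A : comNzRingType) (S : A -> Prop) (x : A) : Prop :=
  exists (n : nat) (c s : 'I_n -> A),
    (forall i, S (s i)) /\ x = \sum_(i < n) c i * s i.

Definition radical (A : comNzRingType) (J : A -> Prop) (x : A) : Prop :=
  exists n : nat, J (x ^+ n).

Definition symbol : choiceType :=
  {classic {P : poset & {Q : poset & embedding P Q}}}.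

Definition sym (R : comNzRingType) (P Q : poset) (a : embedding P Q) :
    polyring R symbol :=
  pvar R (existT _ P (existT _ Q a) : symbol).

Inductive theta_rel (R : comNzRingType) : polyring R symbol -> Prop :=
| Theta_iso (P Q : poset) (a : embedding P Q) :
    bijective a -> theta_rel (sym R a - 1)
| Theta_comp (P Q S : poset) (a : embedding P Q) (b : embedding Q S) :
    theta_rel (sym R (comp_emb b a) - sym R b * sym R a)
| Theta_amalg (P Q P' : poset) (a : embedding P Q) (b : embedding P P')
    (r : nat) (A : 'I_r -> amalgamation a b) :
    all_amalgamations A ->
    theta_rel (sym R a - \sum_(i < r) sym R (am_a (A i))).

(* polyring int symbol / theta_ideal int is the universal ring Theta; the
   relations having integer coefficients, polyring R symbol / theta_ideal R is
   its base change to R.                                                      *)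
Definition theta_ideal (R : comNzRingType) : polyring R symbol -> Prop :=
  ideal_gen (@theta_rel R).

Section JPoset.

Variables p q : nat.

(* a_1, ..., a_p are the indices < p, the point * is p, and b_1, ..., b_q are
   the indices > p.                                                           *)
Definition Jle : rel 'I_(p + q).+1 := fun i j => (i == j) || (i <= p <= j)%N.

Lemma Jle_refl : reflexive Jle. Proof. by move=> i; rewrite /Jle eqxx. Qed.

Lemma Jle_anti : antisymmetric Jle.
Proof.
move=> i j /andP[/orP[/eqP//|/andP[ip pj]] /orP[/eqP//|/andP[jp pi]]].
by apply/val_inj/eqP; rewrite eqn_leq (leq_trans ip pj) (leq_trans jp pi).
Qed.

Lemma Jle_trans : transitive Jle.
Proof.
move=> j i l /orP[/eqP->//|/andP[ip pj]] /orP[/eqP<-|/andP[jp pl]];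
  by rewrite /Jle ip ?pj ?pl orbT.
Qed.

Definition J : poset := Poset Jle_refl Jle_anti Jle_trans.

Definition J_star : 'I_(pcard J) := inord p.

Definition J_emb : embedding (induced_poset (@lift_inj _ J_star)) J :=
  induced_emb (@lift_inj _ J_star).

End JPoset.

Notation A33 R := (polyring R ('I_3 * 'I_3)%type).

Section SpaceOfMeasures.

Variable k : fieldType.

Definition J_pullback (f : A33 k) : polyring k symbol :=
  peval (fun ij : 'I_3 * 'I_3 => sym k (J_emb ij.1 ij.2)) f.

Definition theta_radical : polyring k symbol -> Prop :=
  radical (@theta_ideal k).

(* The coordinate ring of the reduced space is the quotient of polyring k symbol
   by theta_radical; this says that A33 k surjects onto it.                   *)
Definition J_closed_immersion : Prop :=
  forall f : polyring k symbol,
    exists g : A33 k, theta_radical (f - J_pullback g).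

Definition space_ideal (f : A33 k) : Prop := theta_radical (J_pullback f).

Record affine_subspace := AffineSubspace {
  abase : 'M[k]_3;
  adir : {vspace 'M[k]_3}
}.

Definition adim (L : affine_subspace) : nat := \dim (adir L).

Definition in_affine (L : affine_subspace) (M : 'M[k]_3) : Prop :=
  M - abase L \in adir L.

(* Only equations of degree at most 1 are used: over a finite field, the ideal
   of all polynomials vanishing at the k-points of L would be too large to be
   the ideal of the subvariety.                                               *)
Definition affine_ideal (L : affine_subspace) : A33 k -> Prop :=
  ideal_gen (fun f : A33 k => (msize f <= 2)%N /\
    forall M : 'M[k]_3, in_affine L M ->
      peval (A := k^o) (fun ij : 'I_3 * 'I_3 => M ij.1 ij.2) f = 0).

End SpaceOfMeasures.

(* Main.v *)
(* A measure is determined by its values on one-point extensions, and Moebius inversion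
   expresses these through the total values of the points lying between an antichain of
   size p and one of size q above it, that is, through n_pq = nu(J_pq \ * -> J_pq). Over
   an integral domain, adding two points to a suitable poset in the two possible orders
   shows that n_pq does not change when p or q grows beyond 2, so that nu is determined
   by the nine values n_pq with p, q <= 2.

   Conversely, nine values define a measure as soon as the total values of pairs of added
   points do not depend on the order of addition. This amounts to finitely many quadratic
   relations between the n_pq. Combinations of these relations split into linear factors,
   and their solutions in a domain are the points of the 24 components.

   Since the radical of an ideal is the intersection of the kernels of the homomorphisms
   to integral domains that kill the ideal, this determines the reduced space. *)

(* Amalgamations may identify new points with old ones, which is awkward to enumerate for posets. On
   preorders over a fixed finite type, relation (c) becomes a sum over the types of the added
   points, that is, over sets of relations with the old points. Moebius inversion is taken in the
   full Boolean lattice of such sets: impossible types are not excluded, they receive the value 0.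
   In this form the values of types add up correctly under restriction to fewer old points for an
   arbitrary table n_pq, so that (c) for one added point imposes nothing. All constraints come from
   the exchange of two added points, and most configurations of bounds satisfy it identically; only
   the strictly separated ones, with 13 possible profiles on each side, give the quadratic
   relations. Homomorphisms to arbitrary domains are considered, not only points over k: a finite
   field has too few points to determine the reduced space, so the components are tested at their
   generic points. *)
From HB Require Import structures.
From Stdlib Require Import Ring.
Require Import Defs.
From mathcomp Require Import all_boot all_order all_algebra.
From mathcomp Require Import finmap boolp monalg.
From mathcomp Require classical_sets generic_quotient ring_quotient.

Set Implicit Arguments.
Unset Strict Implicit.
Unset Printing Implicit Defensive.

Import GRing.Theory.
Local Open Scope ring_scope.

(* [ring] needs the operations to be constants over [R]: [rfold] folds the canonical
   instances of the operations into these. *)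
Definition radd (R : comNzRingType) (x y : R) : R := x + y.
Definition rmul (R : comNzRingType) (x y : R) : R := x * y.
Definition ropp (R : comNzRingType) (x : R) : R := - x.
Definition rsub (R : comNzRingType) (x y : R) : R := x - y.
Definition rnat (R : comNzRingType) (x : R) n : R := x *+ n.
Definition r0 (R : comNzRingType) : R := 0.
Definition r1 (R : comNzRingType) : R := 1.

Lemma comNzRing_theory (R : comNzRingType) :
  ring_theory (r0 R) (r1 R) (@radd R) (@rmul R) (@rsub R) (@ropp R) eq.
Proof.
split; rewrite /radd /rmul /rsub /ropp /r0 /r1 => *;
  rewrite ?add0r ?mul1r ?addrA ?mulrA ?subrr ?mulrDl //; [exact: addrC | exact: mulrC].
Qed.

Ltac rfold R :=
  repeat match goal with
  | |- context [@GRing.add ?V ?x ?y] => change (@GRing.add V x y) with (@radd R x y)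
  | |- context [@GRing.mul ?V ?x ?y] => change (@GRing.mul V x y) with (@rmul R x y)
  | |- context [@GRing.opp ?V ?x] => change (@GRing.opp V x) with (@ropp R x)
  | |- context [@GRing.natmul ?V ?x ?n] => change (@GRing.natmul V x n) with (@rnat R x n)
  | |- context [@GRing.one ?V] => change (@GRing.one V) with (r1 R)
  | |- context [@GRing.zero ?V] => change (@GRing.zero V) with (r0 R)
  end;
  match goal with |- @eq _ ?a ?b => change (@eq (GRing.ComNzRing.sort R) a b) end.

(** * Moebius inversion on the lattice of subsets *)

Section Moebius.

Variables (U : finType) (R : comNzRingType).
Implicit Types (Z Y X W N P : {set U}) (G f : {set U} -> R).

(** The Moebius transform on the Boolean lattice of subsets of [W], inverse to summation over the
    supersets of [Z] in [W]. *)
Definition mob W G Z : R :=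
  \sum_(Y : {set U} | (Z \subset Y) && (Y \subset W)) (-1) ^+ #|Y :\: Z| * G Y.

(** Pairs each set with the one that differs from it in [u] alone; alternating sums of functions
    insensitive to [u] then cancel term by term. *)
Lemma sum_toggle (u : U) (Q : pred {set U}) (F : {set U} -> R) :
  (forall Y, Q (u |: Y) = Q Y) ->
  \sum_(Y : {set U} | Q Y) F Y =
  \sum_(Y : {set U} | Q Y && (u \notin Y)) (F Y + F (u |: Y)).
Proof.
move=> QU; rewrite (bigID (fun Y : {set U} => u \in Y)) /= addrC big_split /=.
congr (_ + _).
rewrite (reindex_onto (fun Y => u |: Y) (fun Y => Y :\ u)) /=; last first.
  by move=> Y /andP[_ uY]; rewrite setD1K.
apply: eq_bigl => Y; rewrite QU setU11 andbT; congr (_ && _).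
apply/eqP/idP => [<-|/setU1K //]; first by rewrite !inE eqxx.
Qed.

Lemma sum_signed Z X : Z \subset X ->
  \sum_(Y : {set U} | (Z \subset Y) && (Y \subset X)) (-1) ^+ #|Y :\: Z|
    = (X == Z)%:R :> R.
Proof.
move=> ZX; have [->|XZ] := eqVneq X Z.
  rewrite (big_pred1 Z); first by rewrite setDv cards0 expr0.
  by move=> Y /=; rewrite eqEsubset andbC.
have /set0Pn[u] : X :\: Z != set0.
  by rewrite setD_eq0; apply: contra XZ => XZ; rewrite eqEsubset XZ.
rewrite inE => /andP[uZ uX].
rewrite (sum_toggle (u := u)) => [|Y]; last first.
  rewrite subUset sub1set uX /=; congr (_ && _).
  by rewrite -subDset (setDidPl _) // disjoint_sym disjoints1.
rewrite big1 // => Y /andP[/andP[_ _] uY].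
rewrite setDUl (setDidPl (B := Z) (A := [set u]) _) ?disjoints1 //.
rewrite cardsU1 inE (negbTE uY) andbF /= add1n exprS mulN1r subrr //.
Qed.

(** Summation over supersets is unitriangular for inclusion, whence the induction on the number of
    elements of [W] missing from [Z]. *)
Lemma zeta_inj W f f' :
  (forall Z, Z \subset W ->
    \sum_(Y : {set U} | (Z \subset Y) && (Y \subset W)) f Y =
    \sum_(Y : {set U} | (Z \subset Y) && (Y \subset W)) f' Y) ->
  forall Z, Z \subset W -> f Z = f' Z.
Proof.
move=> H Z; have [n] := ubnP #|W :\: Z|; elim: n Z => // n IH Z.
rewrite ltnS => le ZW; have := H Z ZW.
rewrite (bigD1 Z) ?subxx //= [RHS](bigD1 Z) ?subxx //=.
rewrite [X in _ + X = _](eq_bigr f') => [/addIr //|Y /andP[/andP[ZY YW] YZ]].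
apply: IH => //; apply: leq_trans le; apply: proper_card.
rewrite properE setDS //=; apply: contra YZ => H'.
rewrite eqEsubset ZY andbT; apply/subsetP => u uY.
apply: contraT => uZ; have := subsetP H' u; rewrite !inE uZ uY (subsetP YW) //=.
by move/(_ isT).
Qed.

Lemma mob_zeta W G Z : Z \subset W ->
  \sum_(Y : {set U} | (Z \subset Y) && (Y \subset W)) mob W G Y = G Z.
Proof.
move=> ZW; rewrite /mob.
rewrite (exchange_big_dep (fun X => (Z \subset X) && (X \subset W))) /=; last first.
  by move=> Y X /andP[ZY YW] /andP[YX ->]; rewrite (subset_trans ZY).
under eq_bigr => X /andP[ZX XW].
  rewrite -mulr_suml.
  under eq_bigl => Y do rewrite XW andbT.
  have -> : \sum_(Y : {set U} | (Z \subset Y) && (Y \subset W) && (Y \subset X))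
     (-1) ^+ #|X :\: Y| = (X == Z)%:R :> R.
    rewrite -sum_signed //.
    (* The sign counts [X :\: Y] instead of [Y :\: Z]; complementation in the interval from [Z] to
       [X] exchanges the two. *)
    rewrite (reindex_onto (fun Y => Z :|: (X :\: Y)) (fun Y => Z :|: (X :\: Y))) /=.
      apply: eq_big => [Y|Y].
        rewrite subsetUl !subUset ZW ZX subsetDl (subset_trans (subsetDl _ _) XW) /=.
        apply/eqP/andP => [<-|[ZY YX]]; first by rewrite subsetUl subUset ZX subsetDl.
        apply/setP => u; have := subsetP ZY u; have := subsetP YX u.
        by rewrite !inE; case: (u \in Z); case: (u \in Y); case: (u \in X) => //= A B;
           rewrite ?(A isT) ?(B isT).
      move=> /andP[_ /eqP E]; congr (_ ^+ #|pred_of_set _|).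
      rewrite -[in RHS]E; apply/setP => u; rewrite !inE.
      by case: (u \in Z); case: (u \in Y); case: (u \in X).
    move=> Y /andP[/andP[ZY YW] YX]; apply/setP => u.
    have := subsetP ZY u; have := subsetP YX u.
    by rewrite !inE; case: (u \in Z); case: (u \in Y); case: (u \in X) => //= A B;
       rewrite ?(A isT) ?(B isT).
  over.
rewrite (bigD1 Z) ?subxx //= eqxx mul1r big1 ?addr0 // => X /andP[_ /negbTE ->].
by rewrite mul0r.
Qed.

Lemma mob_uniq W G f :
  (forall Z, Z \subset W ->
    \sum_(Y : {set U} | (Z \subset Y) && (Y \subset W)) f Y = G Z) ->
  forall Z, Z \subset W -> f Z = mob W G Z.
Proof.
move=> H; apply: zeta_inj => Z ZW; rewrite H // mob_zeta //.
Qed.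

Lemma eq_mob W G G' Z :
  (forall Y, Z \subset Y -> Y \subset W -> G Y = G' Y) -> mob W G Z = mob W G' Z.
Proof. by move=> H; apply: eq_bigr => Y /andP[ZY YW]; rewrite H. Qed.

(** Grouping the supersets of [Z] by their traces on [W] shows that the left-hand sides sum up to
    [G], and Moebius inversion is unique. This makes the values of types compatible with restriction
    to fewer points, whatever [G] is. *)
Lemma mob_restrict W W' G Z : W \subset W' -> Z \subset W ->
  \sum_(Y : {set U} | (Y \subset W') && (Y :&: W == Z)) mob W' G Y = mob W G Z.
Proof.
move=> WW; move: Z; apply: mob_uniq => Z ZW.
rewrite -(mob_zeta G (subset_trans ZW WW)).
rewrite [RHS](partition_big (fun Y => Y :&: W) (fun X => (Z \subset X) && (X \subset W))) /=.
  apply: eq_bigr => X /andP[ZX XW]; apply: eq_bigl => Y.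
  apply/andP/andP => [[YW /eqP E]|[/andP[ZY YW] E]]; rewrite ?E //.
  by rewrite YW (subset_trans ZX) // -E subsetIl.
by move=> Y /andP[ZY YW']; rewrite subsetI ZY ZW subsetIr.
Qed.

(** The terms of [Y] and [u |: Y] cancel. This is how impossible types receive the value 0. *)
Lemma mob_vanish W G Z u : u \in W -> u \notin Z ->
  (forall Y, Z \subset Y -> Y \subset W -> G (u |: Y) = G Y) -> mob W G Z = 0.
Proof.
move=> uW uZ H; rewrite /mob (sum_toggle (u := u)) => [|Y]; last first.
  rewrite subUset sub1set uW /=; congr (_ && _).
  by rewrite -subDset (setDidPl _) // disjoint_sym disjoints1.
rewrite big1 // => Y /andP[/andP[ZY YW] uY].
rewrite setDUl (setDidPl (B := Z) (A := [set u]) _) ?disjoints1 //.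
rewrite cardsU1 inE (negbTE uY) andbF /= add1n exprS mulN1r H // mulNr subrr //.
Qed.

Lemma mob_only W G Z : Z \subset W ->
  (forall Y, Z \subset Y -> Y \subset W -> Y != Z -> G Y = 0) -> mob W G Z = G Z.
Proof.
move=> ZW H; rewrite /mob (bigD1 Z) ?subxx //= setDv cards0 expr0 mul1r.
by rewrite big1 ?addr0 // => Y /andP[/andP[ZY YW] YZ]; rewrite H ?mulr0.
Qed.

(** Inclusion and exclusion over the forbidden elements [N]. *)
Lemma sum_avoid W P N (f : {set U} -> R) : N \subset W -> P \subset W ->
  \sum_(Y : {set U} | [&& P \subset Y, [disjoint Y & N] & Y \subset W]) f Y =
  \sum_(V : {set U} | V \subset N) (-1) ^+ #|V| *
     \sum_(Y : {set U} | (P :|: V \subset Y) && (Y \subset W)) f Y.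
Proof.
move=> NW PW; under [RHS]eq_bigr do rewrite mulr_sumr.
rewrite (exchange_big_dep (fun Y => (P \subset Y) && (Y \subset W))) /=; last first.
  by move=> V Y _ /andP[/subUsetP[-> _] ->].
rewrite [RHS](bigID (fun Y => [disjoint Y & N])) /= [X in _ = _ + X]big1 ?addr0.
  apply: eq_big => [Y|Y /and3P[PY dYN YW]].
    by rewrite -andbA [X in _ && X]andbC.
  rewrite (big_pred1 set0) ?cards0 ?expr0 ?mul1r // => V /=.
  rewrite subUset PY YW andbT /=; apply/andP/eqP => [[VN VY]|->]; rewrite ?sub0set //.
  by apply/eqP; rewrite -subset0 -(disjoint_setI0 dYN) subsetI VY VN.
move=> Y /andP[/andP[PY YW] dYN]; rewrite -mulr_suml.
rewrite (_ : \sum_(_ | _) _ = (Y :&: N == set0)%:R).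
  by rewrite setI_eq0 (negbTE dYN) mul0r.
rewrite -(sum_signed (Z := set0)) ?sub0set //; apply: eq_big => [V|V _]; rewrite ?setD0 //.
by rewrite sub0set subUset PY YW andbT subsetI andbC.
Qed.

End Moebius.

Lemma mob_imset (U U' : finType) (R : comNzRingType) (e : U -> U') (W : {set U})
    (G : {set U'} -> R) (Z : {set U}) : injective e -> Z \subset W ->
  mob (e @: W) G (e @: Z) = mob W (fun Y => G (e @: Y)) Z.
Proof.
move=> ie; move: Z; apply: (mob_uniq (f := fun Z => mob _ G (e @: Z))) => Z ZW.
rewrite -(mob_zeta G (imsetS e ZW)).
rewrite (reindex_onto (fun Y : {set U} => e @: Y) (fun Y => e @^-1: Y)) /=.
  apply: eq_bigl => Y.
  have -> : e @^-1: (e @: Y) = Y.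
    by apply/setP => u; rewrite inE mem_imset.
  rewrite eqxx andbT.
  have S (A B : {set U}) : (e @: A \subset e @: B) = (A \subset B).
    apply/idP/idP => [H|AB]; last by apply: imsetS.
    by apply/subsetP => u uA; rewrite -(mem_imset _ _ ie) (subsetP H) // mem_imset.
  by rewrite !S.
move=> Y /andP[_ YW]; apply/setP => u; apply/imsetP/idP => [[v]|uY].
  by rewrite inE => vY ->.
by have /imsetP[v vW E] := subsetP YW u uY; exists v; rewrite // inE -E.
Qed.

(** * Types of an added point and their values *)

(* A point [x] added to a preorder [r] on [D] is encoded by its type, the set of the
   pairs [(d, false)] for [d] below [x] and [(d, true)] for [d] above [x]. Preorders are
   used instead of posets so that [x] may be equivalent to a point of [D], as happens in
   amalgamations. *)
Section Types.

Variable T : finType.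
Implicit Types (r : rel T) (D A B : {set T}) (Z Y : {set T * bool}) (x y : T).

(** Nothing is asked of [r] outside [D], so that one relation on [T] serves for a whole chain of
    subsets. *)
Definition preo r D :=
  [forall x in D, r x x] &&
  [forall x in D, forall y in D, forall z in D, r x y && r y z ==> r x z].

Lemma preoP r D : reflect
  ((forall x, x \in D -> r x x) /\
   (forall x y z, x \in D -> y \in D -> z \in D -> r x y -> r y z -> r x z))
  (preo r D).
Proof.
apply: (iffP andP) => -[H1 H2]; split.
- by move=> x xD; move/forall_inP: H1; apply.
- move=> x y z xD yD zD xy yz.
  move/forall_inP: H2 => /(_ x xD)/forall_inP/(_ y yD)/forall_inP/(_ z zD).
  by rewrite xy yz.
- by apply/forall_inP.
- apply/forall_inP => x xD; apply/forall_inP => y yD; apply/forall_inP => z zD.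
  by apply/implyP => /andP[]; apply: H2.
Qed.

Lemma preo_sub r D D' : D' \subset D -> preo r D -> preo r D'.
Proof.
move=> /subsetP S /preoP[H1 H2]; apply/preoP; split.
  by move=> x /S; apply: H1.
by move=> x y z /S xD /S yD /S zD; apply: H2.
Qed.

Lemma eq_preo r r' D : {in D &, r =2 r'} -> preo r D = preo r' D.
Proof.
move=> E; apply/preoP/preoP => -[H1 H2]; split.
- by move=> x xD; rewrite -E // H1.
- by move=> x y z xD yD zD; rewrite -!E //; apply: H2.
- by move=> x xD; rewrite E // H1.
- by move=> x y z xD yD zD; rewrite !E //; apply: H2.
Qed.

Definition op r : rel T := fun u v => r v u.

Lemma op_preo r D : preo (op r) D = preo r D.
Proof.
by apply/preoP/preoP => -[H1 H2]; split=> // x y z xD yD zD xy yz; apply: (H2 z y x).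
Qed.

Definition lo Z := [set d | (d, false) \in Z].
Definition hi Z := [set d | (d, true) \in Z].
Definition pairs A B : {set T * bool} :=
  [set z | if z.2 then z.1 \in B else z.1 \in A].
Definition dbl D := pairs D D.

Lemma in_dbl D z : (z \in dbl D) = (z.1 \in D).
Proof. by rewrite inE if_same. Qed.

Lemma lo_pairs A B : lo (pairs A B) = A. Proof. by apply/setP => d; rewrite !inE. Qed.
Lemma hi_pairs A B : hi (pairs A B) = B. Proof. by apply/setP => d; rewrite !inE. Qed.

Lemma pairsK Z : pairs (lo Z) (hi Z) = Z.
Proof. by apply/setP => -[d []]; rewrite !inE. Qed.

Lemma loU Z Y : lo (Z :|: Y) = lo Z :|: lo Y.
Proof. by apply/setP => d; rewrite !inE. Qed.

Lemma hiU Z Y : hi (Z :|: Y) = hi Z :|: hi Y.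
Proof. by apply/setP => d; rewrite !inE. Qed.

Lemma subset_pairs A B Z : (pairs A B \subset Z) = (A \subset lo Z) && (B \subset hi Z).
Proof.
apply/subsetP/andP => [H|[/subsetP HA /subsetP HB] [d []]].
- by split; apply/subsetP => d dA; rewrite inE; apply: H; rewrite inE.
- by rewrite inE /= => /HB; rewrite inE.
- by rewrite inE /= => /HA; rewrite inE.
Qed.

Lemma pairs_subset A B D : (pairs A B \subset dbl D) = (A \subset D) && (B \subset D).
Proof. by rewrite subset_pairs /dbl lo_pairs hi_pairs. Qed.

Lemma subset_dbl Z D : (Z \subset dbl D) = (lo Z \subset D) && (hi Z \subset D).
Proof. by rewrite -{1}(pairsK Z) pairs_subset. Qed.

Lemma dbl_sub D D' : D \subset D' -> dbl D \subset dbl D'.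
Proof. by move=> S; rewrite pairs_subset S. Qed.

Definition tp r D x :=
  [set z | (z.1 \in D) && (if z.2 then r x z.1 else r z.1 x)].

Lemma tp_sub r D x : tp r D x \subset dbl D.
Proof. by apply/subsetP => z; rewrite in_dbl inE => /andP[]. Qed.

Lemma tp_restrict r D D' x : D \subset D' -> tp r D' x :&: dbl D = tp r D x.
Proof.
move=> /subsetP S; apply/setP => -[d b]; rewrite in_setI in_dbl !inE /=.
by case dD: (d \in D); rewrite ?andbF // (S _ dD) andbT.
Qed.

Lemma eq_tp r r' D x : {in D, forall d, r d x = r' d x /\ r x d = r' x d} ->
  tp r D x = tp r' D x.
Proof.
move=> E; apply/setP => -[d b]; rewrite !inE /=.
by case dD: (d \in D) => //=; have [-> ->] := E d dD.
Qed.

Definition upd r x Z : rel T := fun u v =>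
  if u == x then (v == x) || ((v, true) \in Z)
  else if v == x then (u, false) \in Z else r u v.

Lemma upd_in r x Z D : x \notin D -> {in D &, upd r x Z =2 r}.
Proof.
move=> xD u v uD vD; rewrite /upd.
by rewrite !(negbTE (memPn xD _ _)).
Qed.

Lemma upd_lo r x Z d : d != x -> upd r x Z d x = ((d, false) \in Z).
Proof. by move=> dx; rewrite /upd (negbTE dx) eqxx. Qed.

Lemma upd_hi r x Z d : d != x -> upd r x Z x d = ((d, true) \in Z).
Proof. by move=> dx; rewrite /upd (negbTE dx) eqxx. Qed.

Lemma tp_upd r x Z D : x \notin D -> Z \subset dbl D -> tp (upd r x Z) D x = Z.
Proof.
move=> xD /subsetP ZD; apply/setP => -[d b]; rewrite !inE /=.
case dD: (d \in D) => /=.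
  have dx := memPn xD _ dD.
  by case: b; rewrite ?upd_hi ?upd_lo.
by symmetry; apply/negP => /ZD; rewrite in_dbl /= dD.
Qed.

Lemma upd_tp r x D : r x x -> {in x |: D &, upd r x (tp r D x) =2 r}.
Proof.
move=> xx u v; rewrite /upd !inE /=.
have [->|ux] := eqVneq u x; have [->|vx] := eqVneq v x => //=.
- by move=> _ ->.
- by move=> ->.
Qed.

Definition vld r D Z := [&& Z \subset dbl D,
  [forall d in D, forall e in D, r d e ==> (e \in lo Z) ==> (d \in lo Z)],
  [forall d in D, forall e in D, r d e ==> (d \in hi Z) ==> (e \in hi Z)] &
  [forall d in lo Z, forall e in hi Z, r d e]].

Lemma vldP r D Z : reflect
  [/\ Z \subset dbl D,
      forall d e, d \in D -> r d e -> e \in lo Z -> d \in lo Z,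
      forall d e, e \in D -> r d e -> d \in hi Z -> e \in hi Z &
      forall d e, d \in lo Z -> e \in hi Z -> r d e] (vld r D Z).
Proof.
apply: (iffP and4P) => -[H1 H2 H3 H4]; split=> //.
- move=> d e dD de el; have eD : e \in D.
    by move: H1; rewrite subset_dbl => /andP[/subsetP H _]; apply: H.
  by move/forall_inP: H2 => /(_ d dD)/forall_inP/(_ e eD); rewrite de el.
- move=> d e eD de dl; have dD : d \in D.
    by move: H1; rewrite subset_dbl => /andP[_ /subsetP H]; apply: H.
  by move/forall_inP: H3 => /(_ d dD)/forall_inP/(_ e eD); rewrite de dl.
- by move=> d e dl eh; move/forall_inP: H4 => /(_ d dl)/forall_inP; apply.
- apply/forall_inP => d dD; apply/forall_inP => e eD; apply/implyP => de.
  by apply/implyP; apply: H2.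
- apply/forall_inP => d dD; apply/forall_inP => e eD; apply/implyP => de.
  by apply/implyP; apply: H3.
- by apply/forall_inP => d dD; apply/forall_inP => e eD; apply: H4.
Qed.

Lemma eq_vld r r' D Z : {in D &, r =2 r'} -> vld r D Z = vld r' D Z.
Proof.
wlog suff H : r r' / {in D &, r =2 r'} -> vld r D Z -> vld r' D Z.
  by move=> E; apply/idP/idP; apply: H => // u v uD vD; rewrite E.
move=> E /vldP[h1 h2 h3 h4].
have /andP[/subsetP lD /subsetP hD] : (lo Z \subset D) && (hi Z \subset D).
  by rewrite -subset_dbl.
apply/vldP; split=> //.
- by move=> d e dD de el; apply: (h2 d e) => //; rewrite E // lD.
- by move=> d e eD de dh; apply: (h3 d e) => //; rewrite E // hD.
- by move=> d e dl eh; rewrite -(E d e (lD _ dl) (hD _ eh)); apply: h4.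
Qed.

(** Transitivity of triples with [x] in the last, the first and the middle place gives the three
    closure clauses of [vld], in this order; reflexivity at [x] is built into [upd]. *)
Lemma upd_preo r x Z D : preo r D -> x \notin D -> Z \subset dbl D ->
  preo (upd r x Z) (x |: D) = vld r D Z.
Proof.
move=> pr xD ZD; have /preoP[rr rt] := pr.
have /andP[/subsetP loD /subsetP hiD] : (lo Z \subset D) && (hi Z \subset D).
  by rewrite -subset_dbl.
have U : {in D &, upd r x Z =2 r} by apply: upd_in.
have UL d : d \in D -> upd r x Z d x = (d \in lo Z).
  by move=> dD; rewrite upd_lo ?inE // (memPn xD).
have UH d : d \in D -> upd r x Z x d = (d \in hi Z).
  by move=> dD; rewrite upd_hi ?inE // (memPn xD).
have xx : upd r x Z x x by rewrite /upd eqxx.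
apply/preoP/vldP => [[H1 H2]|[_ H1 H2 H3]]; split=> //.
- move=> d e dD de el; have eD := loD _ el; rewrite -UL //.
  by apply: (H2 d e x); rewrite ?in_setU1 ?dD ?eD ?eqxx ?orbT ?UL ?U.
- move=> d e eD de dh; have dD := hiD _ dh; rewrite -UH //.
  by apply: (H2 x d e); rewrite ?in_setU1 ?dD ?eD ?eqxx ?orbT ?UH ?U.
- move=> d e dl eh; have dD := loD _ dl; have eD := hiD _ eh; rewrite -U //.
  by apply: (H2 d x e); rewrite ?in_setU1 ?dD ?eD ?eqxx ?orbT ?UL ?UH.
- by move=> d /setU1P[->//|dD]; rewrite U // rr.
- move=> a b c /setU1P[->|aD] /setU1P[->|bD] /setU1P[->|cD] //.
  + by rewrite !UH // U // => bh bc; apply: H2 bh.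
  + by rewrite !UL // UH // U // => al ch; apply: H3.
  + by rewrite U // !UL // => ab bl; apply: H1 bl.
  + by rewrite !U //; apply: rt.
Qed.

Lemma vld_tp r D x : preo r (x |: D) -> vld r D (tp r D x).
Proof.
move=> /preoP[rr rt]; have xx : x \in x |: D by rewrite setU11.
have S d : d \in D -> d \in x |: D by rewrite in_setU1 orbC => ->.
apply/vldP; split; first exact: tp_sub.
- move=> d e dD de; rewrite !inE /= dD => /andP[eD ex]; by apply: (rt d e x); rewrite ?xx ?S.
- move=> d e eD de; rewrite !inE /= eD => /andP[dD xd]; by apply: (rt x d e); rewrite ?xx ?S.
- by move=> d e; rewrite !inE /= => /andP[dD dx] /andP[eD xe]; apply: (rt d x e); rewrite ?xx ?S.
Qed.

(* The number of maximal classes of [A], with all numbers above 1 replaced by 2. *)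
Definition kap r A : nat :=
  if A == set0 then 0 else if [exists a in A, forall c in A, r c a] then 1 else 2.

Variant kap_spec r A : nat -> Prop :=
| Kap0 of A = set0 : kap_spec r A 0
| Kap1 a of a \in A & (forall c, c \in A -> r c a) : kap_spec r A 1
| Kap2 a of a \in A & (forall a, a \in A -> exists2 c, c \in A & ~~ r c a) :
   kap_spec r A 2.

Lemma kapP r A : kap_spec r A (kap r A).
Proof.
rewrite /kap; case: eqVneq => [|/set0Pn[a aA]]; first exact: Kap0.
case: ifP => [/existsP[b /andP[bA /forall_inP H]]|H]; first exact: Kap1 bA H.
apply: (Kap2 aA) => b bA; move/existsPn/(_ b): (negbT H).
by rewrite bA /= => /forall_inPn[c cA]; exists c.
Qed.

Lemma kap_set0 r : kap r set0 = 0%N. Proof. by rewrite /kap eqxx. Qed.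

Lemma kap_max r A a : a \in A -> (forall c, c \in A -> r c a) -> kap r A = 1%N.
Proof.
move=> aA H; case: kapP => [A0|//|b bA /(_ a aA)[c /H ->]//].
by rewrite A0 inE in aA.
Qed.

Lemma kap_nomax r A a : a \in A -> (forall a, a \in A -> exists2 c, c \in A & ~~ r c a) ->
  kap r A = 2%N.
Proof.
move=> aA H; case: kapP => [A0|b bA H'|//]; first by rewrite A0 inE in aA.
by have [c /H' ->] := H b bA.
Qed.

Definition lea r A B := [forall a in A, forall b in B, r a b].
Definition meets r A B := [exists a in A, exists b in B, r b a].

Lemma leaP r A B : reflect (forall a b, a \in A -> b \in B -> r a b) (lea r A B).
Proof.
apply: (iffP forall_inP) => [H a b aA bB|H a aA].
  by have /forall_inP/(_ b bB) := H a aA.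
by apply/forall_inP => b bB; apply: H.
Qed.

Lemma meetsP r A B : reflect (exists a b, [/\ a \in A, b \in B & r b a]) (meets r A B).
Proof.
apply: (iffP existsP) => [[a /andP[aA /existsP[b /andP[bB ba]]]]|[a [b [aA bB ba]]]].
  by exists a, b.
by exists a; rewrite aA /=; apply/existsP; exists b; rewrite bB.
Qed.

Lemma meets_op r A B : meets (op r) B A = meets r A B.
Proof. by apply/meetsP/meetsP => -[a [b [H1 H2 H3]]]; exists b, a. Qed.

Lemma lea_op r A B : lea (op r) B A = lea r A B.
Proof. by apply/leaP/leaP => H a b aA bB; apply: H. Qed.

Lemma eq_kap r r' A : {in A &, r =2 r'} -> kap r A = kap r' A.
Proof.
move=> E; case: (kapP r A) => [->|a aA H|a aA H]; rewrite ?kap_set0 //; symmetry.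
  by apply: (kap_max aA) => c cA; rewrite -E // H.
apply: (kap_nomax aA) => b bA; have [c cA rcb] := H b bA.
by exists c; rewrite -?E.
Qed.

Variables (R : comNzRingType).
Implicit Types g : nat -> nat -> R.

(* [G g r A B] is the total value of the types of points [x] with A <= x <= B: such an
   [x] is equivalent to a point of [A] if [A] meets [B], and otherwise the total only
   depends on the maximal classes of [A] and the minimal classes of [B]. The value [mz]
   of a single type is recovered by Moebius inversion. *)
Definition G g r A B : R :=
  if lea r A B then
    if meets r A B then 1 else g (kap r A) (kap (op r) B)
  else 0.
Definition Gz g r Z : R := G g r (lo Z) (hi Z).
Definition mz g r D Z : R := mob (dbl D) (Gz g r) Z.
Definition mx g r D x : R := mz g r D (tp r D x).

Lemma eq_G g r r' A B : {in A :|: B &, r =2 r'} -> G g r A B = G g r' A B.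
Proof.
move=> E.
have EA : {in A &, r =2 r'} by move=> u v uA vA; rewrite E // inE ?uA ?vA.
have EB : {in B &, op r =2 op r'}.
  by move=> u v uA vA; rewrite /op E // inE ?uA ?vA orbT.
have EAB u v : u \in A -> v \in B -> r u v = r' u v /\ r v u = r' v u.
  by move=> uA vB; rewrite !E // inE ?uA ?vB ?orbT.
rewrite /G (eq_kap EA) (eq_kap EB).
have -> : lea r A B = lea r' A B.
  apply/leaP/leaP => H a b aA bB; have := H a b aA bB;
  by have [-> _] := EAB a b aA bB.
suff -> : meets r A B = meets r' A B by [].
apply/meetsP/meetsP => -[a [b [aA bB ba]]]; exists a, b; split=> //; have [_ E1] := EAB a b aA bB;
  by rewrite ?E1 -?E1 in ba *.
Qed.

Lemma eq_mz g r r' D Z : {in D &, r =2 r'} -> mz g r D Z = mz g r' D Z.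
Proof.
move=> E; apply: eq_mob => Y _; rewrite subset_dbl => /andP[/subsetP lD /subsetP hD].
apply: eq_G => u v /setUP[/lD uD|/hD uD] /setUP[/lD vD|/hD vD]; exact: E.
Qed.

Lemma G0 g r A B : ~~ lea r A B -> G g r A B = 0.
Proof. by rewrite /G => /negbTE ->. Qed.

(** [G] sees its arguments only up to down-closure of the first and up-closure of the second, so a
    pair forced by [Z] but missing from it can be toggled. If instead [lo Z] is not below [hi Z],
    every term is 0. *)
Lemma mz_vld0 g r D Z : preo r D -> Z \subset dbl D -> ~~ vld r D Z -> mz g r D Z = 0.
Proof.
move=> /preoP[rr rt] ZD; rewrite /vld ZD /= !negb_and => /or3P[H|H|H].
- move/forall_inPn: H => [d dD] /forall_inPn[e eD].
  rewrite !negb_imply !inE => /and3P[de el dl].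
  apply: (mob_vanish (u := (d, false))); rewrite ?in_dbl // => Y ZY YD.
  have eY : (e, false) \in Y by apply: (subsetP ZY).
  have /andP[/subsetP LD /subsetP HD] : (lo Y \subset D) && (hi Y \subset D).
    by rewrite -subset_dbl.
  rewrite /Gz; set Y' := _ |: Y.
  have -> : hi Y' = hi Y by apply/setP => c; rewrite !inE xpair_eqE andbF.
  have -> : lo Y' = d |: lo Y by apply/setP => c; rewrite !inE xpair_eqE andbT.
  have eL : e \in lo Y by rewrite inE.
  have leaE : lea r (d |: lo Y) (hi Y) = lea r (lo Y) (hi Y).
    apply/leaP/leaP => H a b; first by move=> aA; apply: H; rewrite in_setU1 aA orbT.
    move=> /setU1P[->|aA] bB; last exact: H.
    by apply: rt (H e b eL bB) => //; apply: HD.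
  rewrite /G leaE; case: leaP => // LEA.
  have -> : meets r (d |: lo Y) (hi Y) = meets r (lo Y) (hi Y).
    apply/meetsP/meetsP => -[a [b [aA bB ba]]]; last first.
      by exists a, b; split=> //; rewrite in_setU1 aA orbT.
    move/setU1P: aA => [ad|aA]; last by exists a, b.
    by exists e, b; split=> //; apply: rt de => //; [apply: HD|rewrite -ad].
  suff -> : kap r (d |: lo Y) = kap r (lo Y) by [].
  case: (kapP r (lo Y)) => [E|a aA Ha|a aA Ha]; first by rewrite E inE in eL.
    have aD := LD _ aA; apply: (kap_max (a := a)); first by rewrite in_setU1 aA orbT.
    move=> c /setU1P[->|/Ha //]; apply: rt de _ => //; exact: Ha.
  apply: (kap_nomax (a := a)) => [|b]; first by rewrite in_setU1 aA orbT.
  move=> /setU1P[->|bA].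
    have [c cA ce] := Ha e eL; exists c; rewrite ?in_setU1 ?cA ?orbT //.
    by apply: contra ce => cd; apply: rt de => //; apply: LD.
  by have [c cA cb] := Ha b bA; exists c; rewrite // in_setU1 cA orbT.
- move/forall_inPn: H => [d dD] /forall_inPn[e eD].
  rewrite !negb_imply !inE => /and3P[de el dl].
  apply: (mob_vanish (u := (e, true))); rewrite ?in_dbl // => Y ZY YD.
  have eY : (d, true) \in Y by apply: (subsetP ZY).
  have /andP[/subsetP LD /subsetP HD] : (lo Y \subset D) && (hi Y \subset D).
    by rewrite -subset_dbl.
  rewrite /Gz; set Y' := _ |: Y.
  have -> : lo Y' = lo Y by apply/setP => c; rewrite !inE xpair_eqE andbF.
  have -> : hi Y' = e |: hi Y by apply/setP => c; rewrite !inE xpair_eqE andbT.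
  have dH : d \in hi Y by rewrite inE.
  have leaE : lea r (lo Y) (e |: hi Y) = lea r (lo Y) (hi Y).
    apply/leaP/leaP => H a b aA; first by move=> bB; apply: H; rewrite // in_setU1 bB orbT.
    move=> /setU1P[->|bB]; last exact: H.
    by apply: rt (H a d aA dH) de => //; apply: LD.
  rewrite /G leaE; case: leaP => // LEA.
  have -> : meets r (lo Y) (e |: hi Y) = meets r (lo Y) (hi Y).
    apply/meetsP/meetsP => -[a [b [aA bB ba]]]; last first.
      by exists a, b; split=> //; rewrite in_setU1 bB orbT.
    move/setU1P: bB => [be|bB]; last by exists a, b.
    by exists a, d; split=> //; apply: rt de _ => //; [apply: LD|rewrite -be].
  suff -> : kap (op r) (e |: hi Y) = kap (op r) (hi Y) by [].
  case: (kapP (op r) (hi Y)) => [E|a aA Ha|a aA Ha]; first by rewrite E inE in dH.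
    have aD := HD _ aA; apply: (kap_max (a := a)); first by rewrite in_setU1 aA orbT.
    move=> c /setU1P[->|/Ha //]; apply: rt de => //; exact: (Ha d).
  apply: (kap_nomax (a := a)) => [|b]; first by rewrite in_setU1 aA orbT.
  move=> /setU1P[->|bA].
    have [c cA ce] := Ha d dH; exists c; rewrite ?in_setU1 ?cA ?orbT //.
    by apply: contra ce => cd; apply: rt de cd => //; apply: HD.
  by have [c cA cb] := Ha b bA; exists c; rewrite // in_setU1 cA orbT.
- move/forall_inPn: H => [d dl] /forall_inPn[e eh de].
  rewrite /mz /mob big1 // => Y /andP[ZY YD]; rewrite /Gz G0 ?mulr0 //.
  apply: contra de => /leaP H; rewrite !inE in dl eh.
  by apply: H; rewrite inE; apply: (subsetP ZY).
Qed.

Lemma mz_zeta g r D Z : Z \subset dbl D ->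
  \sum_(Y : {set T * bool} | (Z \subset Y) && (Y \subset dbl D)) mz g r D Y = Gz g r Z.
Proof. exact: mob_zeta. Qed.

(** A sum of values of types weighted by the indicator of further relations collapses to one value
    of [G]. All later sums are brought to this form. *)
Lemma mz_ind g r D Z Y : Z \subset dbl D -> Y \subset dbl D ->
  \sum_(X : {set T * bool} | (Z \subset X) && (X \subset dbl D))
    mz g r D X * (Y \subset X)%:R = Gz g r (Z :|: Y).
Proof.
move=> ZD YD; have ZYD : Z :|: Y \subset dbl D by rewrite subUset ZD.
rewrite -(mz_zeta g r ZYD) (bigID (fun X : {set T * bool} => Y \subset X)) /= [X in _ + X]big1 ?addr0; last first.
  by move=> X /andP[_ /negbTE ->]; rewrite mulr0.
apply: eq_big => [X|X /andP[_ ->]]; last by rewrite mulr1.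
by rewrite subUset -!andbA [_ && (Y \subset X)]andbC.
Qed.

(** Since [d] is both a lower and an upper bound in the type of [x], a larger set of pairs violates
    [lea]: only the first term of the Moebius sum is nonzero. *)
Lemma mx_dup g r D x d : preo r (x |: D) -> d \in D -> r d x -> r x d ->
  mx g r D x = 1.
Proof.
move=> pr dD dx xd; have /preoP[rr rt] := pr.
have xx : x \in x |: D by rewrite setU11.
have S e : e \in D -> e \in x |: D by rewrite in_setU1 orbC => ->.
rewrite /mx /mz mob_only ?tp_sub //.
  rewrite /Gz /G.
  have -> : lea r (lo (tp r D x)) (hi (tp r D x)).
    by apply/leaP; have /vldP[] := vld_tp pr.
  case: meetsP => // -[]; exists d, d; rewrite !inE /= dD dx xd; split=> //.
  exact/rr/S.
move=> Y ZY YD YZ; rewrite /Gz G0 //; apply: contra YZ => /leaP H.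
rewrite eqEsubset ZY andbT; apply/subsetP => -[e b] eY.
have := subsetP YD _ eY; rewrite in_dbl /= => eD; rewrite inE /= eD /=.
case: b eY => eY.
  apply: (rt x d e); rewrite ?xx ?S //; apply: H; rewrite inE //.
  by apply: (subsetP ZY); rewrite inE /= dD.
apply: (rt e d x); rewrite ?xx ?S //; apply: H; rewrite inE //.
by apply: (subsetP ZY); rewrite inE /= dD.
Qed.

Lemma mz_restrict g r D D' Z : D \subset D' -> Z \subset dbl D ->
  \sum_(Y : {set T * bool} | (Y \subset dbl D') && (Y :&: dbl D == Z)) mz g r D' Y
  = mz g r D Z.
Proof. by move=> S; apply: mob_restrict; apply: dbl_sub. Qed.

Lemma eq_mx g r r' D x : {in x |: D &, r =2 r'} -> mx g r D x = mx g r' D x.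
Proof.
move=> E; have S e : e \in D -> e \in x |: D by rewrite in_setU1 orbC => ->.
have xx : x \in x |: D by rewrite setU11.
rewrite /mx (eq_tp (r' := r')); last by move=> d dD; rewrite !E ?xx ?S.
by apply: eq_mz => u v uD vD; rewrite E ?S.
Qed.

(** A valid type over [c |: D] treats [c] like the equivalent point [d], so a single term of
    [mz_restrict] survives. *)
Lemma mx_add_dup g r D c d x : preo r (x |: (c |: D)) -> d \in D -> c \notin D ->
  r d c -> r c d -> mx g r (c |: D) x = mx g r D x.
Proof.
move=> pr dD cD dc cd; have /preoP[rr rt] := pr.
have SD e : e \in D -> e \in c |: D by rewrite in_setU1 orbC => ->.
have S e : e \in D -> e \in x |: (c |: D) by move=> /SD; rewrite !in_setU1 => ->; rewrite orbT.
have xS : x \in x |: (c |: D) by rewrite setU11.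
have cS : c \in x |: (c |: D) by rewrite !inE eqxx orbT.
rewrite {2}/mx -(mz_restrict g r (subsetUr [set c] D)) ?tp_sub //.
rewrite (bigD1 (tp r (c |: D) x)) ?tp_sub /=; last first.
  by rewrite tp_restrict ?subsetUr.
rewrite [X in _ + X]big1 ?addr0 // => Y /andP[/andP[YD /eqP YE] Yne].
apply: mz_vld0 => //; first by apply: preo_sub pr; apply: subsetUr.
apply: contra Yne => /vldP[_ V1 V2 _].
have /setP EE := YE; apply/eqP/setP => -[e b].
have [->|ec] := eqVneq e c; last first.
  have := EE (e, b); rewrite !inE /= (negbTE ec) /= => <-.
  case: (boolP (e \in D)) => eD; rewrite ?if_same ?andbT ?andbF ?eD //=.
  apply/negP => /(subsetP YD); rewrite in_dbl in_setU1 (negbTE ec) /= (negbTE eD) //.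
rewrite inE /= setU11 /=.
have Ed : ((d, b) \in Y) = (if b then r x d else r d x).
  by have := EE (d, b); rewrite !inE /= dD if_same andbT => ->.
case: b Ed => Ed.
  have -> : r x c = r x d by apply/idP/idP => H; apply: rt H _; rewrite ?xS ?cS ?S.
  rewrite -Ed; have := V2 d c (setU11 _ _) dc; have := V2 c d (SD _ dD) cd.
  by rewrite !inE => A B; apply/idP/idP.
have -> : r c x = r d x by apply/idP/idP => H; apply: rt H; rewrite ?xS ?cS ?S.
rewrite -Ed; have := V1 d c (SD _ dD) dc; have := V1 c d (setU11 _ _) cd.
by rewrite !inE => A B; apply/idP/idP.
Qed.

End Types.

Lemma G_imset (T T' : finType) (R : comNzRingType) (g : nat -> nat -> R)
    (f : T -> T') (r : rel T) (r' : rel T') A B :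
  {in A :|: B &, forall u v, r u v = r' (f u) (f v)} ->
  G g r' (f @: A) (f @: B) = G g r A B.
Proof.
move=> E.
have EA : {in A &, forall u v, r u v = r' (f u) (f v)}.
  by move=> u v uA vA; rewrite E // inE ?uA ?vA.
have EB : {in B &, forall u v, r u v = r' (f u) (f v)}.
  by move=> u v uA vA; rewrite E // inE ?uA ?vA orbT.
have EAB u v : u \in A -> v \in B ->
    r u v = r' (f u) (f v) /\ r v u = r' (f v) (f u).
  by move=> uA vB; rewrite !E // inE ?uA ?vB ?orbT.
have K (A1 : {set T}) s s' : {in A1 &, forall u v, s u v = s' (f u) (f v)} ->
    kap s' (f @: A1) = kap s A1.
  move=> E1; case: (kapP s A1) => [->|a aA H|a aA H].
  - by rewrite imset0 kap_set0.
  - apply: (kap_max (imset_f f aA)) => _ /imsetP[c cA ->]; rewrite -E1 //; exact: H.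
  - apply: (kap_nomax (imset_f f aA)) => _ /imsetP[b bA ->].
    by have [c cA cb] := H b bA; exists (f c); rewrite ?imset_f // -E1.
rewrite /G (K _ _ _ EA) (K _ (op r) (op r')); last first.
  by move=> u v uB vB; rewrite /op EB.
have -> : lea r' (f @: A) (f @: B) = lea r A B.
  apply/leaP/leaP => [H a b aA bB|H _ _ /imsetP[a aA ->] /imsetP[b bB ->]].
    by have [-> _] := EAB a b aA bB; rewrite H ?imset_f.
  by have [<- _] := EAB a b aA bB; apply: H.
suff -> : meets r' (f @: A) (f @: B) = meets r A B by [].
apply/meetsP/meetsP => [[_ [_ [/imsetP[a aA ->] /imsetP[b bB ->] H]]]|[a [b [aA bB H]]]].
  by exists a, b; split=> //; have [_ ->] := EAB a b aA bB.
by exists (f a), (f b); rewrite !imset_f //; have [_ <-] := EAB a b aA bB.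
Qed.

Lemma mx_imset (T T' : finType) (R : comNzRingType) (g : nat -> nat -> R)
    (f : T -> T') (r : rel T) (r' : rel T') D x : injective f ->
  {in x |: D &, forall u v, r u v = r' (f u) (f v)} ->
  mx g r' (f @: D) (f x) = mx g r D x.
Proof.
move=> fi E.
pose e (z : T * bool) := (f z.1, z.2).
have ei : injective e by move=> [a b] [a' b'] [/fi -> ->].
have S c : c \in D -> c \in x |: D by rewrite in_setU1 orbC => ->.
have xS : x \in x |: D by rewrite setU11.
have PE (A B : {set T}) : pairs (f @: A) (f @: B) = e @: pairs A B.
  apply/setP => -[t b]; apply/idP/imsetP.
    rewrite inE /=; case: b => /imsetP[c cA ->]; [exists (c, true)|exists (c, false)];
    by rewrite ?inE.
  by move=> [[c b']]; rewrite inE /e /= => H [-> ->]; case: b' H => H; rewrite inE /= imset_f.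
have Lo (Y : {set T * bool}) : lo (e @: Y) = f @: lo Y by rewrite -{1}(pairsK Y) -PE lo_pairs.
have Hi (Y : {set T * bool}) : hi (e @: Y) = f @: hi Y by rewrite -{1}(pairsK Y) -PE hi_pairs.
have -> : mx g r' (f @: D) (f x) = mz g r' (f @: D) (e @: tp r D x).
  congr (mz _ _ _); apply/setP => -[t b]; apply/idP/imsetP.
    rewrite inE /= => /andP[/imsetP[c cD ->] H]; exists (c, b) => //.
    by rewrite inE /= cD !E ?xS ?S.
  move=> [[c b']]; rewrite inE /e /= => /andP[cD H] [-> ->].
  by rewrite inE /= imset_f //= -!E ?xS ?S.
rewrite /mx /mz /dbl PE mob_imset ?tp_sub //; apply: eq_mob => Y _ YD.
rewrite /Gz Lo Hi; apply: G_imset.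
move: YD; rewrite subset_dbl => /andP[/subsetP l /subsetP h] u v.
by move=> /setUP[/l|/h] uD /setUP[/l|/h] vD; apply: E; apply: S.
Qed.

(** * Total values of pairs of added points *)

Section Eval.

Variable T : finType.
Implicit Types (r : rel T) (D A B : {set T}) (Z Y : {set T * bool}) (x y : T).

Definition wit r A : option T := [pick a in A | [forall c in A, r c a]].

Variant wit_spec r A : nat -> option T -> Prop :=
| Wit0 of A = set0 : wit_spec r A 0 None
| Wit1 a of a \in A & (forall c, c \in A -> r c a) : wit_spec r A 1 (Some a)
| Wit2 a of a \in A & (forall a, a \in A -> exists2 c, c \in A & ~~ r c a) :
   wit_spec r A 2 None.

Lemma witP r A : wit_spec r A (kap r A) (wit r A).
Proof.
rewrite /wit; case: pickP => [a /andP[aA /forall_inP H]|H].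
  by rewrite (kap_max aA H); apply: Wit1.
case: kapP => [A0|a aA Ha|a aA Ha]; [exact: Wit0| |exact: Wit2 aA Ha].
by have := H a; rewrite aA => /negP[]; apply/forall_inP.
Qed.

Variable R : comNzRingType.
Add Ring R_ring : (comNzRing_theory R).
Ltac mring := rewrite /= ?mulr1n ?mulr0n; rfold R; ring.
Implicit Types g : nat -> nat -> R.

(* The total value of the pairs of points [x], [y] with A <= x <= B, A' <= y <= B' and
   x <= y, when [x] is added first; see [Eval]. *)
Definition Lval g r A B A' B' : R :=
  let u p := g p (kap (op r) B') in
  let X := B :|: B' in
  if ~~ lea r A' B' then 0 else
  if meets r A' B' then G g r A X else
  (if A' == set0 then u 1%N * G g r A X else
   u 2%N * G g r A X + (u 1%N - u 2%N) * (G g r (A :|: A') X +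
     if wit r A' is Some a then G g r A (a |: X) - G g r (A :|: A') (a |: X) else 0))
  + if wit (op r) B' is Some b then (1 - u 1%N) * G g r (b |: A) X else 0.

(** For nonempty [A], the set [x |: A] has one maximal class exactly when [x] lies above all of [A]
    or below its greatest class; the subtracted indicator corrects for both happening at once. If
    the least class of [B] lies below [x], then [x |: A] meets [B], and the last summand raises the
    value to 1. Everything is now linear in indicators of relations in [Z], ready for [mz_ind]. *)
Lemma G_upd_lo g r D x Z A B : preo r D -> x \notin D -> vld r D Z ->
  A \subset D -> B \subset D ->
  G g (upd r x Z) (x |: A) B =
  if ~~ lea r A B then 0 else
  (pairs set0 B \subset Z)%:R *
  (if meets r A B then 1 else
   (if A == set0 then g 1%N (kap (op r) B) else
     g 2%N (kap (op r) B) + (g 1%N (kap (op r) B) - g 2%N (kap (op r) B)) *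
      ((A \subset lo Z)%:R +
       if wit r A is Some a then (a \in hi Z)%:R - ((A \subset lo Z) && (a \in hi Z))%:R
       else 0))
   + if wit (op r) B is Some b then (1 - g 1%N (kap (op r) B)) * (b \in lo Z)%:R else 0).
Proof.
move=> pr xD vZ /subsetP AD /subsetP BD; have /preoP[rr rt] := pr.
have /vldP[ZD V1 V2 V3] := vZ.
set r' := upd r x Z.
have U : {in D &, r' =2 r} by apply: upd_in.
have UL d : d \in D -> r' d x = (d \in lo Z).
  by move=> dD; rewrite /r' upd_lo ?inE // (memPn xD).
have UH d : d \in D -> r' x d = (d \in hi Z).
  by move=> dD; rewrite /r' upd_hi ?inE // (memPn xD).
have xx : r' x x by rewrite /r' /upd eqxx.
have UAB a b : a \in A -> b \in B -> (r' a b = r a b) * (r' b a = r b a).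
  by move=> aA bB; rewrite !U //; [apply: BD|apply: AD|apply: AD|apply: BD].
have LE : lea r' (x |: A) B = lea r A B && (B \subset hi Z).
  apply/leaP/andP => [H|[/leaP H /subsetP HB] a b /setU1P[->|aA] bB].
  - split; first by apply/leaP => a b aA bB; rewrite -(U a b (AD _ aA) (BD _ bB)) H // setU1r.
    by apply/subsetP => b bB; rewrite -(UH b (BD _ bB)) H // setU11.
  - by rewrite UH ?BD // HB.
  - by rewrite UAB // H.
rewrite {1}/G LE; case: leaP => //= HAB.
rewrite subset_pairs sub0set /=; case: (boolP (B \subset hi Z)) => [/subsetP Bh|_];
  last by rewrite mul0r.
rewrite mul1r.
have kB : kap (op r') B = kap (op r) B.
  by apply: eq_kap => u v uB vB; rewrite /op U ?BD.
rewrite kB.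
case: (meetsP r A B) => [[a [b [aA bB ba]]]|NM].
  have M : meets r' (x |: A) B by apply/meetsP; exists a, b; rewrite setU1r // (UAB a b aA bB).2.
  by rewrite M.
have Mx b : b \in B -> b \in lo Z -> forall c, c \in B -> r b c.
  by move=> bB bl c cB; exact: V3 bl (Bh _ cB).
have ME : meets r' (x |: A) B = [exists b in B, b \in lo Z].
  apply/meetsP/existsP => [[a [b [/setU1P[->|aA] bB]]]|[b /andP[bB bl]]].
  - by rewrite UL ?BD // => bl; exists b; rewrite bB.
  - by rewrite (UAB a b aA bB).2 => ba; case: NM; exists a, b.
  - by exists x, b; rewrite setU11 UL ?BD.
have kx : A != set0 -> (A \subset lo Z) \/ (exists2 a, wit r A = Some a & a \in hi Z) ->
    kap r' (x |: A) = 1%N.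
  move=> A0 [/subsetP Al|[a]].
    apply: (kap_max (a := x)); rewrite ?setU11 // => c /setU1P[->//|cA].
    by rewrite UL ?Al ?AD.
  case: witP => // a' aA Ha [<-] ah; apply: (kap_max (a := a')); first exact: setU1r.
  by move=> c /setU1P[->|cA]; rewrite ?UH ?U ?AD // Ha.
have kx2 : A != set0 -> ~~ (A \subset lo Z) ->
    (forall a, wit r A = Some a -> a \notin hi Z) -> kap r' (x |: A) = 2%N.
  move=> A0 /subsetPn[a aA al] H; apply: (kap_nomax (a := x)); rewrite ?setU11 // => b.
  move=> /setU1P[->|bA]; first by exists a; rewrite ?setU1r // UL ?AD.
  case: witP H A0 => [-> _|a' aA' Ha' H|a' aA' Ha' H] A0.
  - by rewrite eqxx in A0.
  - have := H _ erefl => ah; exists x; rewrite ?setU11 // UH ?AD //.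
    by apply: contra ah => bh; apply: V2 (Ha' _ bA) bh; apply: AD.
  - by have [c cA cb] := Ha' b bA; exists c; rewrite ?setU1r // U ?AD.
rewrite ME; case: existsP => [[b /andP[bB bl]]|NE].
  have bmin c : c \in B -> r b c by apply: Mx.
  have [b' [-> b'l]] : exists b', wit (op r) B = Some b' /\ b' \in lo Z.
    case: witP => [B0|b' b'B Hb'|b' _ /(_ b bB)[c cB]]; first by rewrite B0 inE in bB.
      by exists b'; split=> //; apply: V1 (Hb' _ bB) bl; apply: BD.
    by rewrite /op bmin.
  rewrite b'l mulr1; case: eqVneq => [A0|A0]; first by rewrite addrC subrK.
  have Al : A \subset lo Z.
    by apply/subsetP => a aA; apply: V1 (HAB a b aA bB) bl; apply: AD.
  rewrite Al /=; case: (wit r A) => [a|]; rewrite ?subrr; mring.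
have NB b : wit (op r) B = Some b -> b \notin lo Z.
  case: witP => // b' b'B _ [<-]; apply/negP => bl; case: NE; exists b'.
  by rewrite b'B.
have -> : (if wit (op r) B is Some b then (1 - g 1%N (kap (op r) B)) * (b \in lo Z)%:R
   else 0) = 0.
  by case: (wit (op r) B) NB => // b /(_ _ erefl)/negbTE ->; rewrite mulr0.
rewrite addr0; case: eqVneq => [A0|A0].
  by rewrite A0 (kap_max (a := x)) ?setU11 // => c; rewrite setU0 => /set1P ->.
case: (boolP (A \subset lo Z)) => Al.
  rewrite kx; [|by []|by left]; case: (wit r A) => [a|] /=; rewrite ?subrr; mring.
case W : (wit r A) => [a|] /=.
  case: (boolP (a \in hi Z)) => ah.
    by rewrite kx //; [mring|right; exists a].
  by rewrite kx2 //; [mring|move=> a' /eqP; rewrite W => /eqP [<-]].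
by rewrite kx2 //; [mring|rewrite W].
Qed.

(** Each indicator of [G_upd_lo] turns into one value of [G] by [mz_ind]; for types that are not
    valid both integrands are 0. *)
Lemma Eval g r D x A B A' B' : preo r D -> x \notin D ->
  A \subset D -> B \subset D -> A' \subset D -> B' \subset D ->
  \sum_(Z : {set T * bool} | (pairs A B \subset Z) && (Z \subset dbl D))
     mz g r D Z * G g (upd r x Z) (x |: A') B' = Lval g r A B A' B'.
Proof.
move=> pr xD AD BD A'D B'D; rewrite /Lval.
set u := fun p => g p (kap (op r) B').
have PD (P Q : {set T}) : P \subset D -> Q \subset D -> pairs P Q \subset dbl D.
  by rewrite pairs_subset => -> ->.
have GzE (P Q : {set T}) : P \subset D -> Q \subset D ->
  \sum_(Z : {set T * bool} | (pairs A B \subset Z) && (Z \subset dbl D))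
     mz g r D Z * (pairs P Q \subset Z)%:R = G g r (A :|: P) (B :|: Q).
  by move=> PQ QD; rewrite mz_ind ?PD // /Gz loU hiU !lo_pairs !hi_pairs.
transitivity (\sum_(Z : {set T * bool} | (pairs A B \subset Z) && (Z \subset dbl D))
  mz g r D Z * (if ~~ lea r A' B' then 0 else
   if meets r A' B' then (pairs set0 B' \subset Z)%:R else
   (if A' == set0 then u 1%N * (pairs set0 B' \subset Z)%:R else
    u 2%N * (pairs set0 B' \subset Z)%:R + (u 1%N - u 2%N) *
    ((pairs A' B' \subset Z)%:R +
     if wit r A' is Some a then (pairs set0 (a |: B') \subset Z)%:R
        - (pairs A' (a |: B') \subset Z)%:R else 0)) +
    if wit (op r) B' is Some b then (1 - u 1%N) * (pairs [set b] B' \subset Z)%:R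
    else 0)).
  apply: eq_bigr => Z /andP[_ ZD]; case: (boolP (vld r D Z)) => [vZ|nvZ]; last first.
    by rewrite mz_vld0 // !mul0r.
  congr (_ * _); rewrite (G_upd_lo _ pr) //.
  case: (lea r A' B') => //=; case: (meets r A' B') => /=; first by rewrite mulr1.
  rewrite !subset_pairs sub0set /=.
  by case: (A' == set0); case: (wit r A') => [a|]; case: (wit (op r) B') => [b|];
    rewrite ?subset_pairs ?subUset ?sub1set ?sub0set; case: (B' \subset hi Z);
    rewrite ?andbT ?andbF; rewrite /u; mring.
case: (boolP (lea r A' B')) => /= LE; last by rewrite big1 // => Z _; rewrite mulr0.
case: ifP => ME; first by rewrite GzE ?sub0set // setU0.
have Ha a : wit r A' = Some a -> a |: B' \subset D.
  case: witP => // a' aA _ [<-]; rewrite subUset sub1set B'D andbT.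
  exact: (subsetP A'D).
have Hb b : wit (op r) B' = Some b -> [set b] \subset D.
  case: witP => // a' aA _ [<-]; rewrite sub1set; exact: (subsetP B'D).
have setUC' a : a |: (B :|: B') = B :|: (a |: B') by rewrite setUCA.
have setUC'' b : b |: A = A :|: [set b] by rewrite setUC.
have F0 : G g r A (B :|: B') = G g r (A :|: set0) (B :|: B') by rewrite setU0.
under eq_bigr do rewrite mulrDr; rewrite big_split /=; congr (_ + _).
  case: ifP => A0.
    by rewrite F0 -GzE ?sub0set // mulr_sumr; apply: eq_bigr => Z _; rewrite /u; mring.
  case W : (wit r A') => [a|].
    rewrite setUC' F0 -[X in G g r X (B :|: (a |: B')) - _](setU0 A).
    rewrite -!GzE ?sub0set ?Ha //.
    rewrite -sumrB -big_split /= !mulr_sumr -big_split /=.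
    by apply: eq_bigr => Z _; rewrite /u; mring.
  rewrite F0 -!GzE ?sub0set //.
  rewrite addr0 !mulr_sumr -big_split /=.
  by apply: eq_bigr => Z _; rewrite /u; mring.
case W : (wit (op r) B') => [b|]; last by rewrite big1 // => Z _; rewrite mulr0.
by rewrite setUC'' -GzE ?Hb // mulr_sumr; apply: eq_bigr => Z _; rewrite /u; mring.
Qed.

End Eval.

(* When A and A' lie strictly below B and B', [Lval] depends on A and A' only through
   [(kap A, kap A', kap (A :|: A'), lam A A', sig A A')], where [lam] tells that A' has
   a greatest class, which lies strictly above A, and [sig] that A has a greatest class,
   which lies above A'. On B' and B it depends dually. These are all the possible
   values. *)
Definition profiles : seq (nat * nat * nat * bool * bool) :=
  [:: (0, 0, 0, false, false); (0, 1, 1, true, false); (0, 2, 2, false, false);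
      (1, 0, 1, false, true); (1, 1, 1, false, true); (1, 1, 1, true, false);
      (1, 1, 2, false, false); (1, 2, 1, false, true); (1, 2, 2, false, false);
      (2, 0, 2, false, false); (2, 1, 1, true, false); (2, 1, 2, false, false);
      (2, 2, 2, false, false)]%N.

(** [Lval] in the strictly separated case: [lw] is the profile of A and A', and [up] that of B' and
    B for the opposite order. The term with [lam] comes from taking the greatest point of A' as an
    additional upper bound of x. *)
Definition Lf (R : comNzRingType) (g : nat -> nat -> R)
    (lw up : nat * nat * nat * bool * bool) : R :=
  let: (al, al', P, lam, _) := lw in
  let: (be, _, Q, _, sg) := up in
  match al' with
  | 0%N => g 1%N be * g al Q
  | 1%N => g 2%N be * g al Q +
           (g 1%N be - g 2%N be) * (g P Q + (if lam then g al 1%N - 1 else 0))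
  | _ => g 2%N be * g al Q + (g 1%N be - g 2%N be) * g P Q
  end + (if sg then 1 - g 1%N be else 0).

Definition gT (R : comNzRingType) (g : nat -> nat -> R) p q := g q p.

(** Adding y before x amounts, after reversal of the order, to exchanging the roles of the two
    profiles. *)
Definition rels (R : comNzRingType) (g : nat -> nat -> R) :=
  forall lw up, lw \in profiles -> up \in profiles -> Lf g lw up = Lf (gT g) up lw.

Ltac memD := solve [ assumption | match goal with
  | H : {subset ?A <= ?D} |- is_true (_ \in pred_of_set ?D) => exact: H
  | H : {subset ?A <= ?D} |- is_true (_ \in _) => apply: H; assumption end ].

(** * Symmetry of the total values in the order of addition *)

Section LR.

Variable T : finType.
Implicit Types (r : rel T) (D A B : {set T}).

Lemma leaU1 r A A' B : lea r (A :|: A') B = lea r A B && lea r A' B.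
Proof.
apply/leaP/andP => [H|[/leaP H1 /leaP H2] a b /setUP[aA|aA] bB]; last 2 first.
- exact: H1.
- exact: H2.
by split; apply/leaP => a b aA bB; apply: H; rewrite // inE aA ?orbT.
Qed.

Lemma leaU2 r A B B' : lea r A (B :|: B') = lea r A B && lea r A B'.
Proof. by rewrite -!(lea_op r) leaU1. Qed.

Lemma meetsU1 r A A' B : meets r (A :|: A') B = meets r A B || meets r A' B.
Proof.
apply/meetsP/orP => [[a [b [/setUP[aA|aA] bB ba]]]|].
- by left; apply/meetsP; exists a, b.
- by right; apply/meetsP; exists a, b.
by case=> /meetsP[a [b [aA bB ba]]]; exists a, b; rewrite inE aA ?orbT.
Qed.

Lemma meetsU2 r A B B' : meets r A (B :|: B') = meets r A B || meets r A B'.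
Proof. by rewrite -!(meets_op r) meetsU1. Qed.

Lemma set0_lea r A : lea r set0 A.
Proof. by apply/leaP => a b; rewrite inE. Qed.

Definition lam r A A' :=
  if wit r A' is Some a then lea r A [set a] && ~~ meets r A [set a] else false.
Definition sig r A A' := if wit r A is Some a then lea r A' [set a] else false.

Lemma leaR r A a : lea r A [set a] = [forall c in A, r c a].
Proof.
apply/leaP/forall_inP => [H c cA|H c d cA /set1P ->]; first by apply: H; rewrite ?set11.
exact: H.
Qed.

Lemma prof_low r D A A' : preo r D -> A \subset D -> A' \subset D ->
  (kap r A, kap r A', kap r (A :|: A'), lam r A A', sig r A A') \in profiles.
Proof.
move=> /preoP[rr rt] /subsetP AD /subsetP AD'.
have SL a : a \in A -> a \in A :|: A' by rewrite inE => ->.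
have SR a : a \in A' -> a \in A :|: A' by rewrite inE orbC => ->.
rewrite /lam /sig; case: (witP r A) => [A0|a aA Ha|a aA Ha].
- rewrite A0 set0U; case: (witP r A') => [A0'|a' aA' Ha'|a' aA' Ha'] //.
  have M : meets r set0 [set a'] = false.
    by apply/meetsP => -[c [d [H _ _]]]; rewrite inE in H.
  by rewrite set0_lea M.
- case: (witP r A') => [A0'|a' aA' Ha'|a' aA' Ha'] //.
  + rewrite A0' setU0 set0_lea (kap_max aA) //.
  + have -> : lea r A [set a'] = r a a'.
      apply/leaP/idP => [H|H c d cA /set1P ->]; first by apply: H; rewrite ?set11.
      by apply: rt (Ha c cA) H; memD.
    have -> : lea r A' [set a] = r a' a.
      apply/leaP/idP => [H|H c d cA /set1P ->]; first by apply: H; rewrite ?set11.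
      by apply: rt (Ha' c cA) H; memD.
    have -> : meets r A [set a'] = r a' a.
      apply/meetsP/idP => [[c [d [cA /set1P -> dc]]]|H].
        by apply: rt dc (Ha c cA); memD.
      by exists a, a'; rewrite set11.
    case ea: (r a a').
      rewrite (kap_max (a := a')) ?SR //; last first.
        move=> c /setUP[cA|/Ha' //]; apply: rt (Ha c cA) ea; memD.
      by case: (r a' a).
    case ea': (r a' a).
      rewrite (kap_max (a := a)) ?SL // => c /setUP[/Ha //|cA].
      by apply: rt (Ha' c cA) ea'; memD.
    rewrite (kap_nomax (a := a)) ?SL // => c /setUP[cA|cA].
      exists a'; rewrite ?SR //; apply: contraFN ea' => H.
      by apply: rt H (Ha c cA); memD.
    exists a; rewrite ?SL //; apply: contraFN ea => H.
    by apply: rt H (Ha' c cA); memD.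
  + case: leaP => H.
      rewrite (kap_max (a := a)) ?SL // => c /setUP[/Ha //|cA].
      by apply: H; rewrite ?set11.
    rewrite (kap_nomax (a := a)) ?SL // => c /setUP[cA|/Ha'[d dA dc]]; last first.
      by exists d; rewrite ?SR.
    case: (boolP [exists d in A', ~~ r d c]) => [/existsP[d /andP[dA dc]]|NE].
      by exists d; rewrite ?SR.
    case: H => d e dA /set1P ->; apply: (rt d c a); [memD|memD|memD| |exact: Ha].
    by apply: contraNT NE => dc; apply/existsP; exists d; rewrite dA.
- case: (witP r A') => [A0'|a' aA' Ha'|a' aA' Ha'].
  + rewrite A0' setU0 (kap_nomax aA) //.
  + have NM : lea r A [set a'] -> meets r A [set a'] = false.
      move=> /leaP H; apply/meetsP => -[c [d [cA /set1P -> ac]]].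
      have [e eA /negP[]] := Ha c cA.
      by apply: rt (H e a' eA (set11 _)) ac; memD.
    case: (boolP (lea r A [set a'])) => [H|/negP H].
      rewrite NM // (kap_max (a := a')) ?SR // => c /setUP[cA|/Ha' //].
      by move/leaP: H; apply; rewrite ?set11.
    rewrite (kap_nomax (a := a')) ?SR // => c /setUP[/Ha[d dA dc]|cA].
      by exists d; rewrite ?SL.
    case: (boolP [exists d in A, ~~ r d c]) => [/existsP[d /andP[dA dc]]|NE].
      by exists d; rewrite ?SL.
    case: H; apply/leaP => d e dA /set1P ->; apply: (rt d c a'); [memD|memD|memD| |exact: Ha'].
    by apply: contraNT NE => dc; apply/existsP; exists d; rewrite dA.
  + rewrite (kap_nomax (a := a)) ?SL // => c /setUP[/Ha[d dA dc]|/Ha'[d dA dc]].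
      by exists d; rewrite ?SL.
    by exists d; rewrite ?SR.
Qed.

Variable R : comNzRingType.
Add Ring R_ring : (comNzRing_theory R).
Ltac mring := rewrite /= ?mulr1n ?mulr0n; rfold R; ring.
Implicit Types g : nat -> nat -> R.

Lemma G_op g r A B : G (gT g) (op r) B A = G g r A B.
Proof. by rewrite /G lea_op meets_op /gT. Qed.

Lemma Lval0 g r A B A' B' :
  ~~ [&& lea r A B, lea r A' B' & lea r A B'] -> Lval g r A B A' B' = 0.
Proof.
rewrite /Lval; case: (lea r A' B') => //=.
have Z A1 B1 : ~~ [&& lea r A B & lea r A B'] -> A \subset A1 ->
    B :|: B' \subset B1 -> G g r A1 B1 = 0.
  rewrite -leaU2 => H /subsetP SA /subsetP SB; rewrite G0 //.
  by apply: contra H => /leaP H; apply/leaP => a b /SA aA /SB bB; apply: H.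
move=> H; rewrite !(Z _ _ H) ?subxx ?subsetUl //.
case: (wit r A') => [a|]; case: (wit (op r) B') => [b|];
  rewrite ?(Z _ _ H) ?subxx ?subsetUl ?subsetUr //;
  by case: (meets r A' B') => //; case: (A' == set0); mring.
Qed.

(* If [a0] in [A] lies above [b0] in [B], the only x with A <= x <= B is the class of
   [a0], so that only the choice of [y] remains. *)
Lemma Lval_meets g r D A B A' B' : preo r D ->
  A \subset D -> B \subset D -> A' \subset D -> B' \subset D ->
  lea r A B -> lea r A' B' -> lea r A B' -> meets r A B ->
  Lval g r A B A' B' = G g r (A :|: A') B'.
Proof.
move=> /preoP[rr rt] /subsetP AD /subsetP BD /subsetP AD' /subsetP BD'.
move=> hAB hAB' hAB2 mAB.
have /meetsP[a0 [b0 [a0A b0B b0a0]]] := mAB.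
have /leaP LAB := hAB; have /leaP LAB' := hAB'; have /leaP LAB2 := hAB2.
have Amax c : c \in A -> r c a0.
  by move=> cA; apply: rt (LAB c b0 cA b0B) b0a0; memD.
have aB b : b \in B -> r a0 b by exact: LAB.
have EE := (leaU1, leaU2, meetsU1, meetsU2).
rewrite /Lval hAB' /= /G !EE hAB hAB' hAB2 mAB /=.
case mAB' : (meets r A' B'); first by rewrite orbT.
rewrite orbF.
case mAB2 : (meets r A B').
  have /meetsP[a1 [b1 [a1A b1B b1a1]]] := mAB2.
  have b1a0 : r b1 a0 by apply: rt b1a1 (Amax _ a1A); memD.
  have b1min c : c \in B' -> r b1 c.
    by move=> cB; apply: rt b1a0 (LAB2 a0 c a0A cB); memD.
  have AB'B : lea r A' B.
    apply/leaP => a b aA bB; apply: (rt a b1 b); try memD; first exact: LAB'.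
    by apply: rt b1a0 (aB _ bB); memD.
  have [b2 [-> b2B b2B' b2m]] : exists b2, [/\ wit (op r) B' = Some b2,
     lea r [set b2] B, lea r [set b2] B' & meets r [set b2] B'].
    case: witP => [E|b2 b2B Hb2|b2 _ /(_ b1 b1B)[c cB]]; first by rewrite E inE in b1B.
      exists b2; split=> //.
      - apply/leaP => a b /set1P -> bB.
        apply: (rt b2 b1 b); try memD; first exact: (Hb2 _ b1B).
        by apply: rt b1a0 (aB _ bB); memD.
      - by apply/leaP => a b /set1P -> bB; apply: Hb2.
      - by apply/meetsP; exists b2, b2; rewrite set11 rr //; memD.
    by rewrite /op b1min.
  rewrite !EE AB'B b2B b2B' b2m hAB hAB2 !orbT /=; case: eqVneq => [_|A'0]; first by mring.
  case: (witP r A') => [A'0'|a aA' Ha|_ _ _]; [by rewrite A'0' eqxx in A'0| |mring].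
  have H1 : lea r A' [set a] by apply/leaP => c d cA /set1P ->; exact: Ha.
  have H2 : meets r A' [set a].
    by apply/meetsP; exists a, a; rewrite set11 rr //; memD.
  rewrite !EE hAB hAB2 hAB' mAB AB'B H1 H2.
  by case: (lea r A [set a]); rewrite /= ?orbT; mring.
have -> : (match wit (op r) B' with
  | Some b => (1 - g 1%N (kap (op r) B')) *
     (if lea r (b |: A) (B :|: B') then
       if meets r (b |: A) (B :|: B') then 1 else
      g (kap r ([set b] :|: A)) (kap (op r) (B :|: B')) else 0)
  | None => 0 end) = 0.
  case: witP => // b b1B' Hb; have HH : lea r [set b] B = false; last by rewrite !EE HH mulr0.
  apply/negP => /leaP H; move/meetsP: mAB2; case; exists a0, b; split=> //.
  by apply: rt (H b b0 (set11 _) b0B) b0a0; memD.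
rewrite addr0; case: eqVneq => [->|A'0]; first by rewrite setU0 (kap_max a0A Amax) mulr1.
have KP : lea r A' B -> kap r (A :|: A') = 1%N.
  move=> /leaP H; apply: (kap_max (a := a0)); first by rewrite inE a0A.
  move=> c /setUP[/Amax //|cA]; apply: rt (H c b0 cA b0B) b0a0; memD.
case: (witP r A') KP => [A'0'|a aA' Ha|a aA' Ha] KP; first by rewrite A'0' eqxx in A'0.
- have H1 : lea r A' [set a] by apply/leaP => c d cA /set1P ->; exact: Ha.
  have H2 : meets r A' [set a].
    by apply/meetsP; exists a, a; rewrite set11 rr //; memD.
  have KQ : lea r A [set a] -> kap r (A :|: A') = 1%N.
    move=> /leaP H; apply: (kap_max (a := a)); first by rewrite inE aA' orbT.
    by move=> c /setUP[cA|/Ha //]; apply: H; rewrite ?set11.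
  rewrite !EE hAB hAB2 hAB' mAB H1 H2 !orbT !andbT.
  case: (boolP (lea r A' B)) KP => [_ ->//|nP _].
    by case: (lea r A [set a]); rewrite /= ?orbT; mring.
  case: (boolP (lea r A [set a])) KQ => [_ ->//|nQ _]; first by rewrite /= ?orbT; mring.
  rewrite (kap_nomax (r := r) (A := A :|: A') (a := a)); first by mring.
    by rewrite inE aA' orbT.
  {move=> c /setUP[cA|cA].
      have /forall_inPn[d dA] := nP; move=> /forall_inPn[e eB de].
      exists d; first by rewrite inE dA orbT.
      apply: contra de => dc; apply: rt dc (LAB c e cA eB); memD.
    case: (boolP (r a c)) => ac; last by exists a; rewrite // inE aA' orbT.
    move: nQ; rewrite leaR => /forall_inPn[d dA da]; exists d; first by rewrite inE dA.
    by apply: contra da => dc; apply: rt dc (Ha c cA); memD. }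
- case: (boolP (lea r A' B)) KP => [_ ->//|nP _]; first by mring.
  rewrite (kap_nomax (r := r) (A := A :|: A') (a := a)); first by mring.
    by rewrite inE aA' orbT.
  {move=> c /setUP[cA|cA].
      have /forall_inPn[d dA] := nP; move=> /forall_inPn[e eB de].
      exists d; first by rewrite inE dA orbT.
      apply: contra de => dc; apply: rt dc (LAB c e cA eB); memD.
    by have [d dA dc] := Ha c cA; exists d; rewrite // inE dA orbT. }
Qed.

(** For a0 in A above b0 in B', the chain a0 <= x <= y <= b0 <= a0 makes both points equivalent to
    a0: there is a single pair, of value 1. *)
Lemma Lval_one g r D A B A' B' : preo r D ->
  A \subset D -> B \subset D -> A' \subset D -> B' \subset D ->
  lea r A B -> lea r A' B' -> lea r A B' -> meets r A B' ->
  Lval g r A B A' B' = 1.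
Proof.
move=> /preoP[rr rt] /subsetP AD /subsetP BD /subsetP AD' /subsetP BD'.
move=> hAB hAB' hAB2 mAB2.
have /meetsP[a0 [b0 [a0A b0B b0a0]]] := mAB2.
have /leaP LAB := hAB; have /leaP LAB' := hAB'; have /leaP LAB2 := hAB2.
have b0B1 b : b \in B -> r b0 b.
  by move=> bB; apply: rt b0a0 (LAB a0 b a0A bB); memD.
have b0min c : c \in B' -> r b0 c.
  by move=> cB; apply: rt b0a0 (LAB2 a0 c a0A cB); memD.
have AB'B : lea r A' B.
  apply/leaP => a b aA bB; apply: (rt a b0 b); try memD; first exact: LAB'.
  exact: b0B1.
have EE := (leaU1, leaU2, meetsU1, meetsU2).
rewrite /Lval hAB' /= /G !EE hAB hAB' hAB2 AB'B mAB2 !orbT /=.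
have [b2 [-> b2B b2B' b2m]] : exists b2, [/\ wit (op r) B' = Some b2,
   lea r [set b2] B, lea r [set b2] B' & meets r [set b2] B'].
  case: witP => [E|b2 b2B Hb2|b2 _ /(_ b0 b0B)[c cB]]; first by rewrite E inE in b0B.
    exists b2; split=> //.
    - apply/leaP => a b /set1P -> bB.
      apply: (rt b2 b0 b); try memD; first exact: (Hb2 _ b0B).
      exact: b0B1.
    - by apply/leaP => a b /set1P -> bB; apply: Hb2.
    - by apply/meetsP; exists b2, b2; rewrite set11 rr //; memD.
  by rewrite /op b0min.
rewrite !EE hAB hAB2 b2B b2B' b2m !orbT /=.
case: ifP => // _; case: eqVneq => [_|A'0]; first by mring.
case: (witP r A') => [A'0'|a aA' Ha|_ _ _]; [by rewrite A'0' eqxx in A'0| |mring].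
have H1 : lea r A' [set a] by apply/leaP => c d cA /set1P ->; exact: Ha.
rewrite !EE hAB hAB2 hAB' mAB2 AB'B H1 !orbT.
by case: (lea r A [set a]); rewrite /= ?orbT; mring.
Qed.

(** Let a0 in A' not be below b0 in B. Then no point of B' lies below b0, so that B and B' together
    have a single minimal class only if it is the least class of B: this is [t], and [w] is the same
    condition once the greatest point of A' has been added to the upper bounds. *)
Lemma Lval_incomparable g r D A B A' B' : preo r D ->
  A \subset D -> B \subset D -> A' \subset D -> B' \subset D ->
  lea r A B -> lea r A' B' -> lea r A B' ->
  meets r A B = false -> meets r A' B' = false -> meets r A B' = false ->
  lea r A' B = false ->
  Lval g r A B A' B' =
    let K p := if p then 1%N else 2%N in
    let s := if wit r A' is Some a then lea r A [set a] else false in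
    let t := if wit (op r) B is Some b then lea r [set b] B' else false in
    let w := if wit r A' is Some a then
      if wit (op r) B is Some b then r b a else false else false in
    let al := kap r A in let be := kap (op r) B' in
    g 2%N be * g al (K t) + if s then (g 1%N be - g 2%N be) * g al (K w) else 0.
Proof.
move=> /preoP[rr rt] /subsetP AD /subsetP BD /subsetP AD' /subsetP BD'.
move=> hAB hAB' hAB2 mAB mAB' mAB2 nAB'B /=.
have /leaP LAB := hAB; have /leaP LAB' := hAB'; have /leaP LAB2 := hAB2.
have EE := (leaU1, leaU2, meetsU1, meetsU2).
rewrite /Lval hAB' /= /G !EE hAB hAB' hAB2 nAB'B mAB mAB' mAB2 /=.
have /forall_inPn[a0 a0A /forall_inPn[b0 b0B n00]] := negbT nAB'B.
case: eqVneq => [E|A'0]; first by rewrite E inE in a0A.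
have minU1 b : b \in B -> (forall c, c \in B -> r b c) -> lea r [set b] B' ->
    kap (op r) (B :|: B') = 1%N.
  move=> bB Hb /leaP H; apply: (kap_max (a := b)); first by rewrite inE bB.
  by move=> c /setUP[/Hb //|cB]; apply: H; rewrite ?set11.
have nolow c (b : T) : c \in A' -> b \in B' -> r b c -> False.
  by move=> cA bB bc; move/meetsP: mAB'; apply; exists c, b.
have nmin b : b \in B' -> ~~ r b b0.
  move=> bB; apply: contra n00 => bb; apply: rt (LAB' a0 b a0A bB) bb; memD.
have -> : (match wit (op r) B' with
  | Some b => (1 - g 1%N (kap (op r) B')) *
     (if lea r (b |: A) (B :|: B') then
       if meets r (b |: A) (B :|: B') then 1 else
      g (kap r (b |: A)) (kap (op r) (B :|: B')) else 0)
  | None => 0 end) = 0.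
  case: witP => // b b1B' Hb; have HH : lea r [set b] B = false; last by rewrite !EE HH mulr0.
  by apply/negP => /leaP H; have := nmin _ b1B'; rewrite H ?set11.
have -> : kap (op r) (B :|: B') =
   if (if wit (op r) B is Some b then lea r [set b] B' else false) then 1%N else 2%N.
  case: (witP (op r) B) => [E|b bB Hb|b bB Hb]; first by rewrite E inE in b0B.
    case: ifP => [|/negbT/forall_inPn[b' /set1P -> /forall_inPn[c cB nbc]]]; first exact: minU1.
    apply: (kap_nomax (a := b)); first by rewrite inE bB.
    move=> d /setUP[dB|dB].
      exists c; first by rewrite inE cB orbT.
      by apply: contra nbc => dc; apply: rt (Hb _ dB) dc; memD.
    by exists b0; [rewrite inE b0B | exact: nmin].
  apply: (kap_nomax (a := b)); first by rewrite inE bB.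
  move=> d /setUP[/Hb[c cB dc]|dB]; first by exists c; rewrite // inE cB.
  by exists b0; [rewrite inE b0B | exact: nmin].
case: (witP r A') => [E|a aA' Ha|_ _ _]; [by rewrite E eqxx in A'0| |by mring].
rewrite !EE hAB hAB2 nAB'B mAB mAB2 ?andbF /=.
case: (boolP (lea r A [set a])) => qa /=; last by mring.
have -> : meets r A [set a] = false.
  apply/meetsP => -[c [d [cA /set1P -> ac]]]; case/negP: n00.
  apply: (rt a0 a b0); try memD; first exact: Ha.
  by apply: rt ac (LAB c b0 cA b0B); memD.
have -> : kap (op r) (a |: (B :|: B')) =
  if (if wit (op r) B is Some b then r b a else false) then 1%N else 2%N.
  have na : ~~ r a b0 by apply: contra n00 => ab; apply: rt (Ha _ a0A) ab; memD.
  case: (witP (op r) B) => [E|b bB Hb|b bB Hb]; first by rewrite E inE in b0B.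
    case: ifP => ba.
      apply: (kap_max (a := b)); first by rewrite !inE bB orbT.
      move=> c /setU1P[->//|/setUP[/Hb //|cB]].
      by apply: rt ba (LAB' a c aA' cB); memD.
    apply: (kap_nomax (a := b)); first by rewrite !inE bB orbT.
    move=> d /setU1P[->|/setUP[dB|dB]].
    - by exists b0; [rewrite !inE b0B orbT | ].
    - exists a; first by rewrite !inE eqxx.
      by apply: contraFN ba => da; apply: rt (Hb _ dB) da; memD.
    - by exists b0; [rewrite !inE b0B orbT | exact: nmin].
  apply: (kap_nomax (a := b)); first by rewrite !inE bB orbT.
  move=> d /setU1P[->|/setUP[/Hb[c cB dc]|dB]].
  - by exists b0; [rewrite !inE b0B orbT | ].
  - by exists c; rewrite // !inE cB orbT.
  - by exists b0; [rewrite !inE b0B orbT | exact: nmin].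
by mring.
Qed.

(** Some b0 in B lies below some a0 in A', so x <= b0 <= a0 <= y holds automatically and the two
    choices are independent. *)
Lemma Lval_cross g r D A B A' B' : preo r D ->
  A \subset D -> B \subset D -> A' \subset D -> B' \subset D ->
  lea r A B -> lea r A' B' -> lea r A B' -> lea r A' B ->
  meets r A B = false -> meets r A' B' = false -> meets r A B' = false ->
  meets r A' B -> Lval g r A B A' B' = g 1%N (kap (op r) B') * g (kap r A) 1%N.
Proof.
move=> /preoP[rr rt] /subsetP AD /subsetP BD /subsetP AD' /subsetP BD'.
move=> hAB hAB' hAB2 hA'B mAB mAB' mAB2 mA'B.
have /meetsP[a0 [b0 [a0A b0B b0a0]]] := mA'B.
have /leaP LAB := hAB; have /leaP LAB' := hAB'; have /leaP LAB2 := hAB2.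
have /leaP LA'B := hA'B.
have EE := (leaU1, leaU2, meetsU1, meetsU2).
rewrite /Lval hAB' /= /G !EE hAB hAB' hAB2 hA'B mAB mAB' mAB2 mA'B /=.
case: eqVneq => [E|A'0]; first by rewrite E inE in a0A.
have b0le c : c \in B -> r b0 c.
  by move=> cB; apply: rt b0a0 (LA'B a0 c a0A cB); memD.
have b0le' c : c \in B' -> r b0 c.
  by move=> cB; apply: rt b0a0 (LAB' a0 c a0A cB); memD.
have -> : (match wit (op r) B' with
  | Some b => (1 - g 1%N (kap (op r) B')) *
     (if lea r (b |: A) (B :|: B') then
       if meets r (b |: A) (B :|: B') then 1 else
      g (kap r (b |: A)) (kap (op r) (B :|: B')) else 0)
  | None => 0 end) = 0.
  case: witP => // b b1B' Hb; have HH : lea r [set b] B = false; last by rewrite !EE HH mulr0.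
  apply/negP => /leaP H; move/meetsP: mAB'; apply; exists a0, b; split=> //.
  by apply: rt (H b b0 (set11 _) b0B) b0a0; memD.
have -> : kap (op r) (B :|: B') = 1%N.
  apply: (kap_max (a := b0)); first by rewrite inE b0B.
  by move=> c /setUP[/b0le|/b0le'].
have : wit r A' != None.
  case: witP A'0 => [->|//|a aA H _]; first by rewrite eqxx.
  have [c cA /negP[]] := H a0 a0A.
  by apply: rt (LA'B c b0 cA b0B) b0a0; memD.
case: (witP r A') => // a aA' Ha _; rewrite !EE hAB hAB2 hA'B hAB' mAB mAB2 mA'B /=.
have b0a : r b0 a by apply: rt b0a0 (Ha _ a0A); memD.
have -> : lea r A [set a].
  by apply/leaP => c d cA /set1P ->; apply: rt (LAB c b0 cA b0B) b0a; memD.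
have -> : lea r A' [set a] by apply/leaP => c d cA /set1P ->; exact: Ha.
have -> : meets r A [set a] = false.
  apply/meetsP => -[c [d [cA /set1P -> ac]]]; move/meetsP: mAB; apply.
  by exists c, b0; split=> //; apply: rt b0a ac; memD.
have -> : kap (op r) (a |: (B :|: B')) = 1%N.
  apply: (kap_max (a := b0)); first by rewrite !inE b0B orbT.
  by move=> c /setU1P[->//|/setUP[/b0le|/b0le']].
by rewrite !orbT; mring.
Qed.

Lemma Lval_generic g r D A B A' B' : preo r D ->
  A \subset D -> B \subset D -> A' \subset D -> B' \subset D ->
  lea r A B -> lea r A' B' -> lea r A B' -> lea r A' B ->
  meets r A B = false -> meets r A' B' = false -> meets r A B' = false ->
  meets r A' B = false -> Lval g r A B A' B' =
    Lf g (kap r A, kap r A', kap r (A :|: A'), lam r A A', sig r A A')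
      (kap (op r) B', kap (op r) B, kap (op r) (B' :|: B), lam (op r) B' B,
       sig (op r) B' B).
Proof.
move=> /preoP[rr rt] /subsetP AD /subsetP BD /subsetP AD' /subsetP BD'.
move=> hAB hAB' hAB2 hA'B mAB mAB' mAB2 mA'B.
have /leaP LAB := hAB; have /leaP LAB' := hAB'; have /leaP LAB2 := hAB2.
have /leaP LA'B := hA'B.
have EE := (leaU1, leaU2, meetsU1, meetsU2).
rewrite /Lval hAB' /= /G !EE hAB hAB' hAB2 hA'B mAB mAB' mAB2 mA'B /= /lam /sig.
rewrite [B' :|: B]setUC; congr (_ + _); last first.
  case: (witP (op r) B') => // b bB' Hb.
  rewrite !EE hAB hAB2 mAB mAB2 (lea_op r).
  have -> : lea r [set b] B' by apply/leaP => c d /set1P -> dB; exact: Hb.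
  have -> : meets r [set b] B'.
    by apply/meetsP; exists b, b; rewrite set11 rr //; memD.
  by rewrite !orbT !andbT; case: (lea _ _ _); mring.
case: (witP r A') => [->|a aA' Ha|a aA' Ha].
- by rewrite eqxx.
- case: eqVneq => [E|_]; first by rewrite E inE in aA'.
  rewrite !EE hAB hAB2 hA'B hAB' mAB mAB2 mA'B /=.
  have -> : lea r A' [set a] by apply/leaP => c d cA /set1P ->; exact: Ha.
  have -> : meets r A' [set a].
    by apply/meetsP; exists a, a; rewrite set11 rr //; memD.
  have -> : kap (op r) (a |: (B :|: B')) = 1%N.
    apply: (kap_max (a := a)); first by rewrite !inE eqxx.
    move=> c /setU1P[->|/setUP[cB|cB]]; first by apply: rr; memD.
      exact: LA'B.
    exact: LAB'.
  by case: (lea r A [set a]); case: (meets r A [set a]); rewrite /= ?orbT; mring.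
- case: eqVneq => [E|_]; first by rewrite E inE in aA'.
  by mring.
Qed.

(** All degenerate positions of the four sets agree for every [g]; only the strictly separated one
    invokes [rels]. *)
Lemma Lval_swap g r D A B A' B' : preo r D ->
  A \subset D -> B \subset D -> A' \subset D -> B' \subset D -> rels g ->
  Lval g r A B A' B' = Lval (gT g) (op r) B' A' B A.
Proof.
move=> pr AD BD AD' BD' Hg.
have pr' : preo (op r) D by rewrite op_preo.
case: (boolP [&& lea r A B, lea r A' B' & lea r A B']) => [/and3P[h1 h2 h3]|H]; last first.
  rewrite !Lval0 // !(lea_op r); apply: contra H => /and3P[-> -> ->] //.
case m1: (meets r A B).
  rewrite (Lval_meets g pr) // [RHS]/Lval (lea_op r) h1 /= (meets_op r) m1.
  by rewrite (G_op g) [A' :|: A]setUC.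
case m2: (meets r A' B').
  rewrite (Lval_meets _ pr') ?(lea_op r) ?(meets_op r) // (G_op g).
  by rewrite /Lval h2 m2 /= [B' :|: B]setUC.
case m3: (meets r A B').
  by rewrite (Lval_one g pr) // (Lval_one _ pr') ?(lea_op r) ?(meets_op r).
case h4: (lea r A' B); last first.
  rewrite (Lval_incomparable g pr) // (Lval_incomparable _ pr') ?(lea_op r) ?(meets_op r) //=.
  rewrite /gT.
  have -> : wit (op (op r)) A' = wit r A' by [].
  have -> : kap (op (op r)) A = kap r A by [].
  case: (witP r A') => [_|a aA' Ha|a _ _];
    case: (witP (op r) B) => [_|b bB Hb|b _ _]; rewrite ?(lea_op r);
    try solve [mring | case: (lea _ _ _); mring].
  rewrite /op; have W1 : r b a -> lea r A [set a].
    move=> ba; apply/leaP => c d cA /set1P ->; move/preoP: pr => [_ rt].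
    have /leaP H1 := h1.
    by apply: (rt c b a) => //; [exact: (subsetP AD)|exact: (subsetP BD)|exact: (subsetP AD')|exact: H1].
  have W2 : r b a -> lea r [set b] B'.
    move=> ba; apply/leaP => c d /set1P -> dB; move/preoP: pr => [_ rt].
    have /leaP H2 := h2.
    by apply: (rt b a d) => //; [exact: (subsetP BD)|exact: (subsetP AD')|exact: (subsetP BD')|exact: H2].
  case: (r b a) W1 W2 => [-> // -> //|_ _]; first by mring.
  by case: (lea r A [set a]); case: (lea r [set b] B'); mring.
case m4: (meets r A' B).
  rewrite (Lval_cross g pr) // (Lval_cross _ pr') ?(lea_op r) ?(meets_op r) //.
  by rewrite /gT mulrC.
rewrite (Lval_generic g pr) // (Lval_generic _ pr') ?(lea_op r) ?(meets_op r) //.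
apply: Hg; first exact: prof_low pr AD AD'.
exact: prof_low pr' BD' BD.
Qed.

End LR.

(** * Order duality and the exchange of two added points *)

Section Flip.

Variable T : finType.
Implicit Types (r : rel T) (D A B : {set T}) (Z X Y : {set T * bool}) (x y : T).

Definition neg2 (z : T * bool) := (z.1, ~~ z.2).

Lemma neg2K : involutive neg2.
Proof. by move=> [d b]; rewrite /neg2 /= negbK. Qed.

Definition flip Z := neg2 @: Z.

Lemma mem_flip Z z : (z \in flip Z) = (neg2 z \in Z).
Proof. by rewrite -{1}[z]neg2K mem_imset //; apply: inv_inj neg2K. Qed.

Lemma flipK : involutive flip.
Proof. by move=> Z; apply/setP => z; rewrite !mem_flip neg2K. Qed.

Lemma flip_sub Z Y : (flip Z \subset flip Y) = (Z \subset Y).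
Proof.
apply/subsetP/subsetP => H z; last by rewrite !mem_flip; apply: H.
by have := H (neg2 z); rewrite !mem_flip neg2K.
Qed.

Lemma lo_flip Z : lo (flip Z) = hi Z.
Proof. by apply/setP => d; rewrite !inE mem_flip. Qed.

Lemma hi_flip Z : hi (flip Z) = lo Z.
Proof. by apply/setP => d; rewrite !inE mem_flip. Qed.

Lemma flip_pairs A B : flip (pairs A B) = pairs B A.
Proof. by apply/setP => -[d []]; rewrite mem_flip !inE. Qed.

Lemma flip_dbl D : flip (dbl D) = dbl D. Proof. exact: flip_pairs. Qed.

Lemma op_upd r x Z u v : op (upd r x Z) u v = upd (op r) x (flip Z) u v.
Proof.
rewrite /op /upd !mem_flip /neg2 /=.
by case: (u == x); case: (v == x).
Qed.

Variable R : comNzRingType.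
Add Ring R_ring : (comNzRing_theory R).
Ltac mring := rewrite /= ?mulr1n ?mulr0n; rfold R; ring.
Implicit Types g : nat -> nat -> R.

Lemma mz_flip g r D Z : Z \subset dbl D ->
  mz (gT g) (op r) D (flip Z) = mz g r D Z.
Proof.
move=> ZD; rewrite /mz -{1}(flip_dbl D) mob_imset //; last exact: inv_inj neg2K.
by apply: eq_mob => Y _ _; rewrite /Gz -/(flip Y) lo_flip hi_flip G_op.
Qed.

Lemma Eval_dual g r D y A B A' B' : preo r D -> y \notin D ->
  A \subset D -> B \subset D -> A' \subset D -> B' \subset D ->
  \sum_(Z : {set T * bool} | (pairs A' B' \subset Z) && (Z \subset dbl D))
     mz g r D Z * G g (upd r y Z) A (y |: B) = Lval (gT g) (op r) B' A' B A.
Proof.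
move=> pr yD AD BD A'D B'D; have pr' : preo (op r) D by rewrite op_preo.
rewrite -(Eval (gT g) pr' yD) //.
rewrite (reindex_onto flip flip) /=; last by move=> Z _; rewrite flipK.
apply: eq_big => [Z|Z /andP[/andP[_ ZD] _]].
  by rewrite flipK eqxx andbT -(flip_sub _ Z) -(flip_sub Z) flip_pairs flip_dbl.
have ZD' : Z \subset dbl D by rewrite -flip_sub flip_dbl.
rewrite -mz_flip // flipK; congr (_ * _).
rewrite -G_op; apply: eq_G => u v _ _.
by rewrite op_upd flipK.
Qed.

(** The total value of the pairs of types containing [Z] and [Y], for two points added one after the
    other; the sum over the types of the second is already contracted into [Gz]. *)
Definition Phi g r D x Z Y : R :=
  \sum_(X : {set T * bool} | (Z \subset X) && (X \subset dbl D))
     mz g r D X * Gz g (upd r x X) Y.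

(* Turns the types of [x] over [D] and of [y] over [x |: D] into the types of [y] over
   [D] and of [x] over [y |: D] in the same preorder on [y |: (x |: D)]. *)
Definition swp D x y (p : {set T * bool} * {set T * bool}) :=
  (p.2 :&: dbl D, p.1 :|: [set z | (z.1 == y) && ((x, ~~ z.2) \in p.2)]).

Lemma swpK D x y Z Y : x \notin D -> y \notin D -> x != y ->
  Z \subset dbl D -> Y \subset dbl (x |: D) ->
  swp D y x (swp D x y (Z, Y)) = (Z, Y).
Proof.
move=> xD yD xy /subsetP ZD /subsetP YD; rewrite /swp /=; congr (_, _).
  apply/setP => -[d b]; rewrite !(in_setI, in_setU, in_dbl, inE) /=.
  case dZ: ((d, b) \in Z) => /=; first by have := ZD _ dZ; rewrite in_dbl.
  by apply/negP => /andP[/andP[/eqP -> _] yD']; rewrite yD' in yD.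
apply/setP => -[d b]; rewrite !(in_setI, in_setU, in_dbl, inE) /=.
have nZ c : (y, c) \notin Z by apply/negP => /ZD; rewrite in_dbl /= (negbTE yD).
rewrite negbK (negbTE (nZ _)) eqxx /=.
case: (eqVneq d x) => [->|dx] /=; first by rewrite (negbTE xD) andbF.
rewrite orbF; case dY: ((d, b) \in Y) => //=.
by have := YD _ dY; rewrite in_dbl in_setU1 (negbTE dx).
Qed.

Lemma swp_sub D x y Z Y :
  Z \subset dbl D -> Y \subset dbl (x |: D) ->
  ((swp D x y (Z, Y)).1 \subset dbl D) && ((swp D x y (Z, Y)).2 \subset dbl (y |: D)).
Proof.
move=> ZD YD; rewrite subsetIr subUset /=.
rewrite (subset_trans ZD) ?dbl_sub ?subsetUr //=.
by apply/subsetP => -[d b]; rewrite inE in_dbl in_setU1 => /andP[->].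
Qed.

Lemma swp_mono D x y Z Y Z' Y' : Z \subset Z' -> Y \subset Y' ->
  ((swp D x y (Z, Y)).1 \subset (swp D x y (Z', Y')).1) &&
  ((swp D x y (Z, Y)).2 \subset (swp D x y (Z', Y')).2).
Proof.
move=> ZZ YY; rewrite setSI //= setUSS //.
by apply/subsetP => z; rewrite !inE => /andP[-> /(subsetP YY)].
Qed.

Lemma sum_swp D x y (F : {set T * bool} -> {set T * bool} -> R) Z0 Y0 :
  x \notin D -> y \notin D -> x != y -> Z0 \subset dbl D -> Y0 \subset dbl (x |: D) ->
  \sum_(Z : {set T * bool} | (Z0 \subset Z) && (Z \subset dbl D))
    \sum_(Y : {set T * bool} | (Y0 \subset Y) && (Y \subset dbl (x |: D)))
      F (swp D x y (Z, Y)).1 (swp D x y (Z, Y)).2 =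
  \sum_(Z : {set T * bool} | ((swp D x y (Z0, Y0)).1 \subset Z) && (Z \subset dbl D))
    \sum_(Y : {set T * bool} |
       ((swp D x y (Z0, Y0)).2 \subset Y) && (Y \subset dbl (y |: D))) F Z Y.
Proof.
move=> xD yD xy ZD YD; rewrite !pair_big /=.
rewrite [RHS](reindex_onto (swp D x y) (swp D y x)) /=; last first.
  move=> [Z Y] /= /andP[/andP[_ ZD'] /andP[_ YD']].
  by rewrite swpK // eq_sym.
apply: eq_bigl => -[Z Y]; apply/idP/idP.
  move=> /andP[/andP[/= ZZ ZD'] /andP[YY YD']].
  have /andP[a1 a2] := swp_sub y ZD' YD'; have /andP[a3 a4] := swp_mono D x y ZZ YY.
  by rewrite a1 a2 a3 a4 swpK //=.
have yx : y != x by rewrite eq_sym.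
have spl (p : {set T * bool} * {set T * bool}) : p = (p.1, p.2) by case: p.
move=> /andP[/andP[/andP[H1 H2] /andP[H3 H4]] /eqP E].
have := @swp_sub D y x (swp D x y (Z, Y)).1 (swp D x y (Z, Y)).2 H2 H4.
have := @swp_mono D y x _ _ (swp D x y (Z, Y)).1 (swp D x y (Z, Y)).2 H1 H3.
rewrite -(spl (swp D x y (Z, Y))) -(spl (swp D x y (Z0, Y0))) E swpK //.
by move=> /andP[-> ->] /andP[-> ->].
Qed.

Lemma Gz_upd_in g r x X D Y : x \notin D -> Y \subset dbl D ->
  Gz g (upd r x X) Y = Gz g r Y.
Proof.
move=> xD; rewrite subset_dbl => /andP[/subsetP l /subsetP h].
apply: eq_G => u v /setUP[/l|/h] uD /setUP[/l|/h] vD; exact: (upd_in r X xD).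
Qed.

Lemma Gz_upd_both g r D x X A B : preo r D -> x \notin D -> vld r D X ->
  A \subset D -> B \subset D ->
  G g (upd r x X) (x |: A) (x |: B) = (pairs A B \subset X)%:R.
Proof.
move=> pr xD /vldP[XD _ _ V3] AD BD; rewrite subset_pairs /G.
have UL d : d \in D -> upd r x X d x = (d \in lo X).
  by move=> dD; rewrite upd_lo ?inE // (memPn xD).
have UH d : d \in D -> upd r x X x d = (d \in hi X).
  by move=> dD; rewrite upd_hi ?inE // (memPn xD).
have -> : meets (upd r x X) (x |: A) (x |: B).
  by apply/meetsP; exists x, x; rewrite !setU11 /upd eqxx.
suff -> : lea (upd r x X) (x |: A) (x |: B) = (A \subset lo X) && (B \subset hi X).
  by case: (_ && _).
apply/leaP/andP => [H|[/subsetP HA /subsetP HB] a b].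
  split; apply/subsetP => d dA.
    by rewrite -UL ?(subsetP AD) // H ?setU11 ?setU1r.
  by rewrite -UH ?(subsetP BD) // H ?setU11 ?setU1r.
move=> /setU1P[->|aA] /setU1P[->|bB].
- by rewrite /upd eqxx.
- by rewrite UH ?(subsetP BD) // HB.
- by rewrite UL ?(subsetP AD) // HA.
- have -> := upd_in r X xD (subsetP AD _ aA) (subsetP BD _ bB).
  by apply: V3; [apply: HA|apply: HB].
Qed.

(** There are four cases, by the relations between [x] and [y] that are prescribed. Both relations
    make the points equivalent, so that their bounds are united; none makes the choices independent;
    a single one is [Lval] or its dual. *)
Lemma Phi_swp g r D x y Z Y : rels g -> preo r D ->
  x \notin D -> y \notin D -> x != y -> Z \subset dbl D -> Y \subset dbl (x |: D) ->
  Phi g r D x Z Y = Phi g r D y (swp D x y (Z, Y)).1 (swp D x y (Z, Y)).2.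
Proof.
move=> Hg pr xD yD xy ZD YD.
pose A' := lo Y :&: D; pose B' := hi Y :&: D.
have AD' : A' \subset D by apply: subsetIr.
have BD' : B' \subset D by apply: subsetIr.
have := ZD; rewrite subset_dbl => /andP[AD BD].
have := YD; rewrite subset_dbl => /andP[YlD YhD].
have loE : lo Y = if (x, false) \in Y then x |: A' else A'.
  apply/setP => d; have [->|dx] := eqVneq d x.
    by rewrite inE; case: ifP => _; rewrite ?setU11 // /A' in_setI (negbTE xD) andbF.
  have -> : (d \in if (x, false) \in Y then x |: A' else A') = (d \in A').
    by case: ifP; rewrite // in_setU1 (negbTE dx).
  rewrite in_setI inE; case dY: ((d, false) \in Y) => //=; symmetry.
  by have := subsetP YlD d; rewrite in_setU1 (negbTE dx) inE dY; apply.
have hiE : hi Y = if (x, true) \in Y then x |: B' else B'.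
  apply/setP => d; have [->|dx] := eqVneq d x.
    by rewrite inE; case: ifP => _; rewrite ?setU11 // /B' in_setI (negbTE xD) andbF.
  have -> : (d \in if (x, true) \in Y then x |: B' else B') = (d \in B').
    by case: ifP; rewrite // in_setU1 (negbTE dx).
  rewrite in_setI inE; case dY: ((d, true) \in Y) => //=; symmetry.
  by have := subsetP YhD d; rewrite in_setU1 (negbTE dx) inE dY; apply.
set p := swp D x y (Z, Y).
have p1 : p.1 = pairs A' B'.
  by apply/setP => -[d b]; rewrite in_setI in_dbl !inE /=; case: b.
have nZ c : (y, c) \notin Z.
  by apply/negP => /(subsetP ZD); rewrite in_dbl /= (negbTE yD).
have lop : lo p.2 = if (x, true) \in Y then y |: lo Z else lo Z.
  apply/setP => d; rewrite (fun_if (fun s : {set T} => d \in s)) !inE /=.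
  by have [->|dy] := eqVneq d y; rewrite ?(negbTE (nZ _)) ?orbF //=; case: ifP.
have hip : hi p.2 = if (x, false) \in Y then y |: hi Z else hi Z.
  apply/setP => d; rewrite (fun_if (fun s : {set T} => d \in s)) !inE /=.
  by have [->|dy] := eqVneq d y; rewrite ?(negbTE (nZ _)) ?orbF //=; case: ifP.
have E1 u (W : {set T * bool}) (S S' : {set T}) : u \notin D -> S \subset D -> S' \subset D -> W \subset dbl D ->
    \sum_(X : {set T * bool} | (W \subset X) && (X \subset dbl D))
      mz g r D X * G g (upd r u X) S S' = Gz g r W * G g r S S'.
  move=> uD SD SD' WD; rewrite -(mz_zeta g r WD) mulr_suml; apply: eq_bigr => X _.
  have := Gz_upd_in g r X uD (Y := pairs S S').
  by rewrite /Gz lo_pairs hi_pairs pairs_subset SD SD' => ->.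
have E2 u (W : {set T * bool}) (S S' : {set T}) : u \notin D -> S \subset D -> S' \subset D -> W \subset dbl D ->
    \sum_(X : {set T * bool} | (W \subset X) && (X \subset dbl D))
      mz g r D X * G g (upd r u X) (u |: S) (u |: S') = Gz g r (W :|: pairs S S').
  move=> uD SD SD' WD; rewrite -(mz_ind g r WD); last by rewrite pairs_subset SD.
  apply: eq_bigr => X /andP[_ XD]; case: (boolP (vld r D X)) => vX.
    by rewrite (Gz_upd_both _ pr).
  by rewrite mz_vld0 // !mul0r.
rewrite /Phi p1 /Gz lop hip loE hiE.
case: ((x, false) \in Y); case: ((x, true) \in Y).
- have PD : pairs A' B' \subset dbl D by rewrite pairs_subset AD'.
  apply: etrans (E2 _ _ _ _ xD AD' BD' ZD) _; apply: etrans (esym (E2 _ _ _ _ yD AD BD PD)).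
  by rewrite /Gz !loU !hiU !lo_pairs !hi_pairs [A' :|: _]setUC [B' :|: _]setUC.
- rewrite -{1}(pairsK Z); apply: etrans (Eval g pr xD AD BD AD' BD') _.
  apply: etrans (esym (Eval_dual g pr yD AD BD AD' BD')).
  exact: Lval_swap pr _ _ _ _ Hg.
- rewrite -{1}(pairsK Z); apply: etrans (Eval_dual g pr xD AD' BD' AD BD) _.
  apply: etrans (esym (Eval g pr yD AD' BD' AD BD)).
  symmetry; exact: Lval_swap pr _ _ _ _ Hg.
- have PD : pairs A' B' \subset dbl D by rewrite pairs_subset AD'.
  apply: etrans (E1 _ _ _ _ xD AD' BD' ZD) _; apply: etrans (esym (E1 _ _ _ _ yD AD BD PD)).
  by rewrite /Gz lo_pairs hi_pairs mulrC //.
Qed.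

(** Two Moebius inversions, in [Y] and then in [Z], pass from the totals of [Phi_swp] to single
    types. *)
Lemma mz_swp g r D x y Z Y : rels g -> preo r D ->
  x \notin D -> y \notin D -> x != y -> Z \subset dbl D -> Y \subset dbl (x |: D) ->
  mz g r D Z * mz g (upd r x Z) (x |: D) Y =
  mz g r D (swp D x y (Z, Y)).1 *
    mz g (upd r y (swp D x y (Z, Y)).1) (y |: D) (swp D x y (Z, Y)).2.
Proof.
move=> Hg pr xD yD xy; move: Y Z.
pose F Z Y := mz g r D Z * mz g (upd r y Z) (y |: D) Y.
move=> Y Z ZD; move: Y.
apply: (zeta_inj (f := fun Y => mz g r D Z * mz g (upd r x Z) (x |: D) Y)
  (f' := fun Y => F (swp D x y (Z, Y)).1 (swp D x y (Z, Y)).2)) => Y YD.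
move: Z ZD.
apply: (zeta_inj
  (f := fun Z => \sum_(Y0 : {set T * bool} | (Y \subset Y0) && (Y0 \subset dbl (x |: D)))
     mz g r D Z * mz g (upd r x Z) (x |: D) Y0)
  (f' := fun Z => \sum_(Y0 : {set T * bool} | (Y \subset Y0) && (Y0 \subset dbl (x |: D)))
     F (swp D x y (Z, Y0)).1 (swp D x y (Z, Y0)).2)) => Z ZD.
rewrite sum_swp //; transitivity (Phi g r D x Z Y).
  by apply: eq_bigr => X _; rewrite -mulr_sumr mz_zeta.
rewrite (Phi_swp Hg pr xD yD xy ZD YD); apply: eq_bigr => X _; rewrite -mulr_sumr mz_zeta //.
by have /andP[] := swp_sub y ZD YD.
Qed.

Lemma mx_swap g r D x y : rels g -> preo r (y |: (x |: D)) ->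
  x \notin D -> y \notin D -> x != y ->
  mx g r D x * mx g r (x |: D) y = mx g r D y * mx g r (y |: D) x.
Proof.
move=> Hg pr xD yD xy.
have /preoP[rr _] := pr.
have xx : r x x by apply: rr; rewrite !inE eqxx orbT.
have yy : r y y by apply: rr; rewrite !inE eqxx.
have prD : preo r D.
  by apply: preo_sub pr; rewrite subsetU // subsetUr orbT.
have := mz_swp Hg prD xD yD xy (tp_sub r D x) (tp_sub r (x |: D) y).
have -> : (swp D x y (tp r D x, tp r (x |: D) y)).1 = tp r D y.
  by rewrite /= tp_restrict ?subsetUr.
have -> : (swp D x y (tp r D x, tp r (x |: D) y)).2 = tp r (y |: D) x.
  apply/setP => -[d b]; rewrite !inE /= eqxx /=.
  have [->|dy] := eqVneq d y; last by rewrite orbF.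
  by rewrite (negbTE yD) /=; case: b.
rewrite /mx (eq_mz g (r := upd r x _) (r' := r)) => [|u v]; last by move=> *; exact: upd_tp.
by rewrite (eq_mz g (r := upd r y _) (r' := r)) => [//|u v]; last by move=> *; exact: upd_tp.
Qed.

End Flip.

(** The quotient by equivalence, carried by representatives: [pick] depends only on the extension of
    its predicate, hence chooses the same representative for equivalent points. *)
Lemma realize (T : finType) (r : rel T) : preo r [set: T] ->
  exists (S : poset) (u : T -> 'I_(pcard S)),
    (forall z, exists t, u t = z) /\ (forall t t', r t t' = ple (u t) (u t')).
Proof.
move=> /preoP[rr rt].
have {}rr t : r t t by apply: rr; rewrite inE.
have {}rt t1 t2 t3 : r t1 t2 -> r t2 t3 -> r t1 t3 by apply: rt; rewrite inE.
pose c t := odflt t [pick e | r e t && r t e].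
have cP t : r (c t) t && r t (c t).
  by rewrite /c; case: pickP => //= _; rewrite rr.
have cE t t' : r t t' -> r t' t -> c t = c t'.
  move=> tt' t't; rewrite /c.
  have E : (fun e => r e t && r t e) =1 (fun e => r e t' && r t' e).
    move=> e; apply/andP/andP => -[h1 h2]; split.
    - exact: rt h1 tt'.
    - exact: rt t't h2.
    - exact: rt h1 t't.
    - exact: rt tt' h2.
  rewrite (eq_pick E); case: pickP => // /(_ t'); by rewrite rr.
have cc t : c (c t) = c t by have /andP[h1 h2] := cP t; apply: cE.
pose C := [set c t | t : T].
pose f (i : 'I_#|C|) : T := enum_val i.
have fc i : c (f i) = f i by have /imsetP[t _ E] := enum_valP i; rewrite /f E cc.
have le_refl : reflexive (fun i j => r (f i) (f j)) by move=> i /=.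
have le_anti : antisymmetric (fun i j => r (f i) (f j)).
  by move=> i j /andP[/cE H /H]; rewrite !fc => /enum_val_inj.
have le_trans : transitive (fun i j => r (f i) (f j)).
  by move=> j i k /=; apply: rt.
have cC t : c t \in C by apply: imset_f.
exists (Poset le_refl le_anti le_trans), (fun t => enum_rank_in (cC t) (c t)).
have fu t : f (enum_rank_in (cC t) (c t)) = c t by rewrite /f enum_rankK_in.
split=> [z|t t'] /=.
  by exists (f z); apply: enum_val_inj; rewrite -/(f _) fu fc.
rewrite !fu; have /andP[h1 h2] := cP t; have /andP[h3 h4] := cP t'.
apply/idP/idP => H; first exact: rt h1 (rt _ _ _ H h4).
exact: rt h2 (rt _ _ _ H h3).
Qed.

Lemma embedding_eq (P Q : poset) (a b : embedding P Q) : a =1 b -> a = b.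
Proof.
case: a b => [f fi fl] [f' fi' fl'] /= /funext E; move: fi fl fi' fl'; rewrite E.
by move=> *; congr Embedding; apply: Prop_irrelevance.
Qed.

(** * The candidate measure built from a table of values *)

Section Nu.

Variable R : comNzRingType.
Variable g : nat -> nat -> R.
Hypothesis Hg : rels g.

Section NuT.

Variable T : finType.
Implicit Types (r : rel T) (D E B : {set T}) (s : seq T) (x y : T).

(** The list may repeat points or contain points equivalent to earlier ones: by [mx_dup] these
    contribute the factor 1. *)
Fixpoint nu r D s : R :=
  if s is x :: s' then mx g r D x * nu r (x |: D) s' else 1.

Lemma eq_nu r r' E D s : {in E &, r =2 r'} -> D \subset E -> {subset s <= E} ->
  nu r D s = nu r' D s.
Proof.
move=> rE; elim: s D => //= x s IH D DE sE.
have xE : x \in E by apply: sE; rewrite inE eqxx.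
have xDE : x |: D \subset E by rewrite subUset sub1set xE.
rewrite IH //; last by move=> y ys; apply: sE; rewrite inE ys orbT.
rewrite (eq_mx g (r' := r')) // => u v uD vD; apply: rE; exact: (subsetP xDE).
Qed.

Lemma nu_cat r D s s' : nu r D (s ++ s') = nu r D s * nu r (D :|: [set:: s]) s'.
Proof.
elim: s D => [|x s IH] D /=; first by rewrite mul1r set_nil setU0.
by rewrite IH mulrA set_cons setUA [D :|: _]setUC.
Qed.

Lemma nu_one r E D s : preo r E -> D \subset E -> {subset s <= E} ->
  (forall x, x \in s -> exists2 d, d \in D & r d x && r x d) -> nu r D s = 1.
Proof.
move=> pr; elim: s D => //= x s IH D DE sE H.
have xE : x \in E by apply: sE; rewrite inE eqxx.
have xDE : x |: D \subset E by rewrite subUset sub1set xE.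
have [|d dD /andP[dx xd]] := H x; first by rewrite inE eqxx.
rewrite (mx_dup _ _ dD dx xd); last exact: preo_sub pr.
rewrite mul1r IH // => y ys; first by apply: sE; rewrite inE ys orbT.
by have [|e eD He] := H y; [rewrite inE ys orbT|exists e; rewrite // inE eD orbT].
Qed.

Lemma nu_swap r E D x y s : preo r E -> D \subset E -> x \in E -> y \in E ->
  nu r D (x :: y :: s) = nu r D (y :: x :: s).
Proof.
move=> pr DE xE yE; have /preoP[rr _] := pr.
have [->//|xy] := eqVneq x y.
have xDE : x |: D \subset E by rewrite subUset sub1set xE.
have yDE : y |: D \subset E by rewrite subUset sub1set yE.
have xyDE : y |: (x |: D) \subset E by rewrite subUset sub1set yE.
have yxDE : x |: (y |: D) \subset E by rewrite subUset sub1set xE.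
rewrite /= !mulrA setUCA; congr (_ * _).
have M z (F : {set T}) : z \in F -> z |: F \subset E -> mx g r F z = 1.
  by move=> zF zFE; apply: (mx_dup g (d := z)) => //; [exact: preo_sub pr|apply: rr..];
     apply: (subsetP zFE); rewrite setU11.
case: (boolP (x \in D)) => xD.
  have -> : x |: D = D by apply/setUidPr; rewrite sub1set.
  by rewrite (M x D) // (M x (y |: D)) ?inE ?xD ?orbT // mul1r mulr1.
case: (boolP (y \in D)) => yD.
  have -> : y |: D = D by apply/setUidPr; rewrite sub1set.
  by rewrite (M y D) // (M y (x |: D)) ?inE ?yD ?orbT // mul1r mulr1.
by rewrite mx_swap //; apply: preo_sub pr.
Qed.

Lemma nu_perm r E D s s' : preo r E -> D \subset E -> {subset s <= E} ->
  perm_eq s s' -> nu r D s = nu r D s'.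
Proof.
move=> pr; elim: s D s' => [|x s IH] D s' DE sE.
  by move=> /perm_size/eqP; rewrite eq_sym => /nilP ->.
move=> H; have xs' : x \in s' by rewrite -(perm_mem H) inE eqxx.
have xE : x \in E by apply: sE; rewrite inE eqxx.
have xDE : x |: D \subset E by rewrite subUset sub1set xE.
case/splitPr: xs' H => s1 s2 H.
have s'E : {subset s1 ++ x :: s2 <= E} by move=> y; rewrite -(perm_mem H); apply: sE.
have {}H : perm_eq s (s1 ++ s2).
  by rewrite -(perm_cons x); apply: perm_trans H _; rewrite -[x :: s2]cat1s perm_catCA.
have -> : nu r D (s1 ++ x :: s2) = nu r D (x :: s1 ++ s2).
  elim: s1 D DE s'E {IH H xDE sE} => //= y s1 IH D DE s'E.
  have yE : y \in E by apply: s'E; rewrite inE eqxx.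
  rewrite IH; first exact: (nu_swap _ pr).
    by rewrite subUset sub1set yE.
  by move=> z zs; apply: s'E; rewrite inE zs orbT.
by rewrite /= (IH _ (s1 ++ s2)) // => y ys; apply: sE; rewrite inE ys orbT.
Qed.

Lemma nu_add_dup r E D c s : preo r E -> D \subset E -> c \in E -> {subset s <= E} ->
  (exists2 d, d \in D & r d c && r c d) -> nu r (c |: D) s = nu r D s.
Proof.
move=> pr; elim: s D => //= x s IH D DE cE sE [d dD /andP[dc cd]].
have xE : x \in E by apply: sE; rewrite inE eqxx.
have xDE : x |: D \subset E by rewrite subUset sub1set xE.
rewrite setUCA IH //; last 2 first.
- by move=> y ys; apply: sE; rewrite inE ys orbT.
- by exists d; rewrite ?dc // inE dD orbT.
case: (boolP (c \in D)) => cD; last first.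
  rewrite (mx_add_dup g (d := d)) //; apply: preo_sub pr.
  by rewrite !subUset !sub1set xE cE.
by have -> : c |: D = D by apply/setUidPr; rewrite sub1set.
Qed.

Lemma nu_base r E D D' s : preo r E -> D' \subset E -> {subset s <= E} -> D \subset D' ->
  (forall x, x \in D' -> exists2 d, d \in D & r d x && r x d) -> nu r D' s = nu r D s.
Proof.
move=> pr DE' sE DD' H.
have -> : D' = D :|: [set:: enum D'].
  apply/setP => x; rewrite !inE mem_enum; case xD: (x \in D) => //=.
  by rewrite (subsetP DD').
have H' x : x \in enum D' -> exists2 d, d \in D & r d x && r x d.
  by rewrite mem_enum; apply: H.
have : {subset enum D' <= E} by move=> x; rewrite mem_enum; apply: (subsetP DE').
have DE : D \subset E by apply: subset_trans DE'.
elim: (enum D') H' => [|c l IH] H' lE; first by rewrite set_nil setU0.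
have lE' : {subset l <= E} by move=> x xl; apply: lE; rewrite inE xl orbT.
rewrite set_cons setUCA (nu_add_dup pr) //; last 3 first.
- rewrite subUset DE; apply/subsetP => x; rewrite inE; exact: lE'.
- by apply: lE; rewrite inE eqxx.
- by have [|d dD Hd] := H' c; [rewrite inE eqxx|exists d; rewrite // inE dD].
by apply: IH => // x xl; apply: H'; rewrite inE xl orbT.
Qed.

(* The preorders on [B :|: s] that extend [r0] both on [B] and on [D :|: s], as sets of
   pairs; amalgamations correspond to such preorders on a disjoint union. *)
Definition sr (p : {set T * T}) : rel T := fun u v => (u, v) \in p.

Definition exts (r0 : rel T) B D s (p : {set T * T}) :=
  [&& preo (sr p) (B :|: [set:: s]),
      p \subset setX (B :|: [set:: s]) (B :|: [set:: s]),
      [forall u in B, forall v in B, sr p u v == r0 u v] &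
      [forall u in D :|: [set:: s], forall v in D :|: [set:: s], sr p u v == r0 u v]].

Lemma extsP r0 B D s (p : {set T * T}) : reflect
  [/\ preo (sr p) (B :|: [set:: s]),
      p \subset setX (B :|: [set:: s]) (B :|: [set:: s]),
      {in B &, sr p =2 r0} & {in D :|: [set:: s] &, sr p =2 r0}] (exts r0 B D s p).
Proof.
have P A : reflect {in A &, sr p =2 r0}
    [forall u in A, forall v in A, sr p u v == r0 u v].
  apply: (iffP forall_inP) => [H u v uA vA|H u uA].
    by have /forall_inP/(_ v vA)/eqP := H u uA.
  by apply/forall_inP => v vA; apply/eqP; apply: H.
by apply: (iffP and4P) => -[h1 h2 /P h3 /P h4].
Qed.

(** Induction on [s]: the extensions are sorted by the type of the first point [x] over the larger
    base [B]. These types all restrict to the type of [x] over [D], so their values add up to the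
    factor of [x] by [mz_restrict]. *)
Lemma exts_sum r0 B D s : D \subset B -> uniq s -> [disjoint s & B] ->
  preo r0 B -> preo r0 (D :|: [set:: s]) ->
  \sum_(p : {set T * T} | exts r0 B D s p) nu (sr p) B s = nu r0 D s.
Proof.
elim: s r0 B D => [|x s IH] r0 B D DB us dsB prB prD.
  pose p0 := [set q : T * T | [&& q.1 \in B, q.2 \in B & r0 q.1 q.2]].
  rewrite (big_pred1 p0) // => p; apply/extsP/eqP => [[_ h2 h3 _]|->].
    apply/setP => -[u v]; rewrite inE /=; have := subsetP h2 (u, v).
    rewrite set_nil setU0 inE /= => H.
    case: (boolP (u \in B)) H => uB; case: (boolP (v \in B)) => vB //=;
      try by move=> H; apply/negP => /H.
    by move=> _; rewrite -h3.
  rewrite !set_nil !setU0.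
  have E : {in B &, sr p0 =2 r0} by move=> u v uB vB; rewrite /sr inE /= uB vB.
  split=> //; first by rewrite (eq_preo E).
    by apply/subsetP => -[u v]; rewrite !inE /= => /and3P[-> ->].
  by move=> u v /(subsetP DB) uB /(subsetP DB); apply: E.
move: us => /= /andP[xs us].
have xB : x \notin B by rewrite (disjointFr dsB) // inE eqxx.
have dsB' : [disjoint s & B].
  by apply: disjointWl dsB; apply/subsetP => y; rewrite inE orbC => ->.
have xD : x \notin D by apply: contra xB; apply: (subsetP DB).
have sNB y : y \in s -> y \notin x |: B.
  move=> ys; rewrite in_setU1 negb_or (disjointFr dsB' ys) andbT.
  by apply: contraNneq xs => <-.
rewrite set_cons setUCA in prD.
have xxD : x |: D \subset x |: (D :|: [set:: s]) by apply: setUS; apply: subsetUl.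
rewrite (partition_big (fun p => tp (sr p) B x)
  (fun Z : {set T * bool} => (Z \subset dbl B) && (Z :&: dbl D == tp r0 D x))) /=; last first.
  move=> p /extsP[_ _ _ h4]; rewrite tp_sub tp_restrict //=.
  apply/eqP/eq_tp => d dD; rewrite set_cons in h4.
  by rewrite !h4 // !inE ?eqxx ?dD ?orbT.
transitivity (\sum_(Z : {set T * bool} | (Z \subset dbl B) && (Z :&: dbl D == tp r0 D x))
   mz g r0 B Z * nu r0 (x |: D) s); last first.
  by rewrite -mulr_suml mz_restrict ?tp_sub.
apply: eq_bigr => Z /andP[ZB /eqP ZD].
case: (boolP (vld r0 B Z)) => vZ; last first.
  (* An impossible type has value 0 and no extension realizes it. *)
  rewrite mz_vld0 // mul0r big1 // => p /andP[/extsP[h1 _ h3 _] /eqP E].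
  case/negP: vZ; rewrite -E.
  have := vld_tp (r := sr p) (D := B) (x := x).
  have {}h1 : preo (sr p) (x |: B).
    by apply: preo_sub h1; rewrite set_cons setUCA setUS // subsetUl.
  by move=> /(_ h1); rewrite (eq_vld _ h3).
(* The prescribed relation for the remaining points: [x] has type [Z] over [B], and [r0] is kept for
   pairs not inside [x |: B]. *)
pose r1 : rel T := fun u v =>
  if (u \in x |: B) && (v \in x |: B) then upd r0 x Z u v else r0 u v.
have r1B : {in x |: B &, r1 =2 upd r0 x Z} by move=> u v uB vB; rewrite /r1 uB vB.
have /preoP[rr rt] := prD.
have xx : r0 x x by apply: rr; rewrite setU11.
have updD : {in x |: D &, upd r0 x Z =2 r0}.
  move=> u v uD vD; rewrite -[in RHS](upd_tp (r := r0) (x := x) (D := D) xx uD vD).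
  rewrite -ZD /upd !in_setI !in_dbl /=.
  case: (eqVneq u x) => ux; case: (eqVneq v x) => vx //=.
    by move: vD; rewrite in_setU1 (negbTE vx) /= => ->; rewrite andbT.
  by move: uD; rewrite in_setU1 (negbTE ux) /= => ->; rewrite andbT.
have r1D : {in x |: (D :|: [set:: s]) &, r1 =2 r0}.
  move=> u v uD vD; rewrite /r1; case: ifP => // /andP[uB vB].
  have S w : w \in x |: B -> w \in x |: (D :|: [set:: s]) -> w \in x |: D.
    move=> wB; rewrite setUA in_setU inE => /orP[//|ws].
    by move: (sNB _ ws); rewrite wB.
  by apply: updD; apply: S.
transitivity (mz g r0 B Z *
   \sum_(p : {set T * T} | exts r1 (x |: B) (x |: D) s p) nu (sr p) (x |: B) s).
  rewrite mulr_sumr; apply: eq_big => [p|p].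
    have SE : B :|: [set:: x :: s] = x |: B :|: [set:: s].
      by rewrite set_cons setUCA setUA.
    have SD : D :|: [set:: x :: s] = x |: (D :|: [set:: s]) by rewrite set_cons setUCA.
    apply/andP/extsP => [[/extsP[h1 h2 h3 h4] /eqP E]|[h1 h2 h3 h4]].
      rewrite SE in h1 h2; rewrite SD in h4; split=> //.
        move=> u v uB vB; rewrite r1B //.
        have pxx : sr p x x by rewrite h4 ?setU11 // xx.
        rewrite -(upd_tp pxx uB vB) E /upd.
        case: eqP => // /eqP ux; case: eqP => // /eqP vx; apply: h3.
          by move: uB; rewrite in_setU1 (negbTE ux).
        by move: vB; rewrite in_setU1 (negbTE vx).
      by rewrite -setUA => u v uD vD; rewrite h4 // r1D.
    rewrite -setUA in h4; have E : tp (sr p) B x = Z.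
      rewrite -(tp_upd r0 xB ZB); apply: eq_tp => d dB.
      by rewrite !h3 ?setU11 ?setU1r // !r1B ?setU11 ?setU1r.
    split; last by apply/eqP.
    apply/extsP; rewrite SE SD; split=> // u v uD vD.
      by rewrite h3 ?setU1r // r1B ?setU1r // (upd_in _ _ xB).
    by rewrite h4 // r1D.
  move=> /andP[/extsP[h1 h2 h3 h4] /eqP E] /=; congr (_ * _).
  by rewrite /mx E; apply: eq_mz.
rewrite IH //.
- congr (_ * _); apply: (eq_nu r1D); rewrite ?setUS ?subsetUl //.
  by move=> y ys; rewrite !inE ys !orbT.
- exact: setUS.
- apply/pred0P => y /=; apply/negP => /andP[ys yB].
  by move: (sNB _ ys); rewrite yB.
- by rewrite (eq_preo r1B) upd_preo.
- by rewrite -setUA (eq_preo r1D).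
Qed.

End NuT.

Lemma nu_imset (T T' : finType) (f : T -> T') (r : rel T) (r' : rel T') (D : {set T}) s :
  injective f -> (forall u v, r u v = r' (f u) (f v)) ->
  nu r' (f @: D) (map f s) = nu r D s.
Proof.
move=> fi E; elim: s D => //= x s IH D; rewrite -imsetU1 IH (mx_imset g (r := r)) //.
Qed.

End Nu.

Lemma preo_ple (Q : poset) A : preo (@ple Q) A.
Proof.
apply/preoP; split=> [x _|x y z _ _ _]; [exact: ple_refl | exact: ple_trans].
Qed.

(** * Amalgamations as preorders on a disjoint union *)

Section AmalgamRelations.

Variables (P Q P' : poset) (a : embedding P Q) (b : embedding P P').

Notation T := ('I_(pcard Q) + 'I_(pcard P'))%type.

Definition am_map (A : amalgamation a b) (t : T) : 'I_(pcard (am_poset A)) :=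
  match t with inl y => am_b A y | inr x => am_a A x end.

Lemma am_map_surj A z : exists t, am_map A t = z.
Proof. by case: (am_cover z) => -[x ->]; [exists (inr x)|exists (inl x)]. Qed.

Definition am_rel A : {set T * T} := [set p | ple (am_map A p.1) (am_map A p.2)].

(** Both amalgamations are quotients of the same disjoint union, hence determined up to isomorphism
    by the preorder pulled back to it. *)
Lemma am_iso_rel A B : amalgamation_iso A B <-> am_rel A = am_rel B.
Proof.
split=> [[f [_ fa fb]]|E].
  have fm t : f (am_map A t) = am_map B t by case: t => x /=.
  by apply/setP => -[t t']; rewrite !inE /= (emap_le f) !fm.
have {}E t t' : ple (am_map A t) (am_map A t') = ple (am_map B t) (am_map B t').
  by have /setP/(_ (t, t')) := E; rewrite !inE.
have [s sK] := choice (@am_map_surj A).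
have sB t : am_map B (s (am_map A t)) = am_map B t.
  by apply: ple_anti; rewrite -!E sK ple_refl.
have fi : injective (fun z => am_map B (s z)).
  move=> z z' H; rewrite -(sK z) -(sK z'); apply: ple_anti.
  by rewrite !E H ple_refl.
have fle x y : ple x y = ple (am_map B (s x)) (am_map B (s y)) by rewrite -E !sK.
exists (Embedding fi fle); split=> /=.
- have [s' s'K] := choice (@am_map_surj B).
  exists (fun z => am_map A (s' z)) => z; last by rewrite sB s'K.
  apply: ple_anti; rewrite -{2 3}(sK z) !E s'K ple_refl //.
- by move=> x; exact: (sB (inr x)).
- by move=> x; exact: (sB (inl x)).
Qed.

(** What is known before amalgamating: the order of Q on the left summand, and that of P' through
    the partial identification [c] elsewhere. Undecided pairs get the default [false]. *)
Definition glue : rel T := fun u v =>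
  let c (t : T) := match t with
    | inr x => Some x
    | inl y => omap b [pick x | a x == y] end in
  match u, v with
  | inl y, inl y' => ple y y'
  | _, _ => if (c u, c v) is (Some x, Some x') then ple x x' else false
  end.

(** In the notation of [exts], the base D is the copy of P in Q, B is P' together with this copy,
    and the added points are those of Q outside P. The two copies of P are equivalent under
    [glue]. *)
Definition gD : {set T} := inl @: [set a x | x : 'I_(pcard P)].
Definition gB : {set T} := inr @: [set: 'I_(pcard P')] :|: gD.
Definition gs : seq T := [seq inl y | y <- enum 'I_(pcard Q) & y \notin [set a x | x : 'I_(pcard P)]].

Lemma pick_im x : [pick x' | a x' == a x] = Some x.
Proof.
by case: pickP => [x' /eqP/(@emap_inj _ _ a) -> //|/(_ x)]; rewrite eqxx.
Qed.

Variant gB_spec : T -> Prop :=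
| GBr x : gB_spec (inr x)
| GBl x : gB_spec (inl (a x)).

Lemma gBP t : t \in gB -> gB_spec t.
Proof.
case/setUP => [/imsetP[x _ ->]|/imsetP[_ /imsetP[x _ ->] ->]]; by constructor.
Qed.

Lemma glue_am A : {in gB &, sr (am_rel A) =2 glue}.
Proof.
move=> u v /gBP[] x /gBP[] y; rewrite /sr inE /= ?pick_im /= ?am_comm -?emap_le //.
Qed.

Lemma setU_gs : gD :|: [set:: gs] = inl @: [set: 'I_(pcard Q)].
Proof.
apply/setP => -[y|x]; rewrite in_setU inE.
  rewrite [RHS]imset_f ?inE //.
  rewrite mem_map; last by move=> ? ? [].
  rewrite mem_filter mem_enum andbT /gD.
  case: (boolP (y \in [set a x | x : 'I_(pcard P)])) => H; last by rewrite orbT.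
  by rewrite imset_f.
apply/orP/imsetP => [[/imsetP[? _ //]|/mapP[? _ //]]|[? _ //]].
Qed.

Lemma gB_gs : gB :|: [set:: gs] = [set: T].
Proof.
rewrite /gB -setUA setU_gs; apply/setP => -[y|x]; rewrite !inE; last by rewrite imset_f ?inE.
by rewrite [X in _ || X]imset_f ?orbT ?inE.
Qed.

Lemma glue_preo_B : preo glue gB.
Proof.
apply/preoP; split.
  by move=> u /gBP[] x; rewrite /= ?pick_im ple_refl.
move=> u v w /gBP[] x /gBP[] y /gBP[] z; rewrite /= ?pick_im /= ?(emap_le b);
  by rewrite -?emap_le ?(emap_le b); apply: ple_trans.
Qed.

(** An admissible preorder becomes an amalgamation by passing to its quotient poset with
    [realize]. *)
Lemma exts_am (p : {set T * T}) :
  exts glue gB gD gs p <-> exists A : amalgamation a b, am_rel A = p.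
Proof.
split=> [/extsP[h1 _ h3 h4]|[A <-]]; last first.
  have rp : preo (sr (am_rel A)) (gB :|: [set:: gs]).
    apply/preoP; split=> [x _|x y z _ _ _]; rewrite /sr !inE /=.
      exact: ple_refl.
    exact: ple_trans.
  apply/extsP; split=> //.
  - by rewrite gB_gs; apply/subsetP => -[u v] _; rewrite !inE.
  - exact: glue_am.
  - rewrite setU_gs => u v /imsetP[y _ ->] /imsetP[y' _ ->].
    by rewrite /sr inE /= -emap_le.
rewrite gB_gs in h1; rewrite setU_gs in h4.
have [S [u [us uE]]] := realize h1.
have ub : forall y y', ple y y' = ple (u (inl y)) (u (inl y')).
  by move=> y y'; rewrite -uE h4 ?imset_f.
have ua : forall x x', ple x x' = ple (u (inr x)) (u (inr x')).
  by move=> x x'; rewrite -uE h3 // inE imset_f.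
have inj_of n (S' : poset) (f : 'I_n -> 'I_(pcard S)) (r : rel 'I_n) :
    antisymmetric r -> (forall i j, r i j = ple (f i) (f j)) -> injective f.
  by move=> ra E i j H; apply: ra; rewrite !E H ple_refl.
pose eb := Embedding (inj_of _ S _ _ (@ple_anti Q) ub) ub.
pose ea := Embedding (inj_of _ S _ _ (@ple_anti P') ua) ua.
have comm x : eb (a x) = ea (b x).
  rewrite /=; apply: ple_anti; rewrite -!uE !h3 ?inE ?imset_f ?orbT //=.
  - by rewrite pick_im /= ple_refl.
  - by rewrite inE.
  - by rewrite inE.
have cover z : (exists x, z = ea x) \/ (exists y, z = eb y).
  by have [[y|x] <-] := us z; [right; exists y|left; exists x].
exists (Amalgamation comm cover); apply/setP => -[t t']; rewrite inE /=.
have M s : am_map (Amalgamation comm cover) s = u s by case: s.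
by rewrite !M -uE.
Qed.

End AmalgamRelations.

(** * The axioms of a measure for the candidate *)

Section NuEmbedding.

Variable R : comNzRingType.
Variable g : nat -> nat -> R.
Hypothesis Hg : rels g.

(** All points of Q are enumerated: those of the image contribute the factor 1, and no complement
    has to be listed. *)
Definition nue (P Q : poset) (a : embedding P Q) : R :=
  nu g (@ple Q) [set a x | x : 'I_(pcard P)] (enum 'I_(pcard Q)).

Lemma nue_iso P Q (a : embedding P Q) : bijective a -> nue a = 1.
Proof.
move=> [b _ bK]; apply: (nu_one g (E := setT)); rewrite ?preo_ple ?subsetT //.
  by move=> x _; rewrite inE.
move=> x _; exists x; rewrite ?ple_refl //.
by rewrite -(bK x) imset_f.
Qed.

(** Both bases can be enlarged to [D :|: D'], and both lists to their concatenation, by equivalent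
    points only, which changes no value; the lists are then permutations of each other. *)
Lemma nu_uniq_sets (T : finType) (r : rel T) (D D' : {set T}) s s' : preo r setT ->
  (forall x, x \in D -> exists2 d, d \in D' & r d x && r x d) ->
  (forall x, x \in D' -> exists2 d, d \in D & r d x && r x d) ->
  (forall x, x \in s -> exists2 d, (d \in D') || (d \in s') & r d x && r x d) ->
  (forall x, x \in s' -> exists2 d, (d \in D) || (d \in s) & r d x && r x d) ->
  nu g r D s = nu g r D' s'.
Proof.
move=> pr DD' D'D ss' s's; have /preoP[rr _] := pr.
have {}rr x : r x x by apply: rr; rewrite inE.
have sT (l : seq T) : {subset l <= [set: T]} by move=> x _; rewrite inE.
rewrite -(nu_base g pr (D' := D :|: D')) ?subsetT ?subsetUl //; last first.
  by move=> x /setUP[xD|/D'D //]; exists x; rewrite ?rr.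
rewrite -(nu_base g pr (D := D') (D' := D :|: D')) ?subsetT ?subsetUr //; last first.
  by move=> x /setUP[/DD' //|xD]; exists x; rewrite ?rr.
have K l l' : (forall x, x \in l' -> exists2 d, (d \in D :|: D') || (d \in l) & r d x && r x d) ->
    nu g r (D :|: D') l = nu g r (D :|: D') (l ++ l').
  move=> H; rewrite nu_cat [X in _ * X](nu_one g pr) ?subsetT ?mulr1 //.
  by move=> x /H[d dl Hd]; exists d; rewrite // !in_setU inE -in_setU.
rewrite (K s s') => [|x /s's[d dl Hd]]; last first.
  by exists d => //; case/orP: dl => [dD|->]; rewrite ?orbT // inE dD.
rewrite (K s' s) => [|x /ss'[d dl Hd]]; last first.
  by exists d => //; case/orP: dl => [dD|->]; rewrite ?orbT // inE dD orbT.
by apply: (nu_perm Hg pr); rewrite ?subsetT // perm_catC.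
Qed.

Lemma nue_comp P Q S (a : embedding P Q) (b : embedding Q S) :
  nue (comp_emb b a) = nue b * nue a.
Proof.
rewrite /nue mulrC.
have -> : [set comp_emb b a x | x : 'I_(pcard P)] = b @: [set a x | x : 'I_(pcard P)].
  by apply/setP => z; apply/imsetP/imsetP => [[x _ ->]|[_ /imsetP[x _ ->] ->]];
     [exists (a x); rewrite ?imset_f|exists x].
rewrite -(nu_imset g _ _ (@emap_inj _ _ b) (@emap_le _ _ b)).
have -> : [set b x | x : 'I_(pcard Q)] = [set:: map b (enum 'I_(pcard Q))].
  apply/setP => z; rewrite inE; apply/imsetP/mapP => -[x _ ->]; exists x => //.
  by rewrite mem_enum.
set D := b @: _; set l := map b _; set e := enum _.
(* Adding the image of Q before the other points splits the product. *)
transitivity (nu g (@ple S) D (l ++ e)).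
  apply: nu_uniq_sets; rewrite ?preo_ple // => x xD; exists x; rewrite ?ple_refl //.
    by rewrite mem_cat xD !orbT.
  by rewrite mem_enum inE orbT.
rewrite nu_cat; congr (_ * _).
rewrite (nu_base g (@preo_ple S setT) (D := [set:: l])) ?subsetT ?subsetUr //.
  by move=> x _; rewrite inE.
move=> z /setUP[/imsetP[x _ ->]|zl]; last by exists z; rewrite ?ple_refl.
by exists (b x); rewrite ?ple_refl // inE map_f // mem_enum.
Qed.

Lemma nue_glue P Q P' (a : embedding P Q) (b : embedding P P') :
  nu g (glue a b) (gD P' a) (gs P' a) = nue a.
Proof.
have E : {in inl @: [set: 'I_(pcard Q)] &, glue a b =2
    (fun u v => match u, v with inl y, inl y' => ple y y' | _, _ => true end)}.
  by move=> u v /imsetP[y _ ->] /imsetP[y' _ ->].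
rewrite /nue /gD /gs.
rewrite (eq_nu g E); last 2 first.
- exact/imsetS/subsetT.
- by move=> t /mapP[y _ ->]; rewrite imset_f.
rewrite (nu_imset g (r := @ple Q)) //; last by move=> ? ? [].
apply: nu_uniq_sets; rewrite ?preo_ple // => x xD; exists x; rewrite ?ple_refl //.
  by rewrite mem_enum orbT.
by rewrite mem_filter mem_enum andbT orbN.
Qed.

Lemma nue_am P Q P' (a : embedding P Q) (b : embedding P P') (A : amalgamation a b) :
  nue (am_a A) = nu g (sr (am_rel A)) (gB P' a) (gs P' a).
Proof.
have [s sK] := choice (@am_map_surj _ _ _ _ _ A).
have si : injective s by move=> z z' E; rewrite -(sK z) E sK.
have rE t t' : sr (am_rel A) t t' = ple (am_map A t) (am_map A t') by rewrite /sr inE.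
have pr : preo (sr (am_rel A)) setT.
  by apply/preoP; split=> [x _|x y z _ _ _]; rewrite !rE; [exact: ple_refl|exact: ple_trans].
rewrite /nue -(nu_imset g (f := s) (r' := sr (am_rel A))) //; last first.
  by move=> u v; rewrite rE !sK.
have eqv t z : am_map A t = z -> sr (am_rel A) (s z) t && sr (am_rel A) t (s z).
  by move=> <-; rewrite !rE sK ple_refl.
have eqv' t z : am_map A t = z -> sr (am_rel A) t (s z) && sr (am_rel A) (s z) t.
  by move=> H; rewrite andbC eqv.
apply: nu_uniq_sets => //.
- move=> _ /imsetP[_ /imsetP[x _ ->] ->]; exists (inr x); first by rewrite inE imset_f.
  exact: eqv'.
- move=> _ /gBP[] x.
    by exists (s (am_a A x)); [rewrite !imset_f|exact: eqv].
  exists (s (am_a A (b x))); first by rewrite !imset_f.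
  by apply: eqv; rewrite /= am_comm.
- move=> _ /mapP[z _ ->]; have : s z \in [set: 'I_(pcard Q) + 'I_(pcard P')] by rewrite inE.
  rewrite -(gB_gs P' a) in_setU inE => H; exists (s z) => //.
  by rewrite rE ple_refl.
- move=> t _; exists (s (am_map A t)); last exact: eqv.
  by rewrite map_f ?orbT // mem_enum.
Qed.

Lemma nue_amalg P Q P' (a : embedding P Q) (b : embedding P P') r
    (A : 'I_r -> amalgamation a b) :
  all_amalgamations A -> nue a = \sum_(i < r) nue (am_a (A i)).
Proof.
move=> allA; rewrite -(nue_glue a b).
rewrite -(exts_sum g (B := gB P' a)); first last.
- rewrite setU_gs; apply/preoP; split=> [_ /imsetP[x _ ->]|].
    exact: ple_refl.
  by move=> _ _ _ /imsetP[x _ ->] /imsetP[y _ ->] /imsetP[z _ ->]; apply: ple_trans.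
- exact: glue_preo_B.
- apply/pred0P => t /=; apply/negP => /andP[/mapP[y]].
  rewrite mem_filter => /andP[ya _] -> /setUP[/imsetP[? _ //]|/imsetP[y' H [E]]].
  by rewrite E H in ya.
- rewrite map_inj_uniq; last by move=> ? ? [].
  by apply: filter_uniq; apply: enum_uniq.
- exact: subsetUr.
(* By [am_iso_rel], [h] is a bijection from the representatives of the amalgamations onto the
   extensions counted by [exts_sum]. *)
pose h i := am_rel (A i).
have hi : injective h.
  move=> i j /am_iso_rel ij; have [k [_ kU]] := allA (A i).
  by rewrite -(kU j ij) (kU i) //; apply/am_iso_rel.
rewrite (eq_bigl [in h @: setT]) => [|p]; last first.
  apply/idP/imsetP => [/exts_am[B <-]|[i _ ->]].
    by have [i [/am_iso_rel -> _]] := allA B; exists i.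
  by apply/exts_am; exists (A i).
rewrite big_imset /=; last by move=> i j _ _; apply: hi.
by apply: eq_big => [i|i _]; rewrite ?inE ?nue_am.
Qed.

End NuEmbedding.

(** * Evaluation of an abstract measure between antichains *)

Definition antichain (T : finType) (r : rel T) (A : {set T}) :=
  forall a b, a \in A -> b \in A -> r a b -> a = b.

Definition below (T : finType) (r : rel T) (A B : {set T}) :=
  forall a b, a \in A -> b \in B -> r a b && ~~ r b a.

Definition gen (T : finType) (r : rel T) (A A1 : {set T}) :=
  (A1 \subset A) && [forall a in A, exists b in A1, r a b].

Lemma genP (T : finType) (r : rel T) (A A1 : {set T}) : reflect
  (A1 \subset A /\ forall a, a \in A -> exists2 b, b \in A1 & r a b) (gen r A A1).
Proof.
apply: (iffP andP) => -[S H]; split=> //.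
  by move=> a aA; have /existsP[b /andP[bA ab]] := forall_inP H a aA; exists b.
by apply/forall_inP => a /H[b bA ab]; apply/existsP; exists b; rewrite bA.
Qed.

(** In a generating subset of least size no element lies below another, since it could be
    dropped. *)
Lemma antichain_basis (T : finType) (r : rel T) (D A : {set T}) : preo r D -> A \subset D ->
  exists2 A1, gen r A A1 & antichain r A1.
Proof.
move=> /preoP[rr rt] /subsetP AD.
have gA : gen r A A by apply/genP; split=> // a aA; exists a; rewrite ?rr ?AD.
have [A1 g1 Hmin] := @arg_minnP _ A (gen r A) (fun S : {set T} => #|S|) gA.
exists A1 => // a b aA bA ab; apply: contraTeq isT => nab.
have /genP[/subsetP S H] := g1.
have : gen r A (A1 :\ a).
  apply/genP; split; first by apply: subset_trans (subD1set _ _) _; apply/subsetP.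
  move=> c cA; have [d dA cd] := H c cA.
  have [E|da] := eqVneq d a; last by exists d; rewrite // !inE da.
  exists b; first by rewrite !inE eq_sym nab.
  by apply: (rt c d b) => //; [exact: AD|exact/AD/S|exact/AD/S|rewrite E].
move/Hmin; rewrite (cardsD1 a A1) aA add1n ltnn //.
Qed.

Lemma kap_basis (T : finType) (r : rel T) (D A A1 : {set T}) : preo r D -> A \subset D ->
  gen r A A1 -> antichain r A1 -> kap r A = minn #|A1| 2.
Proof.
move=> /preoP[rr rt] /subsetP AD /genP[/subsetP S H] ac.
case: kapP => [A0|a aA Ha|a aA Ha].
- suff -> : A1 = set0 by rewrite cards0.
  by apply/setP => a; rewrite inE; apply/negP => /S; rewrite A0 inE.
- have [b bA ab] := H a aA.
  have -> : A1 = [set b].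
    apply/setP => c; rewrite inE; apply/idP/eqP => [cA|->//]; apply: ac => //.
    by apply: (rt c a b) => //; [exact/AD/S|exact: AD|exact/AD/S|exact/Ha/S].
  by rewrite cards1.
- rewrite (minn_idPr _) //; rewrite ltnNge; apply/negP; rewrite leq_eqVlt ltnS leqn0.
  have [b bA ab] := H a aA.
  case/orP=> [/cards1P[c E]|/eqP/cards0_eq E]; last by rewrite E inE in bA.
  have cA : c \in A by apply: S; rewrite E set11.
  by have [d dA] := Ha c cA; have [e eA de] := H d dA; rewrite E inE in eA;
     rewrite -(eqP eA) de.
Qed.

Section Strict.

Variables (T : finType) (R : comNzRingType).
Implicit Types (r : rel T) (A B D : {set T}).

(** A valid type properly containing [pairs A B] has a point d of A above the new point, or one of B
    below it. In the first case all of A lies below d, so the antichain A is d alone and the new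
    point is equivalent to it; the second case is dual. *)
Lemma strict_sum (r : rel T) A B (w : {set T * bool} -> R) :
  preo r (A :|: B) -> antichain r A -> antichain r B -> below r A B ->
  (forall Z : {set T * bool}, Z \subset dbl (A :|: B) -> ~~ vld r (A :|: B) Z -> w Z = 0) ->
  (forall d, d \in A :|: B -> w (tp r (A :|: B) d) = 1) ->
  \sum_(Z : {set T * bool} | (pairs A B \subset Z) && (Z \subset dbl (A :|: B))) w Z =
  w (pairs A B) + (#|A| == 1%N)%:R + (#|B| == 1%N)%:R.
Proof.
move=> pr acA acB ab w0 w1; have /preoP[rr rt] := pr.
set D := A :|: B in pr w0 w1 rr rt *.
have AD a : a \in A -> a \in D by rewrite inE => ->.
have BD a : a \in B -> a \in D by rewrite inE orbC => ->.
have dAB a : a \in A -> a \in B -> False.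
  by move=> aA aB; have /andP[_] := ab a a aA aB; rewrite rr ?AD.
have PD : pairs A B \subset dbl D by rewrite pairs_subset subsetUl subsetUr.
have tpv d : d \in D -> vld r D (tp r D d).
  by move=> dD; apply: vld_tp; have -> : d |: D = D by apply/setUidPr; rewrite sub1set.
have tpd d (Z : {set T * bool}) : d \in D -> vld r D Z -> (d, false) \in Z -> (d, true) \in Z ->
    Z = tp r D d.
  move=> dD /vldP[ZD v1 v2 v3] dl dh; apply/setP => -[e b]; rewrite inE /=.
  apply/idP/andP => [H|[eD H]].
    split; first by have := subsetP ZD _ H; rewrite in_dbl.
    by case: b H => H; apply: v3; rewrite inE.
  case: b H => H.
    by have := v2 d e eD H; rewrite !inE; apply.
  by have := v1 e d eD H; rewrite !inE; apply.
have Zc (Z : {set T * bool}) : pairs A B \subset Z -> vld r D Z -> Z != pairs A B ->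
    (exists2 a, A = [set a] & Z = tp r D a) \/ (exists2 b, B = [set b] & Z = tp r D b).
  rewrite subset_pairs => /andP[/subsetP Al /subsetP Bh] vZ ZP.
  have /vldP[ZD v1 v2 v3] := vZ.
  have /subsetPn[[d b] dZ] : ~~ (Z \subset pairs A B).
    apply: contra ZP => ZP; rewrite eqEsubset ZP subset_pairs /=.
    by apply/andP; split; apply/subsetP.
  have dD : d \in D by have := subsetP ZD _ dZ; rewrite in_dbl.
  case: b dZ => dZ; rewrite inE /= => nd; [left|right]; exists d.
  - have dA : d \in A by move: dD; rewrite inE (negbTE nd) orbF.
    apply/setP => a; rewrite inE; apply/idP/eqP => [aA|->//].
    by apply: acA => //; apply: v3; [exact: Al|rewrite inE].
  - apply: tpd => //; move: dD; rewrite inE (negbTE nd) orbF => /Al; by rewrite inE.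
  - have dB : d \in B by move: dD; rewrite inE (negbTE nd).
    apply/setP => a; rewrite inE; apply/idP/eqP => [aA|->//].
    by symmetry; apply: acB => //; apply: v3; [rewrite inE|exact: Bh].
  - apply: tpd => //; move: dD; rewrite inE (negbTE nd) => /Bh; by rewrite inE.
have tpA a : A = [set a] -> pairs A B \subset tp r D a.
  move=> E; rewrite subset_pairs; have aA : a \in A by rewrite E set11.
  apply/andP; split; apply/subsetP => c cA; rewrite !inE /=.
    by rewrite cA /=; move: cA; rewrite E inE => /eqP ->; rewrite rr ?AD.
  by rewrite cA orbT /=; have /andP[] := ab a c aA cA.
have tpB b : B = [set b] -> pairs A B \subset tp r D b.
  move=> E; rewrite subset_pairs; have bB : b \in B by rewrite E set11.
  apply/andP; split; apply/subsetP => c cA; rewrite !inE /=.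
    by rewrite cA /=; have /andP[] := ab c b cA bB.
  by rewrite cA orbT /=; move: cA; rewrite E inE => /eqP ->; rewrite rr ?BD.
have neA a : A = [set a] -> tp r D a != pairs A B.
  move=> E; apply/eqP => /setP/(_ (a, true)); rewrite !inE /=.
  have aA : a \in A by rewrite E set11.
  by rewrite aA /= rr ?AD // => /esym/(dAB _ aA).
have neB b : B = [set b] -> tp r D b != pairs A B.
  move=> E; apply/eqP => /setP/(_ (b, false)); rewrite !inE /=.
  have bB : b \in B by rewrite E set11.
  by rewrite bB orbT /= rr ?BD // => /esym aA; apply: dAB bB.
rewrite (bigD1 (pairs A B)) ?subxx //= -addrA; congr (_ + _).
case: (boolP (#|A| == 1%N)) => [/cards1P[a Ea]|nA].
  have aA : a \in A by rewrite Ea set11.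
  rewrite (bigD1 (tp r D a)) ?tp_sub ?tpA ?neA //= w1 ?AD //; congr (_ + _).
  case: (boolP (#|B| == 1%N)) => [/cards1P[b Eb]|nB].
    have bB : b \in B by rewrite Eb set11.
    have nab : tp r D b != tp r D a.
      apply/eqP => /setP/(_ (a, true)); rewrite !inE /= aA /= rr ?AD //.
      by have /andP[_ /negbTE ->] := ab a b aA bB.
    rewrite (bigD1 (tp r D b)) ?tp_sub ?tpB ?neB ?nab //= w1 ?BD // big1 ?addr0 //.
    move=> Z /andP[/andP[/andP[/andP[PZ ZD] nP] na] nb].
    case: (boolP (vld r D Z)) => vZ; last exact: w0.
    case: (Zc Z PZ vZ nP) => -[c Ec E].
      by move: na; rewrite E; move: Ec; rewrite Ea => /set1_inj ->; rewrite eqxx.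
    by move: nb; rewrite E; move: Ec; rewrite Eb => /set1_inj ->; rewrite eqxx.
  rewrite big1 // => Z /andP[/andP[/andP[PZ ZD] nP] na].
  case: (boolP (vld r D Z)) => vZ; last exact: w0.
  case: (Zc Z PZ vZ nP) => -[c Ec E].
    by move: na; rewrite E; move: Ec; rewrite Ea => /set1_inj ->; rewrite eqxx.
  by rewrite Ec cards1 in nB.
rewrite add0r; case: (boolP (#|B| == 1%N)) => [/cards1P[b Eb]|nB].
  have bB : b \in B by rewrite Eb set11.
  rewrite (bigD1 (tp r D b)) ?tp_sub ?tpB ?neB //= w1 ?BD // big1 ?addr0 //.
  move=> Z /andP[/andP[/andP[PZ ZD] nP] nb].
  case: (boolP (vld r D Z)) => vZ; last exact: w0.
  case: (Zc Z PZ vZ nP) => -[c Ec E].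
    by rewrite Ec cards1 in nA.
  by move: nb; rewrite E; move: Ec; rewrite Eb => /set1_inj ->; rewrite eqxx.
rewrite big1 // => Z /andP[/andP[PZ ZD] nP].
case: (boolP (vld r D Z)) => vZ; last exact: w0.
case: (Zc Z PZ vZ nP) => -[c Ec E].
  by rewrite Ec cards1 in nA.
by rewrite Ec cards1 in nB.
Qed.

End Strict.

(* The points [x] with A <= x <= B, for antichains A < B of sizes [p] and [q], are the
   new point of [J p q], the point of [A] if [p = 1] and the point of [B] if [q = 1]. *)
Definition shift1 (R : comNzRingType) (n : nat -> nat -> R) p q : R :=
  n p q + (p == 1%N)%:R + (q == 1%N)%:R.

(** The consequences of the axioms of a measure from which its values are computed, in terms of
    types over preorders. They are kept abstract so that the dual of a measure is an instance too,
    which halves the work on p and q. *)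
Record tmeas (R : comNzRingType)
    (m : forall T : finType, rel T -> {set T} -> T -> {set T * bool} -> R)
    (n : nat -> nat -> R) : Prop := TMeas {
  tm_vld : forall (T : finType) (r : rel T) (D : {set T}) x (Z : {set T * bool}), preo r D -> x \notin D ->
    Z \subset dbl D -> ~~ vld r D Z -> m T r D x Z = 0;
  tm_res : forall (T : finType) (r : rel T) (D D' : {set T}) x (Z : {set T * bool}), preo r D' -> x \notin D' ->
    D \subset D' -> Z \subset dbl D ->
    \sum_(Y : {set T * bool} | (Y \subset dbl D') && (Y :&: dbl D == Z)) m T r D' x Y
      = m T r D x Z;
  tm_dup : forall (T : finType) (r : rel T) (D : {set T}) x d, preo r D -> x \notin D ->
    d \in D -> m T r D x (tp r D d) = 1;
  tm_strict : forall (T : finType) (r : rel T) (A B : {set T}) x, preo r (A :|: B) ->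
    x \notin A :|: B -> antichain r A -> antichain r B -> below r A B ->
    m T r (A :|: B) x (pairs A B) = n #|A| #|B|;
  tm_swap : forall (T : finType) (r : rel T) (D : {set T}) x y (Z Y : {set T * bool}), preo r D -> x \notin D ->
    y \notin D -> x != y -> Z \subset dbl D -> Y \subset dbl (x |: D) ->
    m T r D x Z * m T (upd r x Z) (x |: D) y Y =
    m T r D y (swp D x y (Z, Y)).1 *
      m T (upd r y (swp D x y (Z, Y)).1) (y |: D) x (swp D x y (Z, Y)).2
}.

Section TypedMeasure.

Variables (R : comNzRingType)
  (m : forall T : finType, rel T -> {set T} -> T -> {set T * bool} -> R)
  (n : nat -> nat -> R).
Hypothesis Hm : tmeas m n.

Section Fixed.

Variable T : finType.
Implicit Types (r : rel T) (A B D : {set T}) (Z Y : {set T * bool}).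

Definition Gm r D x Z : R :=
  \sum_(Y : {set T * bool} | (Z \subset Y) && (Y \subset dbl D)) m r D x Y.

Lemma Gm_res r D D' x Z : preo r D' -> x \notin D' -> D \subset D' -> Z \subset dbl D ->
  Gm r D' x Z = Gm r D x Z.
Proof.
move=> pr xD DD ZD; rewrite /Gm.
rewrite (partition_big (fun Y => Y :&: dbl D)
  (fun X : {set T * bool} => (Z \subset X) && (X \subset dbl D))) /=; last first.
  by move=> Y /andP[ZY _]; rewrite subsetI ZY ZD subsetIr.
apply: eq_bigr => X /andP[ZX XD]; rewrite -(tm_res Hm pr xD DD XD).
apply: eq_bigl => Y; apply/andP/andP => [[/andP[_ ->] ->//]|[YD E]].
by rewrite YD E (subset_trans ZX) // -(eqP E) subsetIl.
Qed.

Lemma Gm_eqv r D x Z Z' : preo r D -> x \notin D ->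
  (forall Y, vld r D Y -> (Z \subset Y) = (Z' \subset Y)) -> Gm r D x Z = Gm r D x Z'.
Proof.
move=> pr xD E; rewrite /Gm big_mkcond [RHS]big_mkcond; apply: eq_bigr => Y _.
case: (boolP (Y \subset dbl D)) => YD; rewrite ?andbF //.
case: (boolP (vld r D Y)) => vY; first by rewrite E.
by rewrite (tm_vld Hm) // !if_same.
Qed.

Lemma Gm_nlea r D x Z : preo r D -> x \notin D -> ~~ lea r (lo Z) (hi Z) -> Gm r D x Z = 0.
Proof.
move=> pr xD nl; rewrite /Gm big1 // => Y /andP[/subsetP ZY YD].
apply: (tm_vld Hm) => //; apply: contra nl => /vldP[_ _ _ v3].
apply/leaP => a b aZ bZ; apply: v3; rewrite !inE in aZ bZ *; exact: ZY.
Qed.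

Lemma Gm_meets r D x Z : preo r D -> x \notin D -> Z \subset dbl D ->
  lea r (lo Z) (hi Z) -> meets r (lo Z) (hi Z) -> Gm r D x Z = 1.
Proof.
move=> pr xD ZD /leaP LE /meetsP[a [b [al bh ba]]]; have /preoP[rr rt] := pr.
have := ZD; rewrite subset_dbl => /andP[/subsetP lD /subsetP hD].
have aD := lD _ al; have bD := hD _ bh.
rewrite /Gm (bigD1 (tp r D a)) /=; last first.
  rewrite tp_sub andbT -(pairsK Z) subset_pairs; apply/andP; split; apply/subsetP => c cZ.
    rewrite !inE /= lD //=; apply: (rt c b a) => //; [exact: lD|exact: LE].
  by rewrite !inE /= hD //=; apply: LE.
rewrite (tm_dup Hm) // big1 ?addr0 // => Y /andP[/andP[/subsetP ZY YD] YE].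
apply: (tm_vld Hm) => //; apply: contra YE => /vldP[_ v1 v2 v3].
have aY : (a, false) \in Y by apply: ZY; rewrite !inE in al.
have bY : (b, true) \in Y by apply: ZY; rewrite !inE in bh.
have aY' : (a, true) \in Y.
  by have := v2 b a aD ba; rewrite !inE; apply.
apply/eqP/setP => -[c d]; rewrite inE /=; apply/idP/andP => [cY|[cD H]].
  split; first by have := subsetP YD _ cY; rewrite in_dbl.
  by case: d cY => cY; apply: v3; rewrite inE.
case: d H => H; first by have := v2 a c cD H; rewrite !inE; apply.
by have := v1 c a cD H; rewrite !inE; apply.
Qed.

(** Closure of valid types allows [Z] to be replaced by its generating antichains; [tm_res] then
    discards all other points of [D]. *)
Lemma Gm_strict r D x Z A B : preo r D -> x \notin D -> Z \subset dbl D ->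
  gen r (lo Z) A -> gen (op r) (hi Z) B ->
  antichain r A -> antichain r B -> below r A B ->
  Gm r D x Z = shift1 n #|A| #|B|.
Proof.
move=> pr xD ZD /genP[Al HA] /genP[Bh HB] acA acB ab.
have := ZD; rewrite subset_dbl => /andP[lD hD].
have ABD : A :|: B \subset D.
  by rewrite subUset (subset_trans Al) // (subset_trans Bh).
have pr' := preo_sub ABD pr; have xAB : x \notin A :|: B.
  by apply: contra xD; apply: (subsetP ABD).
have PD : pairs A B \subset dbl (A :|: B) by rewrite pairs_subset subsetUl subsetUr.
rewrite (Gm_eqv (Z' := pairs A B)) // => [|Y /vldP[YD v1 v2 _]].
  rewrite (Gm_res pr xD ABD PD) /Gm (strict_sum (r := r)) //.
  - by rewrite (tm_strict Hm).
  - by move=> Z0 Z0D nv; apply: (tm_vld Hm).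
  - by move=> d dAB; apply: (tm_dup Hm).
rewrite -(pairsK Z) !subset_pairs.
apply/andP/andP => -[/subsetP h1 /subsetP h2]; split; apply/subsetP => c cZ.
- by apply: h1; apply: (subsetP Al).
- by apply: h2; apply: (subsetP Bh).
- have [d dA cd] := HA c cZ; apply: v1 cd _; [exact: (subsetP lD)|exact: h1].
- have [d dA cd] := HB c cZ; apply: v2 cd _; [exact: (subsetP hD)|exact: h2].
Qed.

Lemma Gm_swap r D x y Z0 Y0 : preo r D -> x \notin D -> y \notin D -> x != y ->
  Z0 \subset dbl D -> Y0 \subset dbl (x |: D) ->
  \sum_(Z : {set T * bool} | (Z0 \subset Z) && (Z \subset dbl D))
     m r D x Z * Gm (upd r x Z) (x |: D) y Y0 =
  \sum_(Z : {set T * bool} | ((swp D x y (Z0, Y0)).1 \subset Z) && (Z \subset dbl D))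
     m r D y Z * Gm (upd r y Z) (y |: D) x (swp D x y (Z0, Y0)).2.
Proof.
move=> pr xD yD xy ZD YD.
under [RHS]eq_bigr do rewrite mulr_sumr.
rewrite -(sum_swp (fun Z Y => m r D y Z * m (upd r y Z) (y |: D) x Y)) //.
apply: eq_bigr => Z /andP[_ ZD']; rewrite mulr_sumr; apply: eq_bigr => Y /andP[_ YD'].
exact: (tm_swap Hm).
Qed.

(** The exchange of [x] and [y], restricted to pairs with [y] below [x] whose types contain [P1],
    [P2] and avoid [N1], [N2]. For the point added second only totals can be evaluated, hence the
    alternating sums. *)
Lemma Gm_swap_avoid r D x y (P1 N1 P2 N2 : {set T * bool}) : preo r D -> x \notin D -> y \notin D -> x != y ->
  P1 \subset dbl D -> N1 \subset dbl D -> P2 \subset dbl D -> N2 \subset dbl D ->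
  \sum_(Z : {set T * bool} | [&& P1 \subset Z, [disjoint Z & N1] & Z \subset dbl D])
     m r D x Z * (\sum_(V : {set T * bool} | V \subset N2) (-1) ^+ #|V| *
        Gm (upd r x Z) (x |: D) y ((x, true) |: P2 :|: V)) =
  \sum_(Z : {set T * bool} | [&& P2 \subset Z, [disjoint Z & N2] & Z \subset dbl D])
     m r D y Z * (\sum_(V : {set T * bool} | V \subset N1) (-1) ^+ #|V| *
        Gm (upd r y Z) (y |: D) x ((y, false) |: P1 :|: V)).
Proof.
move=> pr xD yD xy P1D N1D P2D N2D.
have S u : dbl D \subset dbl (u |: D) by apply: dbl_sub; apply: subsetUr.
have K v (W : {set T * bool}) b : W \subset dbl D -> (v, b) |: W \subset dbl (v |: D).
  by move=> WD; rewrite subUset sub1set in_dbl setU11 /= (subset_trans WD).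
(* The indicator of all prescribed relations and non-relations; both sides become full sums weighted
   by it, to which [sum_swp] applies. *)
pose c u b (Pa Na Pb Nb Z Y : {set T * bool}) : R :=
  [&& Pa \subset Z, [disjoint Z & Na], (u, b) |: Pb \subset Y & [disjoint Y & Nb]]%:R.
have step u v b (Pa Na Pb Nb : {set T * bool}) : Pa \subset dbl D -> Na \subset dbl D ->
    Pb \subset dbl D -> Nb \subset dbl D ->
  \sum_(Z : {set T * bool} | [&& Pa \subset Z, [disjoint Z & Na] & Z \subset dbl D])
     m r D u Z * (\sum_(V : {set T * bool} | V \subset Nb) (-1) ^+ #|V| *
        Gm (upd r u Z) (u |: D) v ((u, b) |: Pb :|: V)) =
  \sum_(Z : {set T * bool} | (set0 \subset Z) && (Z \subset dbl D))
    \sum_(Y : {set T * bool} | (set0 \subset Y) && (Y \subset dbl (u |: D)))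
     m r D u Z * m (upd r u Z) (u |: D) v Y * c u b Pa Na Pb Nb Z Y.
  move=> PaD NaD PbD NbD.
  transitivity (\sum_(Z : {set T * bool} | [&& Pa \subset Z, [disjoint Z & Na] & Z \subset dbl D])
    \sum_(Y : {set T * bool} | [&& (u, b) |: Pb \subset Y, [disjoint Y & Nb] & Y \subset dbl (u |: D)])
      m r D u Z * m (upd r u Z) (u |: D) v Y).
    apply: eq_bigr => Z _.
    by rewrite -mulr_sumr (sum_avoid _ (subset_trans NbD (S u)) (K u _ b PbD)).
  rewrite big_mkcond [RHS]big_mkcond; apply: eq_bigr => Z _; rewrite sub0set /=.
  case: (Z \subset dbl D); last by rewrite !andbF.
  rewrite andbT; case: ifP => [/andP[h1 h2]|nc].
    rewrite big_mkcond [RHS]big_mkcond; apply: eq_bigr => Y _; rewrite sub0set /= /c h1 h2 /=.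
    case: (Y \subset dbl (u |: D)); rewrite ?andbF // andbT.
    by case: ifP => _; rewrite ?mulr1 ?mulr0.
  by rewrite big1 // => Y _; rewrite /c !andbA nc mulr0.
rewrite (step x y true P1 N1 P2 N2) // (step y x false P2 N2 P1 N1) //.
have sw0 : swp D x y (set0, set0) = (set0, set0).
  by rewrite /swp /= set0I; congr pair; apply/setP => z; rewrite !inE andbF.
have := sum_swp (fun Z Y => m r D y Z * m (upd r y Z) (y |: D) x Y * c y false P2 N2 P1 N1 Z Y)
  xD yD xy (sub0set _) (sub0set _).
rewrite sw0 [(set0, set0).1]/= [(set0, set0).2]/= => <-.
apply: eq_bigr => Z /andP[_ ZD]; apply: eq_bigr => Y /andP[_ YD].
rewrite -(tm_swap Hm) //; congr (_ * _%:R); congr nat_of_bool.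
have nZ b : (y, b) \notin Z by apply/negP => /(subsetP ZD); rewrite in_dbl /= (negbTE yD).
have disI (N : {set T * bool}) : N \subset dbl D -> [disjoint Y :&: dbl D & N] = [disjoint Y & N].
  by move=> ND; rewrite -!setI_eq0 -setIA (setIidPr ND).
have disU (N : {set T * bool}) : N \subset dbl D ->
    [disjoint (swp D x y (Z, Y)).2 & N] = [disjoint Z & N].
  move=> ND; rewrite -!setI_eq0; congr (_ == _); apply/setP => -[d b].
  rewrite !in_setI in_setU; case dN: ((d, b) \in N); rewrite ?andbF // !andbT inE /=.
  have [dy|] := eqVneq d y; last by rewrite orbF.
  by move: (subsetP ND _ dN); rewrite in_dbl /= dy (negbTE yD).
rewrite disU // /swp /= disI // subsetI P2D andbT !subUset !sub1set.
rewrite in_setU (negbTE (nZ _)) inE /= eqxx /=.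
have -> : (P1 \subset Z :|: [set z | (z.1 == y) && ((x, ~~ z.2) \in Y)]) = (P1 \subset Z).
  apply/idP/idP => [/subsetP H|/subset_trans]; last by apply; apply: subsetUl.
  apply/subsetP => z zP; have := H z zP; rewrite in_setU => /orP[//|].
  rewrite inE => /andP[/eqP zy]; have := subsetP P1D _ zP.
  by rewrite in_dbl zy (negbTE yD).
by case: (P1 \subset Z); case: ((x, true) \in Y); case: (P2 \subset Y);
   case: [disjoint Z & N1]; case: [disjoint Y & N2].
Qed.

End Fixed.

End TypedMeasure.

Lemma shift1_ge2 (R : comNzRingType) (n : nat -> nat -> R) k q : (2 <= k)%N ->
  shift1 n k q = n k q + (q == 1%N)%:R.
Proof. by rewrite /shift1; case: k => [|[|k]] //= _; rewrite addr0. Qed.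

(** * Independence of the first index beyond 2 *)

(* The lower points of the configuration are [cap0], below [capM 0] and [capM 1] only,
   and the antichain of the [capM i]; the upper points form the antichain [capU]. Adding
   two points [x] and [c] with prescribed relations and non-relations in the two orders
   gives 0 on one side, where the terms cancel in pairs, and (n (p + 1) q - n p q)^2 up
   to sign on the other. *)
Section Cap.

Variables (p q : nat).
Hypothesis p2 : (2 <= p)%N.

Notation T := ((option 'I_p.+1 + 'I_q) + bool)%type.

Definition capr : rel T := fun u v =>
  match u, v with
  | inl (inl a), inl (inl b) => match a, b with
      | None, None => true
      | None, Some i => (i < 2)%N
      | Some i, Some j => i == j
      | Some _, None => false end
  | inl (inl _), inl (inr _) => true
  | inl (inr i), inl (inr j) => i == j
  | inl (inr _), inl (inl _) => false
  | _, _ => u == v end.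

Definition cap0 : T := inl (inl None).
Definition capM (i : 'I_p.+1) : T := inl (inl (Some i)).
Definition capU : {set T} := [set inl (inr j) | j : 'I_q].
Definition capD : {set T} := [set inl u | u : (option 'I_p.+1 + 'I_q)%type].

Lemma capM_inj : injective capM. Proof. by move=> i j []. Qed.

Lemma cap_preo : preo capr capD.
Proof.
apply/preoP; split; first by move=> _ /imsetP[[[i|]|j] _ ->] /=.
move=> _ _ _ /imsetP[u _ ->] /imsetP[v _ ->] /imsetP[w _ ->].
by case: u => [[i|]|i]; case: v => [[j|]|j]; case: w => [[k|]|k] //=;
  do ?[move=> /eqP -> | move=> ? /eqP <-].
Qed.

Lemma mem_capD u : inl u \in capD. Proof. exact: imset_f. Qed.
Lemma inr_capD b : inr b \notin capD. Proof. by apply/imsetP => -[]. Qed.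

Lemma card_capU : #|capU| = q.
Proof. by rewrite card_imset ?card_ord // => i j []. Qed.

Lemma shift1_capU (R : comNzRingType) (n : nat -> nat -> R) k :
  shift1 n k q = shift1 n k #|capU|.
Proof. by rewrite card_capU. Qed.

(** [i1] and [i4] index the two points above [cap0], and [i5] one that is not; p >= 2 makes room for
    all three. *)
Let i1 : 'I_p.+1 := ord0.
Let i4 : 'I_p.+1 := inord 1.
Let i5 : 'I_p.+1 := inord 2.

Lemma val_i4 : val i4 = 1%N. Proof. by rewrite /i4 /= inordK // ltnS ltnW. Qed.
Lemma val_i5 : val i5 = 2%N. Proof. by rewrite /i5 /= inordK // ltnS. Qed.
Lemma i14 : i1 != i4. Proof. by rewrite -val_eqE val_i4. Qed.
Lemma i15 : i1 != i5. Proof. by rewrite -val_eqE val_i5. Qed.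
Lemma i45 : i4 != i5. Proof. by rewrite -val_eqE val_i5 val_i4. Qed.

Lemma lt2E (i : 'I_p.+1) : (i < 2)%N = (i == i1) || (i == i4).
Proof.
rewrite -!val_eqE val_i4 /=; by case: (val i) => [|[|]].
Qed.

Definition capN : {set T * bool} := [set (capM i, false) | i in [set~ i5]].

Lemma capNP (V : {set T * bool}) : V \subset capN ->
  exists2 S : {set 'I_p.+1}, i5 \notin S & lo V = capM @: S /\ hi V = set0.
Proof.
move=> VN; exists [set i | (capM i, false) \in V].
  rewrite inE; apply/negP => /(subsetP VN)/imsetP[i].
  by rewrite !inE => ni [E]; rewrite E eqxx in ni.
split; apply/setP => u; rewrite inE.
  apply/idP/imsetP => [H|[i]]; last by rewrite inE => H ->.
  by have /imsetP[i _ [E]] := subsetP VN _ H; exists i; rewrite // inE -E.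
by rewrite inE; apply/negP => /(subsetP VN)/imsetP[i].
Qed.

Lemma capN_sub : capN \subset dbl capD.
Proof. by apply/subsetP => _ /imsetP[i _ ->]; rewrite in_dbl mem_capD. Qed.

Variables (R : idomainType)
  (m : forall T : finType, rel T -> {set T} -> T -> {set T * bool} -> R)
  (n : nat -> nat -> R).
Hypothesis Hm : tmeas m n.
Hypothesis Hn : forall i, (2 <= i <= p)%N -> n i q = n 2 q.

Notation x := (inr true : T).
Notation c := (inr false : T).

Lemma capU_sub : capU \subset capD.
Proof. by apply/subsetP => _ /imsetP[j _ ->]; rewrite mem_capD. Qed.

Lemma capM_sub (S : {set 'I_p.+1}) : capM @: S \subset capD.
Proof. by apply/subsetP => _ /imsetP[j _ ->]; rewrite mem_capD. Qed.

Lemma antichain_capU (r : rel T) : {in capD &, r =2 capr} -> antichain r capU.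
Proof.
move=> E _ _ /imsetP[i _ ->] /imsetP[j _ ->].
by rewrite E ?mem_capD //= => /eqP ->.
Qed.

Lemma gen_refl (r : rel T) (D A : {set T}) : preo r D -> A \subset D -> gen r A A.
Proof.
move=> /preoP[rr _] AD; apply/genP; split=> // a aA; exists a => //.
by apply: rr; apply: (subsetP AD).
Qed.

(** [P2] and [capN] are the relations and non-relations prescribed for [c], [P1] and [N1] those for
    [x]; moreover [c] is to lie below [x]. *)
Definition P2 : {set T * bool} := pairs [set cap0; capM i5] capU.
Definition P1 : {set T * bool} := pairs (cap0 |: capM @: [set~ i4]) capU.
Definition N1 : {set T * bool} := [set (capM i4, false)].

Lemma P2_sub : P2 \subset dbl capD.
Proof. by rewrite pairs_subset capU_sub andbT subUset !sub1set !mem_capD. Qed.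

Lemma P1_sub : P1 \subset dbl capD.
Proof. by rewrite pairs_subset capU_sub andbT subUset !sub1set mem_capD capM_sub. Qed.

Lemma N1_sub : N1 \subset dbl capD.
Proof. by rewrite sub1set in_dbl mem_capD. Qed.

(** The lower bound [cap0] is redundant as soon as [capM i1] or [capM i4], which lie above it, is
    among the bounds. *)
Lemma Gm_base (S : {set 'I_p.+1}) V : i5 \notin S -> lo V = capM @: S -> hi V = set0 ->
  Gm m capr capD c (P2 :|: V) =
  shift1 n (#|S| + (if (i1 \in S) || (i4 \in S) then 1 else 2)) q.
Proof.
move=> S5 lV hV.
have prD := cap_preo; have cD := inr_capD false.
have VD : P2 :|: V \subset dbl capD.
  by rewrite subUset P2_sub -(pairsK V) pairs_subset lV hV sub0set capM_sub.
pose S' := i5 |: S; have cS' : #|S'| = #|S|.+1 by rewrite cardsU1 S5.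
have loE : lo (P2 :|: V) = cap0 |: capM @: S'.
  by rewrite loU lo_pairs lV imsetU1 setUA.
have hiE : hi (P2 :|: V) = capU by rewrite hiU hi_pairs hV setU0.
have gU : gen (op capr) capU capU.
  have prD' : preo (op capr) capD by rewrite op_preo.
  exact: gen_refl prD' capU_sub.
have aU : antichain capr capU by apply: antichain_capU.
case: ifP => H14.
  rewrite addn1 -cS' -(card_imset _ capM_inj) shift1_capU.
  apply: (Gm_strict Hm) => //; rewrite ?loE ?hiE //.
  - apply/genP; split; first exact: subsetUr.
    move=> a /setU1P[->|aS]; last first.
      exists a => //; have /preoP[rr _] := prD; apply: rr; exact: (subsetP (capM_sub S')).
    case/orP: H14 => H; [exists (capM i1)|exists (capM i4)];
      by rewrite ?imset_f ?inE ?H ?orbT //= lt2E eqxx ?orbT.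
  - by move=> _ _ /imsetP[i _ ->] /imsetP[j _ ->] /= /eqP ->.
  - by move=> _ _ /imsetP[i _ ->] /imsetP[j _ ->].
have cA : #|cap0 |: capM @: S'| = (#|S| + 2)%N.
  rewrite cardsU1 card_imset ?cS'; last exact: capM_inj.
  suff -> : cap0 \notin capM @: S' by rewrite addnC addn1 addn2.
  by apply/imsetP => -[].
rewrite -cA shift1_capU; apply: (Gm_strict Hm) => //; rewrite ?loE ?hiE //.
- apply: (gen_refl prD).
  by rewrite subUset sub1set mem_capD capM_sub.
- have nS i : i \in S' -> (i < 2)%N = false.
    move=> iS; rewrite lt2E; apply: contraFF H14 => /orP[/eqP E|/eqP E];
    move: iS; rewrite E !inE ?(negbTE i15) ?(negbTE i45) /= => ->; by rewrite ?orbT.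
  move=> _ _ /setU1P[->|/imsetP[i iS ->]] /setU1P[->|/imsetP[j jS ->]] //=.
    by rewrite nS.
  by move=> /eqP ->.
- by move=> _ _ /setU1P[->|/imsetP[i _ ->]] /imsetP[j _ ->].
Qed.

(** In the inclusion-exclusion over [capN] every antichain has a size between 2 and p, where [n] is
    constant by assumption, except for [V = capN], which gives size p + 1. The constant part
    cancels. *)
Lemma Gm_outer :
  \sum_(Z : {set T * bool} | [&& P2 \subset Z, [disjoint Z & capN] & Z \subset dbl capD])
     m capr capD c Z = (-1) ^+ #|capN| * (n p.+1 q - n 2 q).
Proof.
rewrite (sum_avoid _ capN_sub P2_sub).
have cN : #|[set~ i5]| = p by rewrite cardsC1 card_ord.
have E (V : {set T * bool}) : V \subset capN ->
    Gm m capr capD c (P2 :|: V) = shift1 n 2 q + (V == capN)%:R * (n p.+1 q - n 2 q).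
  move=> VN; have [S S5 [lV hV]] := capNP VN; rewrite (Gm_base S5 lV hV).
  have SS : S \subset [set~ i5].
    by apply/subsetP => i iS; rewrite !inE; apply: contraNneq S5 => <-.
  have [VE|VNE] := eqVneq V capN.
    have -> : S = [set~ i5].
      apply/setP => i; rewrite -(mem_imset _ _ capM_inj) -lV VE inE.
      by rewrite mem_imset // => j k [].
    rewrite !inE i15 /= cN mul1r addn1 !shift1_ge2 //; last exact: ltnW.
    by rewrite [RHS]addrAC [n 2 q + _]addrC subrK.
  have SP : (#|S| < p)%N.
    apply: leq_trans (_ : #|[set~ i5]| <= p)%N; last by rewrite cN.
    apply: proper_card; rewrite properEneq SS andbT.
    apply: contra VNE => /eqP SE; apply/eqP/setP => -[t b].
    rewrite /capN -SE; case: b.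
      have /setP/(_ t) := hV; rewrite !inE => ->; symmetry.
      by apply/negP => /imsetP[].
    have /setP/(_ t) := lV; rewrite inE => ->; apply/imsetP/imsetP => -[i iS].
      by move=> ->; exists i.
    by case=> ->; exists i.
  rewrite mul0r addr0.
  case: ifP => H14.
    have S0 : (0 < #|S|)%N.
      by rewrite card_gt0; apply/set0Pn; case/orP: H14 => H; [exists i1|exists i4].
    by rewrite addn1 !shift1_ge2 // Hn // !ltnS S0 SP.
  (* Here [S] misses [i1], [i4] and [i5], three of the p + 1 indices. *)
  have SP2 : (#|S| + 2 <= p)%N.
    have : (#|i1 |: (i4 |: S)| <= #|[set~ i5]|)%N.
      by apply: subset_leq_card; rewrite !subUset !sub1set SS !inE i15 i45.
    move/negbT: H14; rewrite negb_or => /andP[n1 n4].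
    by rewrite cN !cardsU1 !inE (negbTE n1) (negbTE n4) (negbTE i14) /= addnA addnC.
  rewrite addn2 in SP2 *.
  by rewrite !shift1_ge2 // Hn //= SP2.
transitivity (\sum_(V : {set T * bool} | V \subset capN) ((-1) ^+ #|V| * shift1 n 2 q +
   (-1) ^+ #|V| * (V == capN)%:R * (n p.+1 q - n 2 q))).
  apply: eq_bigr => V VN; rewrite -mulrA -mulrDr -E //.
rewrite big_split /= -mulr_suml.
have -> : \sum_(V : {set T * bool} | V \subset capN) (-1) ^+ #|V| = 0 :> R.
  transitivity (\sum_(V : {set T * bool} | (set0 \subset V) && (V \subset capN))
     (-1) ^+ #|V :\: set0| : R).
    by apply: eq_big => [V|V _]; rewrite ?sub0set ?setD0.
  rewrite sum_signed ?sub0set //; suff -> : (capN == set0) = false by [].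
  apply/negbTE/set0Pn; exists (capM i1, false); apply: imset_f.
  by rewrite !inE i15.
rewrite mul0r add0r (bigD1 capN) ?subxx //= eqxx mulr1 big1 ?addr0 //.
by move=> V /andP[_ /negbTE ->]; rewrite mulr0 mul0r.
Qed.

(** The point [c] lies above [cap0] and [capM i5] and is incomparable to the other [capM i], so the
    lower bounds of [x] are generated by [c] and the [capM i] with [i] in [S]. *)
Lemma Gm_inner (Z : {set T * bool}) (S : {set 'I_p.+1}) W :
  vld capr capD Z -> P2 \subset Z -> [disjoint Z & capN] -> i5 \notin S ->
  i1 \in S -> lo W = c |: (cap0 |: capM @: (i5 |: S)) -> hi W = capU ->
  Gm m (upd capr c Z) (c |: capD) x W = shift1 n #|S|.+1 q.
Proof.
move=> vZ P2Z dZ S5 S1 lW hW.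
have prD := cap_preo; have cD := inr_capD false.
have /vldP[ZD v1 v2 v3] := vZ.
set r := upd _ _ _.
have U : {in capD &, r =2 capr} by apply: upd_in.
have UL d : d \in capD -> r d c = (d \in lo Z).
  by move=> dD; rewrite /r upd_lo ?inE // (memPn cD).
have UH d : d \in capD -> r c d = (d \in hi Z).
  by move=> dD; rewrite /r upd_hi ?inE // (memPn cD).
have pr : preo r (c |: capD) by rewrite upd_preo.
have xD : x \notin c |: capD by rewrite in_setU1 /= inr_capD.
move: P2Z; rewrite subset_pairs subUset !sub1set => /andP[/andP[Z0 Z5] /subsetP ZU].
have ZM i : i != i5 -> capM i \notin lo Z.
  move=> ni; apply/negP => H; move/pred0P: dZ => /(_ (capM i, false)) /=.
  by rewrite inE in H; rewrite H /= imset_f // !inE.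
have hM i : capM i \notin hi Z.
  apply/negP => H; have [E|ni] := eqVneq i i5; last first.
    by have := v3 _ _ Z5 H; rewrite /= eq_sym (negbTE ni).
  by have := v3 _ _ Z0 H; rewrite /= E lt2E eq_sym (negbTE i15) eq_sym (negbTE i45).
have cM : c \notin capM @: S by apply/imsetP => -[].
have -> : (#|S|.+1 = #|c |: capM @: S|)%N.
  by rewrite cardsU1 cM card_imset //; exact: capM_inj.
rewrite shift1_capU; have SD := capM_sub S.
have WD : W \subset dbl (c |: capD).
  rewrite -(pairsK W) pairs_subset lW hW (subset_trans capU_sub (subsetUr _ _)) andbT.
  by rewrite setUS // subUset sub1set mem_capD capM_sub.
apply: (Gm_strict Hm) => //; rewrite ?lW ?hW.
- apply/genP; split.
    by apply: setUS; rewrite imsetU1; do 2?[apply: subset_trans (subsetUr _ _)].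
  move=> a /setU1P[->|/setU1P[->|/imsetP[i]]].
  + by exists c; rewrite ?setU11 // /r /upd eqxx.
  + by exists c; rewrite ?setU11 // UL ?mem_capD.
  + move=> /setU1P[->|iS] ->.
      by exists c; rewrite ?setU11 // UL ?mem_capD.
    exists (capM i); first by rewrite setU1r // imset_f.
    by rewrite U ?mem_capD //=.
- have pr' : preo (op r) (c |: capD) by rewrite op_preo.
  exact: gen_refl pr' (subset_trans capU_sub (subsetUr _ _)).
- move=> a b /setU1P[->|/imsetP[i iS ->]] /setU1P[->|/imsetP[j jS ->]] //.
  + by rewrite UH ?mem_capD // (negbTE (hM _)).
  + rewrite UL ?mem_capD // (negbTE (ZM _ _)) //.
    by apply: contraNneq S5 => <-.
  + by rewrite U ?mem_capD //= => /eqP ->.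
- exact: (antichain_capU U).
- move=> a b /setU1P[->|/imsetP[i iS ->]] /imsetP[j _ ->].
    have jU : inl (inr j) \in capU by apply: imset_f.
    rewrite UH ?mem_capD // ZU //= UL ?mem_capD //.
    apply/negP => H; have := v1 (capM i1) _ (mem_capD _) _ H => /(_ isT).
    by apply/negP; apply: ZM; exact: i15.
  by rewrite !U ?mem_capD.
Qed.

(** Adding [capM i1] to the lower bounds makes [cap0] redundant, so the generating antichain keeps
    its size, [#|S|.+2]. If [capM i4] is among the bounds, both totals vanish because it is not
    below [x]. *)
Lemma Gm_cross (Z V : {set T * bool}) :
  vld capr capD Z -> P1 \subset Z -> [disjoint Z & N1] ->
  V \subset capN -> (capM i1, false) \notin V ->
  Gm m (upd capr x Z) (x |: capD) c ((x, true) |: P2 :|: V) =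
  Gm m (upd capr x Z) (x |: capD) c ((x, true) |: P2 :|: ((capM i1, false) |: V)).
Proof.
move=> vZ P1Z dZ VN V1; have [S S5 [lV hV]] := capNP VN.
have S1 : i1 \notin S.
  by apply: contra V1 => H; have := imset_f capM H; rewrite -lV inE.
have prD := cap_preo; have cD := inr_capD true.
have /vldP[ZD v1 v2 v3] := vZ.
set r := upd _ _ _.
have U : {in capD &, r =2 capr} by apply: upd_in.
have UL d : d \in capD -> r d x = (d \in lo Z).
  by move=> dD; rewrite /r upd_lo ?inE // (memPn cD).
have UH d : d \in capD -> r x d = (d \in hi Z).
  by move=> dD; rewrite /r upd_hi ?inE // (memPn cD).
have pr : preo r (x |: capD) by rewrite upd_preo.
have xD : c \notin x |: capD by rewrite in_setU1 /= inr_capD.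
move: P1Z; rewrite subset_pairs subUset !sub1set => /andP[/andP[Z0 /subsetP ZM] /subsetP ZU].
have Z4 : capM i4 \notin lo Z.
  by apply/negP => H; move/pred0P: dZ => /(_ (capM i4, false)) /=; rewrite inE in H;
     rewrite H inE eqxx.
have {}ZM i : i != i4 -> capM i \in lo Z by move=> ni; apply/ZM/imset_f; rewrite !inE.
have hM i : capM i \notin hi Z.
  apply/negP => H.
  have h1 := v3 _ _ (ZM i1 i14) H; rewrite /= in h1.
  have h5 : i5 != i4 by rewrite eq_sym i45.
  have := v3 _ _ (ZM i5 h5) H; rewrite /= -(eqP h1) eq_sym (negbTE i15) //.
have h0 : cap0 \notin hi Z by apply/negP => H; have := v3 _ _ (ZM i1 i14) H.
pose A a := a |: capM @: (i5 |: S).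
have W1 : lo ((x, true) |: P2 :|: V) = A cap0.
  rewrite !loU lo_pairs lV /A imsetU1.
  by apply/setP => d; rewrite !inE /= xpair_eqE andbF /= -!orbA.
have W2 : lo ((x, true) |: P2 :|: ((capM i1, false) |: V)) = cap0 |: A (capM i1).
  rewrite !loU lo_pairs lV /A imsetU1.
  apply/setP => d; rewrite !inE /= !xpair_eqE !andbF !andbT /=.
  by move: (d == cap0) (d == capM i5) (d == capM i1) (d \in _) => [] [] [] [].
have hiE (V' : {set T * bool}) : hi V' = set0 -> hi ((x, true) |: P2 :|: V') = x |: capU.
  move=> hV'; rewrite !hiU hi_pairs hV' setU0; congr (_ :|: _).
  by apply/setP => d; rewrite !inE /= xpair_eqE andbT.
have h1 := hiE V hV.
have h2 : hi ((x, true) |: P2 :|: ((capM i1, false) |: V)) = x |: capU.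
  apply: hiE; rewrite hiU hV setU0; apply/setP => d.
  by rewrite !inE xpair_eqE andbF.
case: (boolP (i4 \in S)) => S4.
  have NL (W : {set T * bool}) : capM i4 \in lo W -> x \in hi W -> ~~ lea r (lo W) (hi W).
    move=> l4 hx; apply/negP => /leaP/(_ _ _ l4 hx); rewrite UL ?mem_capD //.
    exact/negP.
  by rewrite !(Gm_nlea Hm pr xD) //; apply: NL; rewrite ?W1 ?W2 ?h1 ?h2 ?setU11 //
    /A ?in_setU ?(mem_imset _ _ capM_inj) ?inE ?S4 ?orbT.
have AD a : a \in capD -> A a \subset capD.
  by move=> aD; rewrite subUset sub1set aD capM_sub.
have AxD a : a \in capD -> A a \subset x |: capD.
  by move=> aD; apply: subset_trans (AD a aD) (subsetUr _ _).
have WD (W : {set T * bool}) : lo W \subset capD -> hi W = x |: capU ->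
    W \subset dbl (x |: capD).
  move=> lW hW; rewrite -(pairsK W) pairs_subset hW setUS ?capU_sub // andbT.
  by rewrite (subset_trans lW) // subsetUr.
have SZ i : i \in i5 |: S -> i != i4.
  by move=> iS; apply: contraNneq S4 => Ei; move: iS; rewrite Ei in_setU1 (negbTE i45).
have gB : gen (op r) (x |: capU) [set x].
  apply/genP; split; first exact: subsetUl.
  move=> a /setU1P[->|aU]; exists x; rewrite ?set11 //.
  by rewrite /op UH ?ZU //; apply: (subsetP capU_sub).
have aB : antichain r [set x] by move=> a b /set1P -> /set1P ->.
have bel a : a \in lo Z -> a \notin hi Z -> a \in capD -> below r (A a) [set x].
  move=> al ah aD u v uA /set1P ->.
  have [ul uh uD] : [/\ u \in lo Z, u \notin hi Z & u \in capD].
    case/setU1P: uA => [->//|/imsetP[i iS ->]]; split; rewrite ?mem_capD //.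
    exact/ZM/SZ.
  by rewrite UL // UH // ul.
have cA a : a \notin capM @: (i5 |: S) -> #|A a| = #|S|.+2.
  by move=> na; rewrite cardsU1 na card_imset ?cardsU1 ?S5 //; exact: capM_inj.
have c1 : #|A cap0| = #|S|.+2 by apply: cA; apply/imsetP => -[].
have c2 : #|A (capM i1)| = #|S|.+2.
  by apply: cA; rewrite (mem_imset _ _ capM_inj) in_setU1 (negbTE i15).
transitivity (shift1 n #|A cap0| #|[set x]|).
  apply: (Gm_strict Hm); rewrite ?W1 ?h1 //.
  - by apply: WD; rewrite ?W1 ?h1 ?AD ?mem_capD.
  - by apply: (gen_refl pr); rewrite AxD ?mem_capD.
  - move=> a b /setU1P[->|/imsetP[i iS ->]] /setU1P[->|/imsetP[j jS ->]] //;
      rewrite U ?mem_capD //=; last by move=> /eqP ->.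
    rewrite lt2E (negbTE (SZ _ jS)) orbF => /eqP E; move: jS; rewrite E in_setU1.
    by rewrite (negbTE i15) (negbTE S1).
  - by apply: bel; rewrite ?mem_capD.
rewrite c1 -c2; symmetry; apply: (Gm_strict Hm); rewrite ?W2 ?h2 //.
- by apply: WD; rewrite ?W2 ?h2 // subUset sub1set mem_capD AD ?mem_capD.
- apply/genP; split; first exact: subsetUr.
  move=> a /setU1P[->|aA].
    by exists (capM i1); rewrite ?setU11 // U ?mem_capD //=.
  by exists a; rewrite // U ?(subsetP (AD _ (mem_capD _)) _ aA) //;
    have /preoP[rr _] := prD; apply: rr; apply: (subsetP (AD _ (mem_capD _)) _ aA).
- move=> a b; rewrite /A -imsetU1 => /imsetP[i iS ->] /imsetP[j jS ->].
  by rewrite U ?mem_capD //= => /eqP ->.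
- by apply: bel; rewrite ?mem_capD // ZM // i14.
Qed.

Lemma cap_step : n p.+1 q = n p q.
Proof.
have prD := cap_preo; have xD := inr_capD true; have cD := inr_capD false.
have xc : x != c by [].
have := Gm_swap_avoid Hm prD xD cD xc P1_sub N1_sub P2_sub capN_sub.
(* With [x] added first, toggling [capM i1] cancels the terms in pairs. *)
rewrite big1 => [|Z /and3P[P1Z dZ ZD]]; last first.
  case: (boolP (vld capr capD Z)) => vZ; last by rewrite (tm_vld Hm) // mul0r.
  rewrite (sum_toggle (u := (capM i1, false))) => [|V]; last first.
    by rewrite subUset sub1set imset_f // !inE i15.
  rewrite big1 ?mulr0 // => V /andP[VN V1].
  by rewrite (Gm_cross vZ P1Z dZ VN V1) cardsU1 V1 add1n exprS mulN1r mulNr subrr.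
(* With [c] added first, the factor of [x] is the same for all valid types of [c]: forbidding
   [capM i4] subtracts an antichain of size p + 1 from one of size p. *)
have E : forall Z : {set T * bool},
   [&& P2 \subset Z, [disjoint Z & capN] & Z \subset dbl capD] ->
   m capr capD c Z * (\sum_(V : {set T * bool} | V \subset N1) (-1) ^+ #|V| *
     Gm m (upd capr c Z) (c |: capD) x ((c, false) |: P1 :|: V)) =
   m capr capD c Z * (n p q - n p.+1 q).
  move=> Z /and3P[P2Z dZ ZD].
  case: (boolP (vld capr capD Z)) => vZ; last by rewrite (tm_vld Hm) // !mul0r.
  congr (_ * _).
  have hc b : hi ((c, b) |: set0) = if b then [set c] else set0.
    by apply/setP => d; case: b; rewrite !inE orbF xpair_eqE ?andbT ?andbF.
  have lE : lo ((c, false) |: P1) = c |: (cap0 |: capM @: (i5 |: [set~ i4] :\ i5)).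
    rewrite loU lo_pairs setD1K ?inE 1?eq_sym ?i45 //; congr (_ :|: _).
    by apply/setP => d; rewrite !inE xpair_eqE andbT.
  have hE : hi ((c, false) |: P1) = capU.
    rewrite hiU hi_pairs; apply/setP => d.
    by rewrite !inE xpair_eqE andbF.
  have sE : \sum_(V : {set T * bool} | V \subset N1) (-1) ^+ #|V| *
     Gm m (upd capr c Z) (c |: capD) x ((c, false) |: P1 :|: V) =
     Gm m (upd capr c Z) (c |: capD) x ((c, false) |: P1) -
     Gm m (upd capr c Z) (c |: capD) x ((c, false) |: P1 :|: N1).
    rewrite (bigD1 set0) ?sub0set //= cards0 mul1r setU0; congr (_ + _).
    rewrite (big_pred1 N1) ?cards1 ?expr1 ?mulN1r // => V /=.
    rewrite subset1; have [->|V0] := eqVneq V set0; rewrite ?orbT ?orbF ?andbF ?andbT //.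
    by symmetry; apply/negbTE; rewrite eq_sym; apply/set0Pn; exists (capM i4, false);
      rewrite set11.
  have c1 : #|[set~ i4] :\ i5| = p.-1.
    have := cardsD1 i5 [set~ i4]; rewrite cardsC1 card_ord !inE eq_sym i45 add1n.
    by move=> /= E1; rewrite [X in _ = X.-1]E1.
  have c2 : #|[set~ i5]| = p by rewrite cardsC1 card_ord.
  have p1 : p.-1.+1 = p by rewrite prednK // ltnW.
  rewrite sE (Gm_inner (S := [set~ i4] :\ i5) vZ P2Z dZ _ _ lE hE) ?inE ?eqxx //; last first.
    by rewrite i15 i14.
  rewrite (Gm_inner (S := [set~ i5]) vZ P2Z dZ) ?inE ?eqxx ?i15 //.
  - rewrite c1.
    rewrite c2.
    rewrite p1.
    rewrite (@shift1_ge2 _ n p _ p2).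
    rewrite (@shift1_ge2 _ n p.+1); last exact: ltnW.
    by rewrite opprD addrACA subrr addr0.
  - rewrite loU lE -!setUA; congr (_ :|: (_ :|: _)).
    have -> : lo N1 = [set capM i4].
      by apply/setP => d; rewrite !inE xpair_eqE andbT.
    have -> : i5 |: [set~ i5] = (i5 |: [set~ i4] :\ i5) :|: [set i4].
      apply/setP => i; rewrite !inE.
      by move: (i == i5) (i == i4) => [] [].
    by rewrite [RHS]imsetU imset_set1.
  - rewrite hiU hE; have -> : hi N1 = set0.
      by apply/setP => d; rewrite !inE xpair_eqE andbF.
    exact: setU0.
(* As [n p q = n 2 q], the two factors are the same difference up to sign. *)
rewrite (eq_bigr _ E) -mulr_suml Gm_outer => /esym/eqP.
rewrite -mulrA mulf_eq0 signr_eq0 /= -(Hn (i := p)) ?p2 ?leqnn //.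
by rewrite mulf_eq0 !subr_eq0 [n p q == _]eq_sym orbb => /eqP.
Qed.

End Cap.

(** * Dual measures and reduction to nine values *)

Section Flip.

Variable T : finType.
Implicit Types (r : rel T) (A B D : {set T}) (Z Y : {set T * bool}).

Lemma flip_inj : injective (@flip T). Proof. exact: inv_inj (@flipK T). Qed.

Lemma flip_sub_dbl D Z : (flip Z \subset dbl D) = (Z \subset dbl D).
Proof. by rewrite -{1}(flip_dbl D) flip_sub. Qed.

Lemma flipI Z Y : flip (Z :&: Y) = flip Z :&: flip Y.
Proof. by apply/setP => z; rewrite !(mem_flip, inE). Qed.

Lemma flip_tp r D x : flip (tp r D x) = tp (op r) D x.
Proof. by apply/setP => -[d []]; rewrite mem_flip !inE. Qed.

Lemma flip_swp D x y Z Y :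
  swp D x y (flip Z, flip Y) = (flip (swp D x y (Z, Y)).1, flip (swp D x y (Z, Y)).2).
Proof.
rewrite /swp /= flipI flip_dbl; congr (_, _).
by apply/setP => -[d b]; rewrite !(inE, mem_flip) /=.
Qed.

Lemma opE_upd r x Z : op (upd r x Z) = upd (op r) x (flip Z).
Proof. by apply/funext => u; apply/funext => v; exact: op_upd. Qed.

Lemma vld_op r D Z : vld (op r) D (flip Z) = vld r D Z.
Proof.
suff H r' Z' : vld r' D Z' -> vld (op r') D (flip Z').
  by apply/idP/idP => [/H|/H //]; rewrite flipK.
move=> /vldP[h1 h2 h3 h4]; apply/vldP; rewrite flip_sub_dbl lo_flip hi_flip; split=> //.
- by move=> d e dD; apply: h3.
- by move=> d e dD; apply: h2.
- by move=> d e dl eh; apply: h4.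
Qed.

End Flip.

Lemma tmeas_op (R : comNzRingType) m (n : nat -> nat -> R) : tmeas m n ->
  tmeas (fun T r D x Z => m T (op r) D x (flip Z)) (fun p q => n q p).
Proof.
move=> Hm; split.
- move=> T r D x Z pr xD ZD nv; have pr' : preo (op r) D by rewrite op_preo.
  by apply: (tm_vld Hm); rewrite ?flip_sub_dbl ?vld_op.
- move=> T r D D' x Z pr xD DD ZD; have pr' : preo (op r) D' by rewrite op_preo.
  rewrite -(tm_res Hm (D := D) (D' := D') (Z := flip Z) pr' xD) ?flip_sub_dbl //.
  rewrite [RHS](reindex_inj (@flip_inj T)) /=; apply: eq_bigl => Y.
  by rewrite flip_sub_dbl -{2}(flip_dbl D) -flipI (inj_eq (@flip_inj T)).
- move=> T r D x d pr xD dD; have pr' : preo (op r) D by rewrite op_preo.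
  by rewrite flip_tp (tm_dup Hm).
- move=> T r A B x pr xD aA aB AB; rewrite flip_pairs setUC.
  rewrite setUC in pr xD; have pr' : preo (op r) (B :|: A) by rewrite op_preo.
  apply: (tm_strict Hm) => //.
  + by move=> a b aA' bA ab; symmetry; apply: aB.
  + by move=> a b aA' bA ab; symmetry; apply: aA.
  + by move=> a b aA' bA; apply: AB.
- move=> T r D x y Z Y pr xD yD xy ZD YD; have pr' : preo (op r) D by rewrite op_preo.
  by rewrite !opE_upd (tm_swap Hm) ?flip_sub_dbl // flip_swp.
Qed.

Section Evaluate.

Variable R : idomainType.
Variables (m : forall T : finType, rel T -> {set T} -> T -> {set T * bool} -> R)
  (n : nat -> nat -> R).
Hypothesis Hm : tmeas m n.

Lemma cap_low p q : (2 <= p)%N -> n p q = n 2 q.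
Proof.
elim/ltn_ind: p => -[|[|[|p]]] // IH _.
rewrite (cap_step (p := p.+2) _ Hm) //; first exact: IH.
by move=> i /andP[i2 ip]; apply: IH.
Qed.

End Evaluate.

Section Evaluate2.

Variable R : idomainType.
Variables (m : forall T : finType, rel T -> {set T} -> T -> {set T * bool} -> R)
  (n : nat -> nat -> R).
Hypothesis Hm : tmeas m n.

Lemma cap_both p q : n p q = n (minn p 2) (minn q 2).
Proof.
transitivity (n (minn p 2) q).
  by case: (leqP p 2) => // p2; rewrite (cap_low Hm) // ltnW.
by case: (leqP q 2) => // q2; exact: (cap_low (tmeas_op Hm) _ (ltnW q2)).
Qed.

Lemma shift1_cap p q : shift1 n p q = shift1 n (minn p 2) (minn q 2).
Proof. by rewrite /shift1 cap_both; case: p q => [|[|p]] [|[|q]]. Qed.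

(** [kap] is the size of a generating antichain cut off at 2, and by [cap_both] the values do not
    notice the cut. *)
Lemma GmE (T : finType) (r : rel T) (D : {set T}) x (Z : {set T * bool}) :
  preo r D -> x \notin D -> Z \subset dbl D -> Gm m r D x Z = Gz (shift1 n) r Z.
Proof.
move=> pr xD ZD; rewrite /Gz /G; case: ifP => [LE|/negbT nl]; last exact: (Gm_nlea Hm).
case: ifP => [MT|/negbT nm]; first exact: (Gm_meets Hm).
have /andP[lD hD] : (lo Z \subset D) && (hi Z \subset D) by rewrite -subset_dbl.
have pr' : preo (op r) D by rewrite op_preo.
have [A gA aA] := antichain_basis pr lD; have [B gB aB] := antichain_basis pr' hD.
have aB' : antichain r B by move=> a b ha hb ab; symmetry; apply: aB.
rewrite (Gm_strict Hm pr xD ZD gA gB aA aB').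
  by rewrite (kap_basis pr lD gA aA) (kap_basis pr' hD gB aB) shift1_cap.
have /genP[/subsetP SA _] := gA; have /genP[/subsetP SB _] := gB.
move=> a b /SA ha /SB hb; move/leaP: LE => -> //=.
by apply: contra nm => ba; apply/meetsP; exists a, b.
Qed.

Lemma tmeasE (T : finType) (r : rel T) (D : {set T}) x (Z : {set T * bool}) :
  preo r D -> x \notin D -> Z \subset dbl D -> m r D x Z = mz (shift1 n) r D Z.
Proof.
move=> pr xD ZD; apply: mob_uniq => // Y YD; exact: GmE.
Qed.

End Evaluate2.

Lemma upd_tp_in (T : finType) (r r' : rel T) (D : {set T}) x : r' x x ->
  {in D &, r =2 r'} -> {in x |: D &, upd r x (tp r' D x) =2 r'}.
Proof.
move=> xx E u v uD vD; rewrite -[RHS](upd_tp (D := D) xx uD vD) /upd.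
case: (eqVneq u x) => ux; case: (eqVneq v x) => vx //.
by apply: E; [move: uD|move: vD]; rewrite in_setU1 ?(negbTE ux) ?(negbTE vx).
Qed.

Definition eqr (T : Type) (r : rel T) : rel T := fun u v => r u v && r v u.

Lemma eqr_sym (T : Type) (r : rel T) u v : eqr r u v = eqr r v u.
Proof. by rewrite /eqr andbC. Qed.

(** * Posets as quotients of preorders *)

Section Chart.

Variable T : finType.
Implicit Types (r : rel T) (D E F : {set T}).

Lemma eqr_refl r E x : preo r E -> x \in E -> eqr r x x.
Proof. by move=> /preoP[rr _] xE; rewrite /eqr rr. Qed.

Lemma eqr_trans r E x y z : preo r E -> x \in E -> y \in E -> z \in E ->
  eqr r x y -> eqr r y z -> eqr r x z.
Proof.
move=> /preoP[_ rt] xE yE zE /andP[h1 h2] /andP[h3 h4]; apply/andP; split.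
  exact: (rt x y z).
exact: (rt z y x).
Qed.

Lemma eqr_le r E x y x' y' : preo r E -> x \in E -> y \in E -> x' \in E -> y' \in E ->
  eqr r x x' -> eqr r y y' -> r x y = r x' y'.
Proof.
move=> /preoP[_ rt] xE yE xE' yE' /andP[h1 h2] /andP[h3 h4]; apply/idP/idP => H.
  by apply: (rt x' y y') => //; apply: (rt x' x y).
by apply: (rt x y' y) => //; apply: (rt x x' y').
Qed.

(** [e] chooses one point in each equivalence class of [D] and identifies P with the quotient
    poset. *)
Definition chart r D (P : poset) (e : 'I_(pcard P) -> T) : Prop :=
  [/\ forall i, e i \in D, forall i j, ple i j = r (e i) (e j)
    & forall d, d \in D -> exists i, eqr r d (e i)].

Lemma chart_eqr r D P e i j : @chart r D P e -> eqr r (e i) (e j) -> i = j.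
Proof. by case=> _ eE _; rewrite /eqr -!eE => /ple_anti. Qed.

Lemma chart_ex r D : preo r D -> exists (P : poset) (e : 'I_(pcard P) -> T), chart r D e.
Proof.
move=> pr; have /preoP[rr rt] := pr.
pose S := {d : T | d \in D}; pose r' : rel S := fun u v => r (val u) (val v).
have pr' : preo r' [set: S].
  apply/preoP; split=> [u _|u v w _ _ _]; first by apply: rr; apply: valP.
  by apply: rt; apply: valP.
have [P [u [us uE]]] := realize pr'.
have [s sK] := choice us.
exists P, (fun i => val (s i)); split=> [i|i j|d dD]; first exact: valP.
  by rewrite -{1}(sK i) -{1}(sK j) -uE.
pose t : S := Sub d dD; exists (u t).
by rewrite -[d]/(val t) /eqr -!/(r' _ _) !uE sK !ple_refl.
Qed.

Lemma eq_chart r r' D P e : {in D &, r =2 r'} -> @chart r D P e -> chart r' D e.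
Proof.
move=> E [h1 h2 h3]; split=> // [i j|d dD]; first by rewrite h2 E.
by have [i H] := h3 d dD; exists i; rewrite /eqr -!E.
Qed.

Definition compat r (P Q : poset) (eP : 'I_(pcard P) -> T) (eQ : 'I_(pcard Q) -> T)
  (a : embedding P Q) : Prop := forall x, eqr r (eP x) (eQ (a x)).

Lemma emb_ex r D E P Q (eP : 'I_(pcard P) -> T) (eQ : 'I_(pcard Q) -> T) :
  preo r E -> D \subset E -> chart r D eP -> chart r E eQ ->
  exists a, compat r eP eQ a.
Proof.
move=> pr /subsetP DE [P1 P2 P3] [Q1 Q2 Q3].
have [f fP] := choice (fun x => Q3 (eP x) (DE _ (P1 x))).
have fle x y : ple x y = ple (f x) (f y).
  by rewrite P2 Q2; apply: (eqr_le pr); rewrite ?Q1 ?DE ?P1.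
have fi : injective f by move=> x y E'; apply: ple_anti; rewrite !fle E' ple_refl.
by exists (Embedding fi fle).
Qed.

Lemma compat_eq r E P Q (eP : 'I_(pcard P) -> T) (eQ : 'I_(pcard Q) -> T) (a b : embedding P Q) :
  preo r E -> (forall x, eP x \in E) -> chart r E eQ ->
  compat r eP eQ a -> compat r eP eQ b -> a = b.
Proof.
move=> pr PE cQ ca cb; apply: embedding_eq => x; have [Q1 _ _] := cQ.
apply: (chart_eqr cQ); apply: (eqr_trans pr _ (PE x)); rewrite ?Q1 //.
by rewrite eqr_sym; apply: ca.
Qed.

Lemma compat_comp r E P Q S (eP : 'I_(pcard P) -> T) (eQ : 'I_(pcard Q) -> T)
    (eS : 'I_(pcard S) -> T) (a : embedding P Q) (b : embedding Q S) :
  preo r E -> (forall x, eP x \in E) -> (forall x, eQ x \in E) -> (forall x, eS x \in E) ->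
  compat r eP eQ a -> compat r eQ eS b -> compat r eP eS (comp_emb b a).
Proof. by move=> pr PE QE SE ca cb x; apply: (eqr_trans pr _ (QE (a x))). Qed.

Lemma emb_bij r D E P Q (eP : 'I_(pcard P) -> T) (eQ : 'I_(pcard Q) -> T) a :
  preo r E -> D \subset E -> chart r D eP -> chart r E eQ -> compat r eP eQ a ->
  (forall x, x \in E -> exists2 d, d \in D & eqr r d x) -> bijective a.
Proof.
move=> pr /subsetP DE cP cQ ca DEq; have [P1 P2 P3] := cP; have [Q1 Q2 Q3] := cQ.
have sur y : exists x, a x = y.
  have [d dD dy] := DEq _ (Q1 y); have [x dx] := P3 d dD; exists x.
  apply: (chart_eqr cQ); apply: (eqr_trans pr _ (DE _ dD)) => //.
  by apply: (eqr_trans pr _ (DE _ (P1 x))); rewrite ?Q1 ?DE // eqr_sym.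
have [s sK] := choice sur.
by exists s => // x; apply: (@emap_inj _ _ a); rewrite sK.
Qed.

End Chart.

(** * Values of a measure on inclusions of preorders *)

Section Value.

Variables (R : comNzRingType) (phi : forall P Q : poset, embedding P Q -> R).
Arguments phi {P Q}.
Hypothesis phi_iso : forall P Q (a : embedding P Q), bijective a -> phi a = 1.
Hypothesis phi_comp : forall P Q S (a : embedding P Q) (b : embedding Q S),
  phi (comp_emb b a) = phi b * phi a.
Hypothesis phi_amalg : forall P Q P' (a : embedding P Q) (b : embedding P P') r
  (A : 'I_r -> amalgamation a b), all_amalgamations A ->
  phi a = \sum_(i < r) phi (am_a (A i)).

Section Fixed.

Variable T : finType.
Implicit Types (r : rel T) (D E F : {set T}).

(* [W r D E] is the value of [phi] on the embedding of posets obtained from D <= E by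
   identifying equivalent points. *)
Definition is_value r D E (v : R) := exists P Q (eP : 'I_(pcard P) -> T) (eQ : 'I_(pcard Q) -> T) a,
  [/\ chart r D eP, chart r E eQ, compat r eP eQ a & v = phi a].

Definition W r D E : R :=
  if pselect (exists v, is_value r D E v) is left H then projT1 (cid H) else 0.

(** Two choices of charts differ by isomorphisms, where [phi] is 1. *)
Lemma is_value_uniq r D E v v' : preo r E -> D \subset E ->
  is_value r D E v -> is_value r D E v' -> v = v'.
Proof.
move=> pr DE [P [Q [eP [eQ [a [cP cQ ca ->]]]]]] [P' [Q' [eP' [eQ' [a' [cP' cQ' ca' ->]]]]]].
have prD := preo_sub DE pr; have [P1 _ _] := cP; have [P1' _ _] := cP'.
have [Q1 _ _] := cQ; have [Q1' _ _] := cQ'; have SD := subsetP DE.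
have [f cf] := emb_ex prD (subxx D) cP cP'; have [g cg] := emb_ex pr (subxx E) cQ cQ'.
have bf : bijective f.
  by apply: (emb_bij prD (subxx D) cP cP' cf) => x xD; exists x; rewrite ?(eqr_refl prD).
have bg : bijective g.
  by apply: (emb_bij pr (subxx E) cQ cQ' cg) => x xD; exists x; rewrite ?(eqr_refl pr).
have E' : comp_emb g a = comp_emb a' f.
  apply: (compat_eq pr _ cQ') => [x||]; first exact: SD.
    by apply: (compat_comp pr _ _ _ ca cg) => // x; apply: SD.
  by apply: (compat_comp pr _ _ _ cf ca') => // x; apply: SD.
have := congr1 phi E'; by rewrite !phi_comp (phi_iso bf) (phi_iso bg) mul1r mulr1.
Qed.

Lemma WE r D E P Q (eP : 'I_(pcard P) -> T) (eQ : 'I_(pcard Q) -> T) a :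
  preo r E -> D \subset E -> chart r D eP -> chart r E eQ -> compat r eP eQ a ->
  W r D E = phi a.
Proof.
move=> pr DE cP cQ ca; have H : is_value r D E (phi a) by exists P, Q, eP, eQ, a.
rewrite /W; case: pselect => [H'|[]]; last by exists (phi a).
by case: (cid H') => v /= Hv; apply: is_value_uniq Hv H.
Qed.

Lemma W_ex r D E : preo r E -> D \subset E ->
  exists P Q (eP : 'I_(pcard P) -> T) (eQ : 'I_(pcard Q) -> T) a,
  [/\ chart r D eP, chart r E eQ, compat r eP eQ a & W r D E = phi a].
Proof.
move=> pr DE; have [P [eP cP]] := chart_ex (preo_sub DE pr); have [Q [eQ cQ]] := chart_ex pr.
have [a ca] := emb_ex pr DE cP cQ; exists P, Q, eP, eQ, a; split=> //.
exact: WE ca.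
Qed.

Lemma eq_W r r' D E : preo r E -> D \subset E -> {in E &, r =2 r'} -> W r D E = W r' D E.
Proof.
move=> pr DE rr'; have [P [Q [eP [eQ [a [cP cQ ca ->]]]]]] := W_ex pr DE.
have SD := subsetP DE; have [P1 _ _] := cP; have [Q1 _ _] := cQ.
symmetry; apply: (WE (eP := eP) (eQ := eQ)) => //.
- by rewrite -(eq_preo rr').
- by apply: eq_chart cP => u v /SD uE /SD; apply: rr'.
- exact: eq_chart cQ.
- by move=> x; have := ca x; rewrite /eqr !rr' ?Q1 ?(SD _ (P1 _)).
Qed.

Lemma W_one r D E : preo r E -> D \subset E ->
  (forall x, x \in E -> exists2 d, d \in D & eqr r d x) -> W r D E = 1.
Proof.
move=> pr DE H; have [P [Q [eP [eQ [a [cP cQ ca ->]]]]]] := W_ex pr DE.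
exact/phi_iso/(emb_bij pr DE cP cQ ca).
Qed.

Lemma W_comp r D E F : preo r F -> D \subset E -> E \subset F ->
  W r D F = W r E F * W r D E.
Proof.
move=> pr DE EF; have prE := preo_sub EF pr; have SE := subsetP EF; have SD := subsetP DE.
have [P [Q [eP [eQ [a [cP cQ ca ->]]]]]] := W_ex prE DE.
have [S [eS cS]] := chart_ex pr; have [b cb] := emb_ex pr EF cQ cS.
have [P1 _ _] := cP; have [Q1 _ _] := cQ; have [S1 _ _] := cS.
rewrite (WE pr EF cQ cS cb) -phi_comp; apply: (WE pr (subset_trans DE EF) cP cS).
by apply: (compat_comp pr _ _ S1 ca cb) => x; apply: SE => //; apply: SD.
Qed.

(** The amalgamations of the one-point extension of [D] with [D'] correspond to the valid types of
    [x] over [D'] that restrict to [Z]; those making [x] equivalent to a point of [D'] are the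
    amalgamations that identify the new point. *)
Lemma W_add r D D' x (Z : {set T * bool}) : preo r D' -> x \notin D' -> D \subset D' ->
  Z \subset dbl D -> vld r D Z ->
  W (upd r x Z) D (x |: D) =
  \sum_(Y : {set T * bool} | vld r D' Y && (Y :&: dbl D == Z)) W (upd r x Y) D' (x |: D').
Proof.
move=> pr xD' DD' ZD vZ; have SD := subsetP DD'.
have xD : x \notin D by apply: contra xD'; apply: SD.
have prD := preo_sub DD' pr.
have prZ : preo (upd r x Z) (x |: D) by rewrite upd_preo.
have rZ : {in D &, upd r x Z =2 r} by apply: upd_in.
have [P [eP cP]] := chart_ex prD; have [P' [eP' cP']] := chart_ex pr.
have [Q [eQ cQ]] := chart_ex prZ; have [b cb] := emb_ex pr DD' cP cP'.
have cPZ : chart (upd r x Z) D eP by apply: eq_chart cP => u v uD vD; rewrite rZ.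
have DxD := subsetUr [set x] D.
have [a ca] := emb_ex prZ DxD cPZ cQ.
rewrite (WE prZ DxD cPZ cQ ca).
have [P1 P2 P3] := cP; have [P1' P2' P3'] := cP'; have [Q1 Q2 Q3] := cQ.
have xDD : x |: D \subset x |: D' by apply: setUS.
have SxD := subsetP xDD.
pose good Y := vld r D' Y && (Y :&: dbl D == Z).
pose h (t : 'I_(pcard Q) + 'I_(pcard P')) : T := match t with inl y => eQ y | inr y => eP' y end.
have hD t : h t \in x |: D' by case: t => y /=; [apply: SxD|rewrite setU1r].
have updY Y : good Y -> {in x |: D &, upd r x Y =2 upd r x Z}.
  move=> /andP[/vldP[YD _ _ _] /eqP YZ] u v uD vD; rewrite -YZ /upd !in_setI !in_dbl /=.
  case: (eqVneq u x) => ux; case: (eqVneq v x) => vx //=.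
    by move: vD; rewrite in_setU1 (negbTE vx) /= => ->; rewrite andbT.
  by move: uD; rewrite in_setU1 (negbTE ux) /= => ->; rewrite andbT.
have preoY Y : good Y -> preo (upd r x Y) (x |: D').
  by move=> /andP[vY _]; rewrite upd_preo //; have /vldP[] := vY.
have chP' Y : chart (upd r x Y) D' eP'.
  by apply: eq_chart cP' => u v uD vD; rewrite (upd_in _ _ xD').
have D'xD := subsetUr [set x] D'.
(* From types to amalgamations: the quotient of [x |: D'] with its two embeddings. *)
have amY Y : good Y -> exists A : amalgamation a b,
    W (upd r x Y) D' (x |: D') = phi (am_a A) /\
    am_rel A = [set p | upd r x Y (h p.1) (h p.2)].
  move=> gY; have prY := preoY Y gY; have UY := updY Y gY.
  have [S [eS cS]] := chart_ex prY; have [S1 S2 S3] := cS.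
  have [a' ca'] := emb_ex prY D'xD (chP' Y) cS.
  have cQY : chart (upd r x Y) (x |: D) eQ.
    by apply: eq_chart cQ => u v uD vD; rewrite UY.
  have [b' cb'] := emb_ex prY xDD cQY cS.
  have comm y : b' (a y) = a' (b y).
    have PE z : eP z \in x |: D' by rewrite setU1r // SD.
    suff E : comp_emb b' a = comp_emb a' b by rewrite -[LHS]/(comp_emb b' a y) E.
    apply: (compat_eq prY PE cS).
      apply: (compat_comp prY PE _ S1 _ cb') => z; first exact: SxD.
      by have := ca z; rewrite /eqr !UY // setU1r.
    apply: (compat_comp prY PE _ S1 _ ca') => z; first exact: setU1r.
    by have := cb z; rewrite /eqr !(upd_in _ _ xD') ?(SD _ (P1 _)).
  have cover z : (exists y, z = a' y) \/ (exists y, z = b' y).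
    have := S1 z; rewrite in_setU1 => /orP[/eqP zx|zD].
      right; have [y xy] := Q3 x (setU11 _ _); exists y; apply: (chart_eqr cS).
      apply: (eqr_trans prY _ (SxD _ (Q1 y))); rewrite ?S1 //.
      by rewrite zx /eqr !UY ?setU11.
    left; have [y zy] := P3' _ zD; exists y; apply: (chart_eqr cS).
    apply: (eqr_trans prY _ (setU1r _ (P1' y))); rewrite ?S1 //.
    by rewrite /eqr !(upd_in _ _ xD') ?P1'.
  exists (Amalgamation comm cover); split; first exact: (WE prY D'xD (chP' Y) cS ca').
  have M t : eqr (upd r x Y) (h t) (eS (am_map (Amalgamation comm cover) t)).
    by case: t => y /=; [apply: cb'|apply: ca'].
  apply/setP => -[t t']; rewrite !inE /= S2; symmetry.
  by apply: (eqr_le prY); rewrite ?S1.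
(* From amalgamations to types: the order of [B] is pulled back to [x |: D'] along a map [k] given
   by [eQ] at [x] and by [eP'] on [D'], and the type of [x] is read off. *)
have amB (B : amalgamation a b) : exists2 Y, good Y &
    am_rel B = [set p | upd r x Y (h p.1) (h p.2)].
  have [qx qxE] := Q3 x (setU11 _ _).
  have kex u : exists z, (u = x -> z = am_b B qx) /\
      (u \in D' -> exists2 i, eqr r u (eP' i) & z = am_a B i).
    have [uD|uD] := boolP (u \in D').
      have [i ui] := P3' _ uD; exists (am_a B i); split=> [ux|_]; last by exists i.
      by move: xD'; rewrite -ux uD.
    by exists (am_b B qx).
  have [k kP] := choice kex.
  have km d i : d \in D' -> eqr r d (eP' i) -> k d = am_a B i.
    move=> dD di; have [_ /(_ dD)[j dj ->]] := kP d; congr (am_a B _).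
    by apply: (chart_eqr cP'); apply: (eqr_trans pr _ dD); rewrite ?P1' // eqr_sym.
  have kQ u y : u \in x |: D -> eqr (upd r x Z) u (eQ y) -> k u = am_b B y.
    rewrite in_setU1 => /orP[/eqP -> xy|uD uy].
      have [/(_ erefl) -> _] := kP x; congr (am_b B _); apply: (chart_eqr cQ).
      by apply: (eqr_trans prZ _ (setU11 x D)); rewrite ?Q1 // eqr_sym.
    have [p up] := P3 _ uD.
    have -> : y = a p.
      have m1 := setU1r x uD; have m2 := setU1r x (P1 p).
      apply: (chart_eqr cQ); apply: (eqr_trans prZ (Q1 _) m1 (Q1 _)).
        by rewrite eqr_sym.
      apply: (eqr_trans prZ m1 m2 (Q1 _)) (ca p).
      by rewrite /eqr !rZ.
    rewrite am_comm; apply: km; first exact: SD.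
    exact: (eqr_trans pr (SD _ uD) (SD _ (P1 p)) (P1' _) up (cb p)).
  have kh t : am_map B t = k (h t).
    case: t => y /=; symmetry.
      by apply: kQ => //; apply: (eqr_refl prZ).
    by apply: km => //; apply: (eqr_refl pr).
  pose rB : rel T := fun u v => ple (k u) (k v).
  have prB A : preo rB A.
    by apply/preoP; split=> [u _|u v w _ _ _]; [exact: ple_refl|exact: ple_trans].
  have rBD : {in D' &, rB =2 r}.
    move=> u v uD vD; have [i ui] := P3' _ uD; have [j vj] := P3' _ vD.
    rewrite /rB (km _ _ uD ui) (km _ _ vD vj) -emap_le P2'; symmetry.
    by apply: (eqr_le pr).
  have rBZ : {in x |: D &, rB =2 upd r x Z}.
    move=> u v uD vD; have [i ui] := Q3 _ uD; have [j vj] := Q3 _ vD.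
    rewrite /rB (kQ _ _ uD ui) (kQ _ _ vD vj) -emap_le Q2; symmetry.
    by apply: (eqr_le prZ).
  have rBU : {in x |: D' &, upd r x (tp rB D' x) =2 rB}.
    by apply: upd_tp_in => [|u v uD vD]; [exact: ple_refl|rewrite rBD].
  exists (tp rB D' x).
    apply/andP; split; first by rewrite -(eq_vld _ rBD) vld_tp.
    rewrite tp_restrict // -(tp_upd r xD ZD); apply/eqP/eq_tp => d dD.
    by rewrite !rBZ ?setU11 ?setU1r.
  by apply/setP => -[t t']; rewrite !inE /= !kh rBU.
pose I := [set Y | good Y].
have gI (i : 'I_#|I|) : good (enum_val i) by have := enum_valP i; rewrite inE.
have [A AP] := choice (fun i => amY _ (gI i)).
have allA : all_amalgamations A.
  move=> B; have [Y gY BY] := amB B.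
  have YI : Y \in I by rewrite inE.
  exists (enum_rank_in YI Y); split.
    by apply/am_iso_rel; have [_ ->] := AP (enum_rank_in YI Y); rewrite BY enum_rankK_in.
  move=> i /am_iso_rel; have [_ ->] := AP i; rewrite BY => E.
  apply: enum_val_inj; rewrite enum_rankK_in //; have gi := gI i.
  move: (enum_val i) gi E => X gX /setP E.
  have [q xq] := Q3 x (setU11 _ _).
  (* Up to equivalence [h] reaches [x] and all of [D'], so the relation on the disjoint union
     determines the type. *)
  have U V : good V -> forall d j, d \in D' -> eqr r d (eP' j) ->
      upd r x V d x = upd r x V (h (inr j)) (h (inl q)) /\
      upd r x V x d = upd r x V (h (inl q)) (h (inr j)).
    move=> gV d j dD dj.
    have d1 : eqr (upd r x V) d (h (inr j)) by rewrite /eqr !(upd_in _ _ xD') //= P1'.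
    have d2 : eqr (upd r x V) x (h (inl q)).
      by rewrite /eqr !(updY V gV) ?setU11 //= Q1.
    have m1 := setU1r x dD; have m2 := setU11 x D'.
    by split; apply: (eqr_le (preoY V gV)).
  have tpV V : good V -> V = tp (upd r x V) D' x.
    by move=> /andP[/vldP[VD _ _ _] _]; rewrite tp_upd.
  rewrite (tpV X gX) (tpV Y gY); apply: eq_tp => d dD; have [j dj] := P3' d dD.
  have [-> ->] := U X gX d j dD dj; have [-> ->] := U Y gY d j dD dj.
  have := E (inr j, inl q); have := E (inl q, inr j); rewrite !inE /=.
  by move=> -> ->.
rewrite (phi_amalg allA) (eq_bigl [in I]) => [|Y]; last by rewrite !inE.
rewrite [RHS]big_enum_val; apply: eq_bigr => i _.
by have [-> _] := AP i.
Qed.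

End Fixed.
End Value.

Lemma vld_pairs (T : finType) (r : rel T) (A B : {set T}) : preo r (A :|: B) ->
  antichain r A -> antichain r B -> below r A B -> vld r (A :|: B) (pairs A B).
Proof.
move=> pr aA aB AB; apply/vldP; rewrite lo_pairs hi_pairs; split.
- by rewrite pairs_subset subsetUl subsetUr.
- move=> d e /setUP[//|dB] de eA.
  by have /andP[_] := AB _ _ eA dB; rewrite de.
- move=> d e /setUP[eA|//] de dB.
  by have /andP[_] := AB _ _ eA dB; rewrite de.
- by move=> d e dA eB; have /andP[] := AB _ _ dA eB.
Qed.

(** * A measure induces values of types *)

Section Measure.

Variables (R : comNzRingType) (phi : forall P Q : poset, embedding P Q -> R).
Arguments phi {P Q}.
Hypothesis phi_iso : forall P Q (a : embedding P Q), bijective a -> phi a = 1.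
Hypothesis phi_comp : forall P Q S (a : embedding P Q) (b : embedding Q S),
  phi (comp_emb b a) = phi b * phi a.
Hypothesis phi_amalg : forall P Q P' (a : embedding P Q) (b : embedding P P') r
  (A : 'I_r -> amalgamation a b), all_amalgamations A ->
  phi a = \sum_(i < r) phi (am_a (A i)).

Definition mphi (T : finType) (r : rel T) (D : {set T}) x (Z : {set T * bool}) : R :=
  if vld r D Z then W (@phi) (upd r x Z) D (x |: D) else 0.

Definition nphi p q : R := phi (J_emb p q).

Lemma mphi_strict (T : finType) (r : rel T) (A B : {set T}) x : preo r (A :|: B) ->
  x \notin A :|: B -> antichain r A -> antichain r B -> below r A B ->
  mphi r (A :|: B) x (pairs A B) = nphi #|A| #|B|.
Proof.
move=> pr xD aA aB AB; have vP := vld_pairs pr aA aB AB; rewrite /mphi vP /nphi.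
set r' := upd _ _ _; have /vldP[PD _ _ _] := vP.
have pr' : preo r' (x |: (A :|: B)) by rewrite upd_preo.
have [xA xB] : x \notin A /\ x \notin B by apply/andP; rewrite -negb_or -in_setU.
have dAB d : d \in A -> d \notin B.
  move=> dA; apply/negP => dB; have /andP[H] := AB d d dA dB; by rewrite H.
have /preoP[rr _] := pr.
have r'E : {in x |: (A :|: B) &, forall u v,
    r' u v = (u == v) || (u \in x |: A) && (v \in x |: B)}.
  have H u v : u \in A :|: B -> v \in A :|: B -> r u v = (u == v) || (u \in A) && (v \in B).
    move=> uD vD; have [<-|uv] /= := eqVneq u v; first exact: rr.
    case/setUP: (uD) => hu; case/setUP: (vD) => hv.
    - rewrite (negbTE (dAB _ hv)) andbF; apply: contra_neqF uv; exact: aA.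
    - by rewrite hu hv; have /andP[] := AB _ _ hu hv.
    - by rewrite (contraTF (dAB u)) ?hu //=; have /andP[_ /negbTE] := AB _ _ hv hu.
    - rewrite (contraTF (dAB u)) ?hu //=; apply: contra_neqF uv; exact: aB.
  have lP d : ((d, false) \in pairs A B) = (d \in A) by rewrite inE.
  have hP d : ((d, true) \in pairs A B) = (d \in B) by rewrite inE.
  move=> u v; rewrite 2!in_setU1 => uD vD; rewrite /r' /upd lP hP !in_setU1.
  move: uD vD; case: (eqVneq u x) => [->|ux] /=; case: (eqVneq v x) => [->|vx] //=.
  - by rewrite (negbTE ux) andbT.
  - by move=> uD vD; rewrite H.
(* Listing A, then [x], then B reproduces the numbering of [J], in which the added point has index
   [#|A|]. *)
pose s := enum A ++ x :: enum B.
have us : uniq s.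
  rewrite cat_uniq /= !enum_uniq (mem_enum B) xB /= andbT negb_or /= mem_enum xA /=.
  apply/hasPn => d; rewrite !mem_enum; apply: contraL; exact: dAB.
have ss : size s = (#|A| + #|B|).+1 by rewrite size_cat /= -!cardE addnS.
have ms d : (d \in s) = (d \in x |: (A :|: B)).
  by rewrite mem_cat in_cons !mem_enum in_setU1 in_setU orbCA.
pose e (i : 'I_(#|A| + #|B|).+1) := nth x s i.
have iss (i : 'I_(#|A| + #|B|).+1) : (i < size s)%N by rewrite ss.
have eD i : e i \in x |: (A :|: B) by rewrite -ms mem_nth.
have ee i j : (e i == e j) = (i == j) by rewrite nth_uniq.
have ix : index x s = #|A|.
  by rewrite index_cat mem_enum (negbTE xA) /= eqxx addn0 -cardE.
have iA d : d \in x |: (A :|: B) -> (d \in x |: A) = (index d s <= #|A|)%N.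
  rewrite !in_setU1; have [->|dx] /= := eqVneq d x; first by rewrite ix leqnn.
  move=> dD; rewrite index_cat mem_enum; case: ifP => dA.
    by apply/esym/ltnW; rewrite cardE index_mem mem_enum.
  by rewrite /= eq_sym (negbTE dx) -cardE addnS ltnNge leq_addr.
have iB d : d \in x |: (A :|: B) -> (d \in x |: B) = (#|A| <= index d s)%N.
  rewrite !in_setU1; have [->|dx] /= := eqVneq d x; first by rewrite ix leqnn.
  move=> dD; rewrite index_cat mem_enum; case: ifP => dA.
    rewrite (negbTE (dAB _ dA)); apply/esym/negbTE.
    by rewrite -ltnNge cardE index_mem mem_enum.
  by move: dD; rewrite in_setU dA /= -cardE leq_addr => ->.
have eJ i j : r' (e i) (e j) = Jle i j.
  by rewrite r'E // iA // iB // ee !index_uniq // -val_eqE.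
have DxD := subsetUr [set x] (A :|: B).
have Jp : val (J_star #|A| #|B|) = #|A| by rewrite /= inordK // ltnS leq_addr.
have ex i : (e i == x) = (i == J_star #|A| #|B|).
  have -> : x = e (J_star #|A| #|B|) by rewrite /e Jp -ix nth_index // ms setU11.
  exact: ee.
apply: (WE phi_iso phi_comp (Q := J #|A| #|B|) (a := J_emb #|A| #|B|) (eQ := e)
  (eP := fun i => e (J_emb #|A| #|B| i))) => //.
- split=> [i|i j|d dD].
  + have := eD (J_emb #|A| #|B| i); rewrite in_setU1 ex /= => /predU1P[E|//].
    by have := neq_lift (J_star #|A| #|B|) i; rewrite E eqxx.
  + by rewrite eJ.
  + have dDx : d \in x |: (A :|: B) by rewrite setU1r.
    have is' : (index d s < (#|A| + #|B|).+1)%N by rewrite -ss index_mem ms.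
    have ed : e (Ordinal is') = d by rewrite /e /= nth_index // ms.
    have nJ : J_star #|A| #|B| != Ordinal is'.
      by rewrite eq_sym -ex ed; apply: contraNneq xD => <-.
    have [j Ej _] := unlift_some nJ.
    by exists j; rewrite /= -Ej ed (eqr_refl pr').
- split=> // d; rewrite -ms => ds.
  have is' : (index d s < (#|A| + #|B|).+1)%N by rewrite -ss index_mem.
  exists (Ordinal is'); rewrite /e /= nth_index // (eqr_refl pr') // -?ms //.
- by move=> i; apply: (eqr_refl pr').
Qed.

(** By multiplicativity both products are the value of the inclusion of [D] in [y |: (x |: D)] for
    the common preorder [r']. *)
Lemma mphi_swap (T : finType) (r : rel T) (D : {set T}) x y (Z Y : {set T * bool}) :
  preo r D -> x \notin D -> y \notin D -> x != y ->
  Z \subset dbl D -> Y \subset dbl (x |: D) ->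
  vld r D Z -> vld (upd r x Z) (x |: D) Y ->
  [/\ vld r D (swp D x y (Z, Y)).1,
      vld (upd r y (swp D x y (Z, Y)).1) (y |: D) (swp D x y (Z, Y)).2 &
      mphi r D x Z * mphi (upd r x Z) (x |: D) y Y =
      mphi r D y (swp D x y (Z, Y)).1 *
       mphi (upd r y (swp D x y (Z, Y)).1) (y |: D) x (swp D x y (Z, Y)).2].
Proof.
move=> pr xD yD xy ZD YD vZ vY; pose r' := upd (upd r x Z) y Y.
have yxD : y \notin x |: D by rewrite in_setU1 eq_sym (negbTE xy).
have xyD : x \notin y |: D by rewrite in_setU1 (negbTE xy).
have prx : preo (upd r x Z) (x |: D) by rewrite upd_preo.
have pr' : preo r' (y |: (x |: D)) by rewrite upd_preo.
have /preoP[rr _] := pr'.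
have xx : r' x x by apply: rr; rewrite !inE eqxx orbT.
have yy : r' y y by apply: rr; rewrite !inE eqxx.
have r'x : {in x |: D &, r' =2 upd r x Z} by apply: upd_in.
have r'D : {in D &, r' =2 r}.
  by move=> u v uD vD; rewrite r'x ?setU1r // (upd_in _ _ xD).
have rr' : {in D &, r =2 r'} by move=> u v uD vD; rewrite r'D.
have Z1 : Z = tp r' D x.
  by rewrite -{1}(tp_upd r xD ZD); apply: eq_tp => d dD; rewrite !r'x ?setU11 ?setU1r.
have Y1 : Y = tp r' (x |: D) y by rewrite -{1}(tp_upd (upd r x Z) yxD YD).
have E1 : (swp D x y (Z, Y)).1 = tp r' D y by rewrite /= Y1 tp_restrict ?subsetUr.
have E2 : (swp D x y (Z, Y)).2 = tp r' (y |: D) x.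
  rewrite /= {1}Z1 {1}Y1; apply/setP => -[d b]; rewrite !inE /= eqxx /=.
  have [->|dy] := eqVneq d y; last by rewrite orbF.
  by rewrite (negbTE yD) /=; case: b.
rewrite E1 E2.
have pry : preo r' (y |: D).
  by apply: preo_sub pr'; rewrite setUS // subsetUr.
have pr'' : preo r' (x |: (y |: D)) by rewrite setUCA.
have ry : {in y |: D &, upd r y (tp r' D y) =2 r'} by apply: upd_tp_in.
have rxy : {in x |: (y |: D) &, upd (upd r y (tp r' D y)) x (tp r' (y |: D) x) =2 r'}.
  exact: upd_tp_in.
have v1 : vld r D (tp r' D y) by rewrite -(eq_vld _ r'D) vld_tp.
have v2 : vld (upd r y (tp r' D y)) (y |: D) (tp r' (y |: D) x).
  by rewrite (eq_vld _ ry) vld_tp.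
split=> //; rewrite /mphi vZ vY v1 v2 mulrC [RHS]mulrC.
rewrite -/r' (eq_W phi_iso phi_comp prx (r' := r')) ?subsetUr //; last first.
  by move=> u v uD vD; rewrite r'x.
rewrite (eq_W phi_iso phi_comp _ _ ry) ?subsetUr ?(eq_preo ry) //.
rewrite (eq_W phi_iso phi_comp _ _ rxy) ?subsetUr ?(eq_preo rxy) //.
by rewrite -!W_comp ?subsetUr // setUCA.
Qed.

Lemma mphi_tmeas : tmeas mphi nphi.
Proof.
split.
- by move=> T r D x Z _ _ _ /negbTE nv; rewrite /mphi nv.
- move=> T r D D' x Z pr xD DD ZD; rewrite [RHS]/mphi; case: ifP => vZ.
    rewrite (W_add phi_iso phi_comp phi_amalg pr xD DD ZD vZ) big_mkcond [RHS]big_mkcond.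
    apply: eq_bigr => Y _; rewrite /mphi.
    case: (boolP (vld r D' Y)) => vY; last by rewrite if_same.
    by have /vldP[-> _ _ _] := vY.
  rewrite big1 // => Y /andP[YD /eqP YZ]; rewrite /mphi; case: ifP => // vY.
  case/negP: (negbT vZ); have /vldP[_ v1 v2 v3] := vY; have SD := subsetP DD.
  have lZ d : (d \in lo Z) = (d \in lo Y) && (d \in D).
    by rewrite -YZ !inE.
  have hZ d : (d \in hi Z) = (d \in hi Y) && (d \in D).
    by rewrite -YZ !inE.
  apply/vldP; split=> // [d e dD de|d e dD de|d e].
  + by rewrite !lZ dD andbT => /andP[eY _]; apply: v1 eY; rewrite ?SD.
  + by rewrite !hZ dD andbT => /andP[eY _]; apply: v2 eY; rewrite ?SD.
  + by rewrite lZ hZ => /andP[dY _] /andP[eY _]; apply: v3.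
- move=> T r D x d pr xD dD; rewrite /mphi.
  have dDE : d |: D = D by apply/setUidPr; rewrite sub1set.
  rewrite vld_tp ?dDE //; have /preoP[rr _] := pr.
  apply: (W_one phi_iso phi_comp) => [||u]; rewrite ?subsetUr //.
    by rewrite upd_preo ?tp_sub // vld_tp ?dDE.
  have dx : d != x by apply: contraNneq xD => <-.
  case/setU1P => [->|uD].
    by exists d; rewrite // /eqr upd_lo ?upd_hi // !inE dD rr.
  by exists u => //; rewrite /eqr (upd_in _ _ xD) // rr.
- exact: mphi_strict.
- move=> T r D x y Z Y pr xD yD xy ZD YD.
  have /andP[zD1 zD2] := swp_sub y ZD YD.
  case vZ: (vld r D Z); last first.
    rewrite {1}/mphi vZ mul0r /mphi.
    case v1: (vld r D (swp D x y (Z, Y)).1); rewrite ?mul0r //.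
    case v2: (vld _ _ (swp D x y (Z, Y)).2); rewrite ?mulr0 //.
    rewrite eq_sym in xy.
    have [] := mphi_swap pr yD xD xy zD1 zD2 v1 v2.
    by rewrite swpK //= 1?eq_sym // vZ.
  case vY: (vld (upd r x Z) (x |: D) Y); last first.
    rewrite {2}/mphi vY mulr0 /mphi.
    case v1: (vld r D (swp D x y (Z, Y)).1); rewrite ?mul0r //.
    case v2: (vld _ _ (swp D x y (Z, Y)).2); rewrite ?mulr0 //.
    rewrite eq_sym in xy.
    have [] := mphi_swap pr yD xD xy zD1 zD2 v1 v2.
    by rewrite swpK //= 1?eq_sym // vY.
  by have [] := mphi_swap pr xD yD xy ZD YD vZ vY.
Qed.

End Measure.

Section Reconstruct.

Variables (R : idomainType) (phi : forall P Q : poset, embedding P Q -> R).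
Arguments phi {P Q}.
Hypothesis phi_iso : forall P Q (a : embedding P Q), bijective a -> phi a = 1.
Hypothesis phi_comp : forall P Q S (a : embedding P Q) (b : embedding Q S),
  phi (comp_emb b a) = phi b * phi a.
Hypothesis phi_amalg : forall P Q P' (a : embedding P Q) (b : embedding P P') r
  (A : 'I_r -> amalgamation a b), all_amalgamations A ->
  phi a = \sum_(i < r) phi (am_a (A i)).

Let g := shift1 (nphi (@phi)).

Lemma W_mx (T : finType) (r : rel T) (D : {set T}) x : preo r (x |: D) ->
  W (@phi) r D (x |: D) = mx g r D x.
Proof.
move=> pr; have DxD := subsetUr [set x] D; have /preoP[rr rt] := pr.
have xx : r x x by apply: rr; rewrite setU11.
case: (boolP (x \in D)) => xD.
  rewrite (mx_dup _ pr xD xx xx); apply: (W_one phi_iso phi_comp) => // u uD.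
  exists u; last by rewrite /eqr rr.
  by move: uD; rewrite (setUidPr _) // sub1set.
have Hm := mphi_tmeas phi_iso phi_comp phi_amalg.
rewrite /mx -(tmeasE Hm (preo_sub DxD pr) xD (tp_sub r D x)) /mphi vld_tp //.
by apply: (eq_W phi_iso phi_comp) => // u v uD vD; rewrite upd_tp.
Qed.

Lemma W_nu (T : finType) (r : rel T) (D : {set T}) s : preo r (D :|: [set:: s]) ->
  W (@phi) r D (D :|: [set:: s]) = nu g r D s.
Proof.
elim: s D => [|x s IH] D pr /=.
  rewrite set_nil setU0 in pr *; apply: (W_one phi_iso phi_comp) => // u uD.
  by have /preoP[rr _] := pr; exists u => //; rewrite /eqr rr.
rewrite set_cons setUCA setUA in pr *.
rewrite (W_comp phi_iso phi_comp (E := x |: D)) ?subsetUl ?subsetUr // IH // W_mx 1?mulrC //.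
by apply: preo_sub pr; rewrite subsetUl.
Qed.

Lemma phi_nue P Q (a : embedding P Q) : phi a = nue g a.
Proof.
rewrite /nue; set D := [set _ | _ in _].
have DT : D :|: [set:: enum 'I_(pcard Q)] = setT.
  by apply/setP => z; rewrite !inE mem_enum orbT.
have pr := preo_ple (Q := Q) setT.
rewrite -W_nu ?DT //; symmetry.
apply: (WE phi_iso phi_comp (eP := a) (eQ := id) (a := a)) => //.
- split=> [i|i j|d /imsetP[i _ ->]]; rewrite ?imset_f -?emap_le //.
  by exists i; rewrite /eqr ple_refl.
- by split=> [i|i j|d _]; rewrite ?inE //; exists d; rewrite /eqr ple_refl.
- by move=> i; rewrite /eqr ple_refl.
Qed.

End Reconstruct.

(** * Necessity of the quadratic relations *)

Section SeqProfile.

Variables (T : finType) (r : rel T) (D : {set T}).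
Hypothesis pr : preo r D.
Implicit Types s : seq T.

(** [kaps], [lams] and [sigs] are list versions of [kap], [lam] and [sig] that evaluate, so that
    profiles of concrete configurations are found by computation. *)
Definition kaps s : nat :=
  if s is [::] then 0 else if has (fun a => all (r^~ a) s) s then 1 else 2.

Lemma kap_seq s : kap r [set:: s] = kaps s.
Proof.
case: (kapP r [set:: s]) => [E|a|a].
- by case: s E => // a s /setP/(_ a); rewrite !inE eqxx.
- rewrite inE => aS H; case: s aS H => // b s aS H; rewrite /kaps.
  suff -> : has (fun a => all (r^~ a) (b :: s)) (b :: s) by [].
  by apply/hasP; exists a => //; apply/allP => c cS; apply: H; rewrite inE.
- rewrite inE => aS H; case: s aS H => // b s aS H; rewrite /kaps.
  suff -> : has (fun a => all (r^~ a) (b :: s)) (b :: s) = false by [].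
  apply/negbTE/hasPn => c cS; have [|d] := H c; rewrite ?inE // => dS dc.
  by apply/negP => /allP/(_ d dS); apply/negP.
Qed.

Definition lams s s' :=
  has (fun a => all (r^~ a) s' && all (fun c => r c a && ~~ r a c) s) s'.

Definition sigs s s' := has (fun a => all (r^~ a) s && all (r^~ a) s') s.

Lemma lam_seq s s' : {subset s <= D} -> {subset s' <= D} ->
  lam r [set:: s] [set:: s'] = lams s s'.
Proof.
move=> sD s'D; have /preoP[rr rt] := pr; rewrite /lam.
case: witP => [E|a|a].
- by case: s' E {s'D} => // a s' /setP/(_ a); rewrite !inE eqxx.
- rewrite inE => aS H; have {}H c : c \in s' -> r c a by move=> cS; apply: H; rewrite inE.
  apply/andP/hasP => [[/leaP LE /meetsP nm]|[b bS /andP[/allP Hb /allP Hs]]].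
    exists a => //; apply/andP; split; first exact/allP.
    apply/allP => c cS; rewrite LE ?inE //=; apply/negP => ac.
    by apply: nm; exists c, a; rewrite !inE.
  split.
    apply/leaP => c d; rewrite !inE => cS /eqP ->.
    have /andP[cb _] := Hs c cS; exact: (rt _ _ _ (sD _ cS) (s'D _ bS) (s'D _ aS) cb (H b bS)).
  apply/meetsP => -[c [d []]]; rewrite !inE => cS /eqP -> ac.
  have /andP[_ /negP] := Hs c cS; apply; exact: (rt _ _ _ (s'D _ bS) (s'D _ aS) (sD _ cS) (H b bS) ac).
- rewrite inE => aS H; symmetry; apply/negbTE/hasPn => b bS; apply/negP => /andP[/allP Hb _].
  have [|c] := H b; rewrite inE // => cS /negP; apply; exact: Hb.
Qed.

Lemma sig_seq s s' : {subset s <= D} -> {subset s' <= D} ->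
  sig r [set:: s] [set:: s'] = sigs s s'.
Proof.
move=> sD s'D; have /preoP[rr rt] := pr; rewrite /sig.
case: witP => [E|a|a].
- by case: s E {sD} => // a s /setP/(_ a); rewrite !inE eqxx.
- rewrite inE => aS H; have {}H c : c \in s -> r c a by move=> cS; apply: H; rewrite inE.
  apply/leaP/hasP => [LE|[b bS /andP[/allP Hb /allP Hs]] c d].
    exists a => //; apply/andP; split; first exact/allP.
    by apply/allP => c cS; rewrite LE ?inE.
  rewrite !inE => cS /eqP ->; exact: (rt _ _ _ (s'D _ cS) (sD _ bS) (sD _ aS) (Hs c cS) (H b bS)).
- rewrite inE => aS H; symmetry; apply/negbTE/hasPn => b bS; apply/negP => /andP[/allP Hb _].
  have [|c] := H b; rewrite inE // => cS /negP; apply; exact: Hb.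
Qed.

End SeqProfile.

Section Necessary.

Variable R : idomainType.
Variables (m : forall T : finType, rel T -> {set T} -> T -> {set T * bool} -> R)
  (n : nat -> nat -> R).
Hypothesis Hm : tmeas m n.
Let g := shift1 n.

(** [tm_swap], summed over all types above the given bounds, has the left-hand sides of [Eval] and
    [Eval_dual] on its two sides. *)
Lemma tmeas_Lval (T : finType) (r : rel T) (D A B A' B' : {set T}) x y :
  preo r D -> x \notin D -> y \notin D -> x != y ->
  A \subset D -> B \subset D -> A' \subset D -> B' \subset D ->
  Lval g r A B A' B' = Lval (gT g) (op r) B' A' B A.
Proof.
move=> pr xD yD xy AD BD A'D B'D.
have key x0 y0 (Z0 : {set T * bool}) (C E : {set T}) : x0 \notin D -> y0 \notin D -> x0 != y0 ->
  C \subset x0 |: D -> E \subset x0 |: D ->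
  \sum_(Z : {set T * bool} | (Z0 \subset Z) && (Z \subset dbl D))
     m r D x0 Z * Gm m (upd r x0 Z) (x0 |: D) y0 (pairs C E) =
  \sum_(Z : {set T * bool} | (Z0 \subset Z) && (Z \subset dbl D))
     mz g r D Z * G g (upd r x0 Z) C E.
  move=> xD0 yD0 xy0 CD ED; apply: eq_bigr => Z /andP[_ ZD].
  rewrite (tmeasE Hm pr xD0 ZD); case: (boolP (vld r D Z)) => vZ; last first.
    by rewrite mz_vld0 // !mul0r.
  rewrite (GmE Hm) /Gz ?lo_pairs ?hi_pairs ?upd_preo //.
    by rewrite in_setU1 eq_sym (negbTE xy0).
  by rewrite pairs_subset CD.
have xA' : x |: A' \subset x |: D by apply: setUS.
have xB' : B' \subset x |: D by apply: subset_trans B'D (subsetUr _ _).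
have yB : y |: B \subset y |: D by apply: setUS.
have yA : A \subset y |: D by apply: subset_trans AD (subsetUr _ _).
have Z0D : pairs A B \subset dbl D by rewrite pairs_subset AD.
have Y0D : pairs (x |: A') B' \subset dbl (x |: D) by rewrite pairs_subset xA'.
have := Gm_swap Hm pr xD yD xy Z0D Y0D.
have -> : (swp D x y (pairs A B, pairs (x |: A') B')).1 = pairs A' B'.
  apply/setP => -[d b]; rewrite /= in_setI in_dbl !inE /=; case: b.
    by case dB: (d \in B'); rewrite //= (subsetP B'D).
  case dA: (d \in A') => /=; first by rewrite orbT (subsetP A'D).
  by rewrite orbF; apply/negP => /andP[/eqP ->]; rewrite (negbTE xD).
have -> : (swp D x y (pairs A B, pairs (x |: A') B')).2 = pairs A (y |: B).
  apply/setP => -[d b]; rewrite !inE /=; case: b; rewrite /= ?eqxx ?andbT ?orbT 1?orbC //.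
  have -> : (x \in B') = false by apply/negP => /(subsetP B'D); apply/negP.
  by rewrite andbF.
have yx : y != x by rewrite eq_sym.
move=> H; have := etrans (esym (key x y _ _ _ xD yD xy xA' xB')) H => {}H.
have := etrans H (key y x _ _ _ yD xD yx yA yB) => {}H.
have := etrans (esym (Eval g pr xD AD BD A'D B'D)) H => {}H.
by apply: (etrans H); apply: (Eval_dual g pr yD AD BD A'D B'D).
Qed.

Lemma tmeas_Lf (T : finType) (r : rel T) (D A B A' B' : {set T}) x y :
  preo r D -> x \notin D -> y \notin D -> x != y ->
  A \subset D -> B \subset D -> A' \subset D -> B' \subset D ->
  lea r A B -> lea r A' B' -> lea r A B' -> lea r A' B ->
  meets r A B = false -> meets r A' B' = false -> meets r A B' = false ->
  meets r A' B = false ->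
  Lf g (kap r A, kap r A', kap r (A :|: A'), lam r A A', sig r A A')
      (kap (op r) B', kap (op r) B, kap (op r) (B' :|: B), lam (op r) B' B,
       sig (op r) B' B) =
  Lf (gT g) (kap (op r) B', kap (op r) B, kap (op r) (B' :|: B), lam (op r) B' B,
       sig (op r) B' B) (kap r A, kap r A', kap r (A :|: A'), lam r A A', sig r A A').
Proof.
move=> pr xD yD xy AD BD A'D B'D l1 l2 l3 l4 m1 m2 m3 m4.
have pr' : preo (op r) D by rewrite op_preo.
rewrite -(Lval_generic g pr AD BD A'D B'D l1 l2 l3 l4 m1 m2 m3 m4).
rewrite (tmeas_Lval pr xD yD xy AD BD A'D B'D).
by apply: (Lval_generic (gT g) pr' B'D A'D BD AD); rewrite ?(lea_op r) ?(meets_op r).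
Qed.

Notation cT := ((option bool * bool) + bool)%type.

(** Two levels, with every lower point ([false]) below every upper one ([true]). Each level has two
    incomparable points [Some _], and [None] is the top of the lower level and the bottom of the
    upper one. The points [inr _] are kept for x and y. *)
Definition cr : rel cT := fun u v =>
  match u, v with
  | inl (a, false), inl (b, false) => (a == b) || (b == None)
  | inl (a, true), inl (b, true) => (a == b) || (a == None)
  | inl (_, c), inl (_, d) => d
  | _, _ => u == v
  end.

Definition cD : {set cT} := [set inl u | u : option bool * bool].

Lemma cr_preo : preo cr cD.
Proof.
apply/preoP; split; first by move=> _ /imsetP[[a []] _ ->] /=; rewrite eqxx.
move=> _ _ _ /imsetP[u _ ->] /imsetP[v _ ->] /imsetP[w _ ->].
by move: u v w => [[[]|] []] [[[]|] []] [[[]|] []].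
Qed.

(* In the order of [profiles]. *)
Definition configs : seq (seq (option bool) * seq (option bool)) :=
  let u := Some false in let v := Some true in let w := None in
  [:: ([::], [::]); ([::], [:: u]); ([::], [:: u; v]); ([:: u], [::]);
      ([:: u], [:: u]); ([:: u], [:: w]); ([:: u], [:: v]); ([:: w], [:: u; v]);
      ([:: u], [:: u; v]); ([:: u; v], [::]); ([:: u; v], [:: w]);
      ([:: u; v], [:: u]); ([:: u; v], [:: u; v])].

Definition sprof (r : rel cT) (f : option bool -> cT) (s : seq (option bool) * seq (option bool)) :=
  (kaps r (map f s.1), kaps r (map f s.2), kaps r (map f s.1 ++ map f s.2),
   lams r (map f s.1) (map f s.2), sigs r (map f s.1) (map f s.2)).

Lemma config_low : map (sprof cr (fun a => inl (a, false))) configs = profiles.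
Proof. by []. Qed.

Lemma config_up : map (sprof (op cr) (fun a => inl (a, true))) configs = profiles.
Proof. by []. Qed.

(** All profiles occur in both levels of [cr], by [config_low] and [config_up], so each pair of
    profiles is realized. *)
Lemma tmeas_rels : rels g.
Proof.
move=> lw up; rewrite -{1}config_low -{1}config_up => /mapP[s _ ->] /mapP[t _ ->].
pose lf a : cT := inl (a, false); pose uf a : cT := inl (a, true).
pose ls s : {set cT} := [set:: map lf s]; pose us s : {set cT} := [set:: map uf s].
have lsP s' u : u \in ls s' -> exists a, u = inl (a, false).
  by rewrite inE => /mapP[a _ ->]; exists a.
have usP s' u : u \in us s' -> exists a, u = inl (a, true).
  by rewrite inE => /mapP[a _ ->]; exists a.
have lD s' : {subset map lf s' <= cD} by move=> _ /mapP[a _ ->]; apply: imset_f.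
have uD s' : {subset map uf s' <= cD} by move=> _ /mapP[a _ ->]; apply: imset_f.
have lsD s' : ls s' \subset cD by apply/subsetP => u; rewrite inE; apply: lD.
have usD s' : us s' \subset cD by apply/subsetP => u; rewrite inE; apply: uD.
have pr := cr_preo; have pr' : preo (op cr) cD by rewrite op_preo.
have LE a b : lea cr (ls a) (us b).
  by apply/leaP => u v /lsP[c ->] /usP[d ->].
have nM a b : meets cr (ls a) (us b) = false.
  by apply/meetsP => -[u [v [/lsP[c ->] /usP[d ->]]]].
have nx b : inr b \notin cD by apply/imsetP => -[].
have catE (f : option bool -> cT) a b : [set:: map f a] :|: [set:: map f b] = [set:: map f a ++ map f b].
  by apply/setP => u; rewrite !inE mem_cat.
have xy : (inr true : cT) != inr false by [].
have := tmeas_Lf pr (nx true) (nx false) xy (lsD s.1) (usD t.2) (lsD s.2) (usD t.1)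
  (LE _ _) (LE _ _) (LE _ _) (LE _ _) (nM _ _) (nM _ _) (nM _ _) (nM _ _).
rewrite /sprof /ls /us (catE lf) (catE uf).
rewrite !(kap_seq cr) !(kap_seq (op cr)).
rewrite (lam_seq pr (lD _) (lD _)) (sig_seq pr (lD _) (lD _)).
by rewrite (lam_seq pr' (uD _) (uD _)) (sig_seq pr' (uD _) (uD _)).
Qed.

End Necessary.

(* A component is given by the entries of its generic 3x3 matrix, in row-major
   order: 0, 1 and 2 stand for 0, 1 and -1, while 3 and 4 stand for two free
   parameters. *)
Definition comps : seq (seq nat) :=
  [::
   [:: 3; 0; 0; 0; 4; 4; 0; 4; 4];
   [:: 4; 4; 4; 4; 4; 4; 4; 4; 4];
   [:: 0; 0; 0; 4; 4; 4; 4; 4; 4];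
   [:: 0; 4; 4; 0; 4; 4; 0; 4; 4];
   [:: 3; 0; 0; 0; 2; 0; 0; 2; 0];
   [:: 3; 0; 0; 0; 2; 2; 0; 0; 0];
   [:: 3; 2; 0; 2; 2; 0; 0; 0; 1];
   [:: 3; 2; 0; 2; 2; 0; 0; 2; 0];
   [:: 3; 2; 0; 2; 2; 2; 0; 0; 0];
   [:: 0; 0; 0; 2; 2; 0; 2; 2; 0];
   [:: 0; 0; 0; 2; 2; 2; 0; 0; 0];
   [:: 0; 0; 1; 2; 2; 0; 0; 0; 1];
   [:: 0; 0; 1; 2; 2; 0; 0; 2; 0];
   [:: 0; 0; 1; 2; 2; 0; 2; 2; 0];
   [:: 0; 2; 0; 0; 2; 0; 0; 2; 0];
   [:: 0; 2; 0; 0; 2; 0; 1; 0; 1];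
   [:: 0; 2; 0; 0; 2; 2; 1; 0; 0];
   [:: 0; 2; 2; 0; 2; 2; 0; 0; 0];
   [:: 0; 2; 2; 0; 2; 2; 1; 0; 0];
   [:: 1; 0; 0; 0; 2; 2; 1; 0; 0];
   [:: 1; 0; 1; 0; 2; 0; 0; 2; 0];
   [:: 1; 0; 1; 0; 2; 0; 1; 0; 1];
   [:: 2; 2; 0; 2; 2; 0; 2; 2; 0];
   [:: 2; 2; 2; 2; 2; 2; 0; 0; 0]].

Definition cval (R : pzRingType) (x t : R) (c : seq nat) : seq R :=
  [seq nth 0 [:: 0; 1; -1; x; t] k | k <- c].

Lemma combm (R : zmodType) (p p' : R) : p = 0 -> p' = 0 -> p - p' = 0.
Proof. by move=> -> ->; rewrite subr0. Qed.

(** * Solutions of the quadratic relations in a domain *)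

Section Cases.

Variable R : idomainType.
Add Ring R_ring : (comNzRing_theory R).
Ltac cring := rewrite /= ?mulr1n ?mulr0n; rfold R; ring.

Lemma in_comp k (x t : R) s : (k < size comps)%N -> s = cval x t (nth [::] comps k) ->
  exists2 c, c \in comps & exists x t : R, s = cval x t c.
Proof. by move=> kc ->; exists (nth [::] comps k); [exact: mem_nth|exists x, t]. Qed.

Lemma factor1 (p v e : R) : p = 0 -> v - e = p \/ v - e = - p -> v = e.
Proof. by move=> -> []; rewrite ?oppr0 => /eqP; rewrite subr_eq0 => /eqP. Qed.

Lemma factor2 (p v e v' e' : R) : p = 0 ->
  (v - e) * (v' - e') = p \/ (v - e) * (v' - e') = - p -> v = e \/ v' = e'.
Proof.
move=> -> H; have /eqP : (v - e) * (v' - e') = 0 by case: H; rewrite ?oppr0.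
by rewrite mulf_eq0 !subr_eq0 => /orP[]/eqP; [left|right].
Qed.

Ltac up_to_sign := solve [left; cring | right; cring].
(* [force] solves a linear relation, [force_sq] the square of one, and [branch] splits a product of
   two linear factors; the factorizations are valid only after substitution of the values found so
   far. *)
Tactic Notation "force" ident(v) uconstr(e) constr(H) := let E := fresh in
  assert (E : v = e) by (apply: (factor1 H); up_to_sign); subst v.
Tactic Notation "force_sq" ident(v) uconstr(e) constr(H) := let E := fresh in
  assert (E : v = e \/ v = e) by (apply: (factor2 H); up_to_sign);
  assert (v = e) by (destruct E; assumption); clear E; subst v.
Tactic Notation "branch" ident(v) uconstr(e) ident(v') uconstr(e') constr(H) :=
  let E := fresh in
  assert (E : v = e \/ v' = e') by (apply: (factor2 H); up_to_sign);
  destruct E; [subst v|subst v'].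

Lemma comps_cases (n00 n01 n02 n10 n11 n12 n20 n21 n22 : R) :
  n11 * n21 - n21 * n21 = 0 ->
  n11 + n11 * n11 - n11 * n21 - n21 = 0 ->
  - n11 - n11 * n11 + n11 * n12 + n12 = 0 ->
  - (n11 * n22) + n12 + n12 * n12 - n22 = 0 ->
  - (n01 * n01) + n01 * n11 = 0 ->
  - n01 - n01 * n01 + n02 + n02 * n11 = 0 ->
  - n01 - n01 * n11 + n02 + n02 * n11 + n10 + n10 * n11 - n11 * n20 - n20 = 0 ->
  n10 * n10 - n10 * n11 = 0 ->
  - (n11 * n12) + n12 * n12 = 0 ->
  - n11 - n11 * n12 - n11 * n21 + n11 * n22 + n12 + n12 * n12 + n12 * n21 + n12 * n21 - n12 * n22 - n21 * n22 = 0 ->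
  n01 * n11 - n01 * n12 - n01 * n21 - n02 * n11 + n02 * n12 + n02 * n21 + n11 + n11 * n12 - n12 * n21 - n21 = 0 ->
  - (n00 * n02) - n01 - n01 * n01 + n01 * n02 + n02 + n02 * n10 = 0 ->
  - n01 - n01 * n10 + n01 * n20 - n01 * n21 + n02 + n02 * n10 - n02 * n20 + n02 * n21 + n10 * n21 - n20 * n21 = 0 ->
  - (n00 * n01) + n00 * n10 = 0 ->
  - (n01 * n02) + n02 * n12 = 0 ->
  n12 * n22 - n21 * n22 = 0 ->
  n10 * n20 + n10 * n20 - n11 * n20 - n20 * n20 = 0 ->
  n00 * n20 - n01 * n20 + n10 + n10 * n10 - n10 * n20 - n20 = 0 ->
  n10 * n20 - n20 * n21 = 0 ->
  - (n01 * n02) - n01 * n02 + n02 * n02 + n02 * n11 = 0 ->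
  n01 * n10 - n01 * n12 - n01 * n20 - n02 * n10 + n02 * n12 + n02 * n20 +
    n10 + n10 * n12 - n12 * n20 - n20 = 0 ->
  n00 * n20 - n01 * n20 + n10 * n20 - n20 * n20 = 0 ->
  - (n01 * n22) + n02 * n22 + n12 + n12 * n12 - n12 * n22 - n22 = 0 ->
  - (n01 * n22) + n02 * n22 + n11 * n22 - n21 * n22 = 0 ->
  - n01 - n01 * n11 + n02 + n02 * n11 + n11 + n11 * n11 - n11 * n21 - n21 = 0 ->
  exists2 c, c \in comps &
    exists x t, [:: n00; n01; n02; n10; n11; n12; n20; n21; n22] = cval x t c.
Proof.
(* Each name records the two profiles of its relation by the values of [kap] for the two sets, with
   [lt], [le] or [inc] for their relative position. *)
move=> H_02_10 H_01_10 H_10_01 H_11lt_20 H_00_10 H_00_11lt H_01_01 H_10_00 H_10_02 H_11inc_21le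
  H_01_11inc H_00_01 H_02_01 H_00_00 H_00_20 H_11inc_11inc H_11inc_00 H_01_00 H_20_00
  H_00_11inc H_01_02 H_02_00 H_01_20 H_02_11inc H_01_11lt.
(* Each leaf of the case tree names a component by its index in [comps], with the parameters of the
   point on it. Several leaves fall into the plane, the component of index 0. *)
branch n21 0 n21 n11 H_02_10.
  { branch n11 0 n11 (-1) H_01_10.
    { force n12 0 H_10_01. force n22 0 H_11lt_20. force_sq n01 0 H_00_10.
    force n02 0 H_00_11lt. force n20 n10 H_01_01. force_sq n10 0 H_10_00.
    by apply: (@in_comp 0 n00 0). }
  branch n12 0 n12 (-1) H_10_02.
    { force n22 1 H_11inc_21le. branch n01 0 n01 (-1) H_00_10.
      { force n02 1 H_01_11inc. force n20 n00 (combm H_00_01 H_02_01).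
      branch n10 0 n10 (-1) H_10_00.
        { force n00 1 H_00_01. by apply: (@in_comp 21 0 0). }
      force n00 0 H_00_00. by apply: (@in_comp 11 0 0). }
    force n02 0 H_00_20. branch n10 0 n10 (-1) H_10_00.
      { force n20 1 H_02_01. force n00 0 H_00_00. by apply: (@in_comp 15 0 0). }
    force n20 0 H_02_01. by apply: (@in_comp 6 n00 0). }
  force n22 0 H_11inc_11inc. branch n01 0 n01 (-1) H_00_10.
    { force n02 0 H_00_20. branch n10 0 n10 (-1) H_10_00.
      { branch n20 0 n20 1 H_11inc_00.
        { by apply: (@in_comp 5 n00 0). }
      force n00 1 H_01_00. by apply: (@in_comp 19 0 0). }
    force n20 0 H_20_00. force n00 0 H_00_00. by apply: (@in_comp 10 0 0). }
  branch n02 0 n02 (-1) H_00_11inc.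
    { branch n10 0 n10 (-1) H_10_00.
      { force n20 1 H_01_02. force n00 0 H_00_00. by apply: (@in_comp 16 0 0). }
    force n20 0 H_01_02. by apply: (@in_comp 8 n00 0). }
  force n10 n00 H_00_01. branch n00 0 n00 (-1) H_00_00.
    { branch n20 0 n20 1 H_02_00.
      { by apply: (@in_comp 17 0 0). }
    by apply: (@in_comp 18 0 0). }
  force n20 0 H_20_00. by apply: (@in_comp 23 0 0). }
branch n12 0 n12 n11 H_10_02.
  { force n22 0 (combm H_01_20 H_02_11inc). branch n11 0 n11 (-1) H_10_01.
    { force_sq n01 0 H_00_10. force n02 0 H_00_11lt. force n20 n10 H_01_01.
    force_sq n10 0 H_10_00. by apply: (@in_comp 0 n00 0). }
  branch n01 0 n01 (-1) H_00_10.
    { branch n02 0 n02 1 H_00_11inc.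
      { force n20 n10 H_01_02. branch n10 0 n10 (-1) H_10_00.
        { by apply: (@in_comp 4 n00 0). }
      force n00 0 H_00_00. by apply: (@in_comp 9 0 0). }
    branch n10 0 n10 (-1) H_10_00.
      { force n20 0 H_20_00. force n00 1 H_00_01. by apply: (@in_comp 20 0 0). }
    force n00 0 H_00_00. branch n20 0 n20 (-1) H_02_00.
      { by apply: (@in_comp 12 0 0). }
    by apply: (@in_comp 13 0 0). }
  force n02 0 H_00_20. branch n10 0 n10 (-1) H_10_00.
    { force n20 0 H_20_00. force n00 0 H_00_00. by apply: (@in_comp 14 0 0). }
  branch n20 0 n20 (-1) H_11inc_00.
    { by apply: (@in_comp 7 n00 0). }
  force n00 (-1) H_01_00. by apply: (@in_comp 22 0 0). }
force n22 n11 (combm H_11lt_20 H_11inc_21le). force n02 n01 (combm H_01_11lt H_01_11inc).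
force n20 n10 (combm H_01_01 H_02_01). branch n01 0 n11 n01 H_00_10.
  { branch n10 0 n11 n10 H_10_00.
    { by apply: (@in_comp 0 n00 n11). }
  branch n00 0 n10 0 H_00_00.
    { by apply: (@in_comp 2 0 n10). }
  by apply: (@in_comp 0 n00 0). }
branch n10 0 n10 n01 H_10_00.
  { branch n00 0 n01 0 H_00_00.
    { by apply: (@in_comp 3 0 n01). }
  by apply: (@in_comp 0 n00 0). }
branch n01 0 n01 n00 H_00_01.
  { by apply: (@in_comp 0 n00 0). }
by apply: (@in_comp 1 0 n00).
Qed.

End Cases.

Definition grid (R : pzRingType) (s : seq R) (p q : nat) : R := nth 0 s (3 * p + q).

Definition entries (R : pzRingType) (n : nat -> nat -> R) : seq R :=
  [:: n 0 0; n 0 1; n 0 2; n 1 0; n 1 1; n 1 2; n 2 0; n 2 1; n 2 2]%N.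

Section Necessary.

Variable R : idomainType.
Add Ring R_ring : (comNzRing_theory R).
Ltac cring := rewrite /= ?mulr1n ?mulr0n; rfold R; ring.

Lemma diff0 (L M P : R) : L = M -> P = L - M -> P = 0.
Proof. by move=> ->; rewrite subrr. Qed.

Ltac rel H := by apply: (diff0 H); rewrite /Lf /gT /shift1; cring.

Lemma rels_cases (n : nat -> nat -> R) : rels (shift1 n) ->
  exists2 c, c \in comps & exists x t, entries n = cval x t c.
Proof.
pose pr := nth (0, 0, 0, false, false)%N profiles; move=> Hg.
have E i j : (i < 13)%N -> (j < 13)%N ->
    Lf (shift1 n) (pr i) (pr j) = Lf (gT (shift1 n)) (pr j) (pr i).
  by move=> i13 j13; apply: Hg; apply: mem_nth.
apply: comps_cases.
- rel (E 2 3 isT isT).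
- rel (E 1 3 isT isT).
- rel (E 3 1 isT isT).
- rel (E 5 9 isT isT).
- rel (E 0 3 isT isT).
- rel (E 0 5 isT isT).
- rel (E 1 1 isT isT).
- rel (E 3 0 isT isT).
- rel (E 3 2 isT isT).
- rel (E 6 10 isT isT).
- rel (E 1 6 isT isT).
- rel (E 0 1 isT isT).
- rel (E 2 1 isT isT).
- rel (E 0 0 isT isT).
- rel (E 0 9 isT isT).
- rel (E 6 6 isT isT).
- rel (E 6 0 isT isT).
- rel (E 1 0 isT isT).
- rel (E 9 0 isT isT).
- rel (E 0 6 isT isT).
- rel (E 1 2 isT isT).
- rel (E 2 0 isT isT).
- rel (E 1 9 isT isT).
- rel (E 2 6 isT isT).
- rel (E 1 5 isT isT).
Qed.

End Necessary.

(** * Verification of the relations on the components *)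

Section Sufficient.

(* Affine and quadratic polynomials in the two parameters of a component, with
   integer coefficients: the relations are identities between such quadratic
   polynomials and can be decided by computation. *)
Definition lin := (int * int * int)%type.
Definition quad := (int * int * int * int * int * int)%type.

Definition ladd (u v : lin) : lin :=
  let: (a, b, c) := u in let: (a', b', c') := v in (a + a', b + b', c + c').
Definition lopp (u : lin) : lin := let: (a, b, c) := u in (- a, - b, - c).
Definition lmul (u v : lin) : quad :=
  let: (a, b, c) := u in let: (a', b', c') := v in
  (a * a', a * b' + b * a', a * c' + c * a', b * b', b * c' + c * b', c * c').
Definition qadd (u v : quad) : quad :=
  let: (a, b, c, d, e, f) := u in let: (a', b', c', d', e', f') := v in
  (a + a', b + b', c + c', d + d', e + e', f + f').

Definition l1 : lin := (1, 0, 0).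
Definition l0 : lin := (0, 0, 0).

Definition Lq (g : nat -> nat -> lin) (lw up : nat * nat * nat * bool * bool) : quad :=
  let: (al, al', P, la, _) := lw in
  let: (be, _, Q, _, sg) := up in
  let d := ladd (g 1%N be) (lopp (g 2%N be)) in
  qadd
  match al' with
  | 0%N => lmul (g 1%N be) (g al Q)
  | 1%N => qadd (lmul (g 2%N be) (g al Q))
      (lmul d (ladd (g P Q) (if la then ladd (g al 1%N) (lopp l1) else l0)))
  | _ => qadd (lmul (g 2%N be) (g al Q)) (lmul d (g P Q))
  end (lmul l1 (if sg then ladd l1 (lopp (g 1%N be)) else l0)).

(** The entries of [shift1] on the component, stored as constant term and coefficients of the two
    parameters. *)
Definition lcode (c : seq nat) p q : lin :=
  ladd (nth l0 [:: l0; l1; lopp l1; (0, 1, 0); (0, 0, 1)] (nth 0%N c (3 * p + q)))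
    ((p == 1%N)%:R + (q == 1%N)%:R, 0, 0).

Lemma lcode_rels : all (fun c => all (fun lw => all (fun up =>
  Lq (lcode c) lw up == Lq (fun p q => lcode c q p) up lw) profiles) profiles) comps.
Proof. by vm_compute. Qed.

Variable R : comNzRingType.
Add Ring R_ring : (comNzRing_theory R).
Ltac cring := rewrite /= ?mulr1n ?mulr0n; rfold R; ring.
Variables x t : R.

Definition lev (u : lin) : R := let: (a, b, c) := u in a%:~R + b%:~R * x + c%:~R * t.
Definition qev (u : quad) : R :=
  let: (a, b, c, d, e, f) := u in a%:~R + b%:~R * x + c%:~R * t + d%:~R * (x * x) +
    e%:~R * (x * t) + f%:~R * (t * t).

Lemma lev_add u v : lev (ladd u v) = lev u + lev v.
Proof. by move: u v => [[a b] c] [[a' b'] c']; rewrite /= !intrD; cring. Qed.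

Lemma lev_opp u : lev (lopp u) = - lev u.
Proof. by move: u => [[a b] c]; rewrite /= !mulrNz; cring. Qed.

Lemma lev_mul u v : qev (lmul u v) = lev u * lev v.
Proof. by move: u v => [[a b] c] [[a' b'] c']; rewrite /= !intrD !intrM; cring. Qed.

Lemma qev_add u v : qev (qadd u v) = qev u + qev v.
Proof.
by move: u v => [[[[[a b] c] d] e] f] [[[[[a' b'] c'] d'] e'] f']; rewrite /= !intrD; cring.
Qed.

Lemma lev1 : lev l1 = 1. Proof. by rewrite /lev /= mulr1z !mulr0z; cring. Qed.
Lemma lev0 : lev l0 = 0. Proof. by rewrite /lev /= !mulr0z; cring. Qed.

Lemma qev_Lq g lw up : qev (Lq g lw up) = Lf (fun p q => lev (g p q)) lw up.
Proof.
move: lw up => [[[[al [|[|al']]] P] la] sg'] [[[[be be'] Q] la'] sg]; rewrite /Lq /Lf;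
  rewrite !(qev_add, lev_mul) lev1 mul1r; congr (_ + _);
  try (by case: sg; rewrite ?lev0 // lev_add lev_opp lev1).
  by rewrite !lev_add lev_opp; case: la; rewrite ?lev0 // lev_add lev_opp lev1.
by rewrite lev_add lev_opp.
Qed.

Lemma lev_lcode c p q : lev (lcode c p q) = shift1 (grid (cval x t c)) p q.
Proof.
rewrite /lcode lev_add /shift1 /grid /cval -addrA; congr (_ + _).
  case: (ltnP (3 * p + q) (size c)) => pqc.
    rewrite (nth_map 0%N) //.
    by case: (nth 0%N c _) => [|[|[|[|[|k]]]]]; rewrite /= ?nth_nil /=;
      rewrite ?oppr0 ?mulrN1z ?mulr1z ?mulr0z; cring.
  by rewrite (nth_default 0%N pqc) [RHS]nth_default ?size_map // lev0.
by rewrite /lev intrD !mulr0z !rmorph_nat; cring.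
Qed.

Lemma comps_rels c : c \in comps -> rels (shift1 (grid (cval x t c))).
Proof.
move=> cc lw up lwP upP.
have E : shift1 (grid (cval x t c)) = fun p q => lev (lcode c p q).
  by apply/funext => p; apply/funext => q; rewrite lev_lcode.
have := congr1 qev (eqP (allP (allP (allP lcode_rels c cc) lw lwP) up upP)).
by rewrite !qev_Lq E.
Qed.

End Sufficient.

(** * Radicals and homomorphisms to domains *)

Section Krull.

Import classical_sets generic_quotient ring_quotient.

Section IdealGen.

Variable A : comNzRingType.
Implicit Types (S J : A -> Prop).

Definition ideal_closed J :=
  [/\ J 0, forall x y, J x -> J y -> J (x + y) & forall c x, J x -> J (c * x)].

Lemma ideal_gen_min S J x : ideal_closed J -> (forall s, S s -> J s) ->
  ideal_gen S x -> J x.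
Proof.
move=> [J0 JD JM] SJ [n [c [s [Ss ->]]]].
by elim/big_ind: _ => // i _; apply/JM/SJ.
Qed.

Lemma ideal_gen_in S s : S s -> ideal_gen S s.
Proof.
by move=> Ss; exists 1%N, (fun=> 1), (fun=> s); rewrite big_ord1 mul1r.
Qed.

Lemma ideal_gen_closed S : ideal_closed (ideal_gen S).
Proof.
split=> [|x y [n [c [s [Ss ->]]]] [m [d [t [St ->]]]]|a x [n [c [s [Ss ->]]]]].
- by exists 0%N, (fun=> 0), (fun=> 0); rewrite big_ord0; split=> // -[].
- pose g (T : Type) (u : 'I_n -> T) (v : 'I_m -> T) (i : 'I_(n + m)) :=
    match split i with inl j => u j | inr j => v j end.
  exists (n + m)%N, (g _ c d), (g _ s t); split.
    by move=> i; rewrite /g; case: (split i).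
  rewrite big_split_ord /g; congr (_ + _); apply: eq_bigr => i _.
    by rewrite (unsplitK (inl i)).
  by rewrite (unsplitK (inr i)).
- exists n, (fun i => a * c i), s; split=> //.
  by rewrite mulr_sumr; apply: eq_bigr => i _; rewrite mulrA.
Qed.

(** Zorn is applied to sets of additional generators, not to ideals, for which no power of [f]
    enters the generated ideal. At a maximal set this ideal is prime: if it contained neither x nor
    y, some power of [f] would lie in I + (x) and another in I + (y), hence their product in I +
    (xy). *)
Lemma prime_ideal_ex S f : ~ radical (ideal_gen S) f ->
  exists I : A -> Prop, [/\ ideal_closed I, forall s, S s -> I s,
    forall x y, I (x * y) -> I x \/ I y & forall n, ~ I (f ^+ n)].
Proof.
move=> nf; pose P (X : set A) := forall n, ~ ideal_gen (fun x => S x \/ X x) (f ^+ n).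
have [F FP totF n [k [c [s [Ss E]]]]|X [PX Xmax]] := @Zorn_bigcup A P.
  (* A linear combination involves finitely many generators, so one member of the chain contains all
     that do not come from [S]. The alternative [set0] covers the empty chain. *)
  suff [Y FY SY] : exists2 Y : set A, F Y \/ Y = set0 & forall i, S (s i) \/ Y (s i).
    case: FY => [FY|Y0]; first by apply: (FP Y FY n); exists k, c, s.
    by apply: nf; exists n, k, c, s; split=> // i; have [//|] := SY i; rewrite Y0.
  elim: k s Ss {c E} => [|k IH] s Ss; first by exists set0; [right|case].
  have [Y FY SY] := IH (fun i => s (lift ord0 i)) (fun i => Ss _).
  have ex0 : exists2 Y0 : set A, F Y0 \/ Y0 = set0 & S (s ord0) \/ Y0 (s ord0).
    by case: (Ss ord0) => [S0|[Z FZ Z0]]; [exists set0; [right|left]|exists Z; [left|right]].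
  have [Z FZ SZ] := ex0.
  have [W FW [YW ZW]] : exists2 W : set A, F W \/ W = set0 &
      (forall x, Y x -> W x) /\ (forall x, Z x -> W x).
    case: FY => [FY|Y0]; last by exists Z; [exact: FZ|split=> //; rewrite Y0].
    case: FZ => [FZ|Z0]; last by exists Y; [left|split=> //; rewrite Z0].
    by have [YZ|ZY] := totF _ _ FY FZ; [exists Z; [left|]|exists Y; [left|]].
  exists W => // i; have [j ->|->] := unliftP ord0 i.
    by have [//|/YW] := SY j; [left|right].
  by have [|/ZW] := SZ; [left|right].
pose I := ideal_gen (fun x => S x \/ X x).
have cI : ideal_closed I := ideal_gen_closed _.
have SI s : S s -> I s by move=> Ss; apply: ideal_gen_in; left.
have XI s : X s -> I s by move=> Ss; apply: ideal_gen_in; right.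
have [I0 ID IM] := cI.
have notI a : ~ I a -> exists n i d, I i /\ f ^+ n = i + d * a.
  move=> nIa; pose Y : set A := fun x => I x \/ x = a.
  have XY : (X `<` Y)%classic.
    split; first by move=> x Xx; left; apply: XI.
    by move=> /(_ a (or_intror erefl)) /XI.
  have /Xmax/existsNP[n /contrapT H] := XY; exists n.
  move: H; apply: (@ideal_gen_min _ (fun z => exists i d, I i /\ z = i + d * a)) => [|s].
    split=> [|x y [i [d [Ii ->]]] [j [e [Ij ->]]]|c x [i [d [Ii ->]]]].
    - by exists 0, 0; rewrite mul0r addr0.
    - by exists (i + j), (d + e); rewrite mulrDl addrACA; split=> //; apply: ID.
    - by exists (c * i), (c * d); rewrite mulrDr mulrA; split=> //; apply: IM.
  case=> [/SI Is|[Is|->]]; first by exists s, 0; rewrite mul0r addr0.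
    by exists s, 0; rewrite mul0r addr0.
  by exists 0, 1; rewrite mul1r add0r.
exists I; split=> //.
move=> x y Ixy; apply: contrapT => /not_orP[/notI[n [i [d [Ii En]]]] /notI[m [j [e [Ij Em]]]]].
apply: (PX (n + m)%N); rewrite exprD En Em -/(I _) mulrDl !mulrDr.
apply: (ID); first by apply: (ID); [apply: IM|rewrite mulrC; apply: IM].
apply: ID; first exact: IM.
by rewrite mulrACA; apply: IM.
Qed.

End IdealGen.

Section Domain.

Variable (Q : comNzRingType).
Hypothesis Q_integral : forall x y : Q, x * y = 0 -> (x == 0) || (y == 0).

(* The ring [Q] as an [idomainType], with inverses given by choice. *)
Definition domain_of (_ : forall x y : Q, x * y = 0 -> (x == 0) || (y == 0)) : Type := Q.
Notation D := (domain_of Q_integral).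

HB.instance Definition _ := GRing.ComNzRing.on D.

Definition dom_unit (x : D) : bool := `[< exists y, y * x = 1 >].
Definition dom_inv (x : D) : D :=
  if pselect (exists y, y * x = 1) is left H then projT1 (cid H) else x.

Lemma dom_mulVr : {in dom_unit, left_inverse 1 dom_inv *%R}.
Proof.
move=> x /asboolP H; rewrite /dom_inv; case: pselect => // H'.
by case: (cid H').
Qed.

Lemma dom_unitP (x y : D) : y * x = 1 -> dom_unit x.
Proof. by move=> H; apply/asboolP; exists y. Qed.

Lemma dom_inv_out : {in [predC dom_unit], dom_inv =1 id}.
Proof.
by move=> x /asboolP H; rewrite /dom_inv; case: pselect.
Qed.

HB.instance Definition _ := GRing.ComNzRing_hasMulInverse.Build D
  dom_mulVr dom_unitP dom_inv_out.
HB.instance Definition _ := GRing.ComUnitRing_isIntegral.Build D Q_integral.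

Definition domain_idomain : idomainType := D.

End Domain.

Section Quotient.

Variables (A : comNzRingType) (I : A -> Prop).
Hypothesis I_closed : ideal_closed I.
Hypothesis I_prime : forall x y, I (x * y) -> I x \/ I y.
Hypothesis I_proper : ~ I 1.

Definition idealb : A -> bool := fun x => `[< I x >].

Lemma idealb_closed : idealr_closed idealb.
Proof.
have [I0 ID IM] := I_closed; split.
- exact/asboolP.
- by apply/negP => /asboolP.
- by move=> a x y /asboolP Ix /asboolP Iy; apply/asboolP; apply: (ID) => //; apply: IM.
Qed.

HB.instance Definition _ := isIdealr.Build A idealb idealb_closed.

Lemma idealb_prime : prime_idealr_closed idealb.
Proof.
by move=> x y /asboolP/I_prime[] H; apply/orP; [left|right]; apply/asboolP.
Qed.

HB.instance Definition _ := isPrimeIdealrClosed.Build A idealb idealb_prime.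

Let Iq : prime_idealr A := idealb.
Let Q : comNzRingType := {ideal_quot Iq}.

Lemma quot_domain : exists (R : idomainType) (phi : {rmorphism A -> R}),
  forall x, phi x = 0 <-> I x.
Proof.
pose R := domain_idomain (@Quotient.rquot_IdomainAxiom _ Iq).
pose pi : {rmorphism A -> Q} := \pi_Q%qT.
exists R, (pi : {rmorphism A -> R}) => x.
have E : (pi x == pi 0) = idealb x by rewrite -[in RHS](subr0 x); exact: (esym (Quotient.idealrBE Iq x 0)).
rewrite rmorph0 in E; split=> [/eqP|Ix].
  by rewrite E => /asboolP.
by apply/eqP; rewrite E; apply/asboolP.
Qed.

End Quotient.

Lemma krull (A : comNzRingType) (S : A -> Prop) f : ~ radical (ideal_gen S) f ->
  exists (R : idomainType) (phi : {rmorphism A -> R}),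
    (forall s, S s -> phi s = 0) /\ phi f <> 0.
Proof.
move=> /prime_ideal_ex[I [cI SI pI nI]].
have n1 : ~ I 1 by rewrite -(expr0 f).
have [R [phi phiE]] := quot_domain cI pI n1.
exists R, phi; split=> [s /SI /phiE //|/phiE].
by apply: (nI 1%N).
Qed.

End Krull.

(** * Evaluation homomorphisms of polynomial rings *)

Section Monomials.

Variables (I : choiceType) (S : comNzRingType) (h : I -> S).

Definition mev (m : {cmonom I}) : S := \prod_(i <- finsupp m) h i ^+ m i.

Lemma mevE (m : {cmonom I}) (d : {fset I}) : (finsupp m `<=` d)%fset ->
  mev m = \prod_(i <- d) h i ^+ m i.
Proof.
move=> md; apply: big_fset_incl => // i _ im.
by rewrite (fsfun_dflt im) expr0.
Qed.

Lemma mev_mmorph : mmorphism mev.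
Proof.
split=> [m1 m2|]; last by rewrite /mev mdom1 big_seq_fset0.
rewrite (mevE (fsubset_refl (finsupp (mmul m1 m2)))) mdomD.
rewrite (mevE (fsubsetUl (finsupp m1) (finsupp m2))).
rewrite (mevE (fsubsetUr (finsupp m1) (finsupp m2))) -big_split /=.
by apply: eq_bigr => i _; rewrite cmM exprD.
Qed.

HB.instance Definition _ := isMultiplicative.Build _ _ mev mev_mmorph.

Lemma mevU i : mev (ucm i) = h i.
Proof. by rewrite /mev mdomU big_seq_fset1 cmUU expr1. Qed.

End Monomials.

Lemma monomE (R : comNzRingType) (I : choiceType) (m : {cmonom I}) :
  << m >> = mev (@pvar R I) m :> polyring R I.
Proof.
have [n] := ubnP (mdeg m); elim: n m => // n IH m; rewrite ltnS => mn.
have [/mdeg_eq0I ->|m0] := eqVneq (mdeg m) 0%N; first by rewrite mmorph1.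
have [i im] : exists i, i \in finsupp m.
  apply/fset0Pn; apply: contraNneq m0 => f0.
  by rewrite mdegE f0 big_seq_fset0.
have mE : m = mmul (ucm i) (divcm m (ucm i)).
  apply/eqP/cmP => j; rewrite cmM cmU divcmE cmU.
  case: eqP => [<-|_]; last by rewrite subn0.
  by rewrite subnKC // lt0n cmE_neq0.
rewrite [in LHS]mE [in RHS]mE mmorphM /= mevU -IH; first by rewrite malgM_def fgmulUU mulr1.
by apply: leq_trans mn; rewrite [in X in (_ < X)%N]mE mdegM mdegU.
Qed.

Section Evaluation.

Variables (R : comNzRingType) (I : choiceType) (S : comNzRingType).

(** Evaluation along an arbitrary homomorphism of coefficients, available as a ring homomorphism;
    [peval] is the case of the structure map of an algebra. *)
Definition pev (f : {rmorphism R -> S}) (h : I -> S) : {rmorphism polyring R I -> S} :=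
  mmap f (mev h).

Lemma pevC f h c : pev f h (malgC c) = f c.
Proof. exact: mmapC. Qed.

Lemma pev_var f h i : pev f h (pvar R i) = h i.
Proof.
transitivity (f 1 * mev h (ucm i)); first exact: mmapU.
by rewrite rmorph1 mul1r mevU.
Qed.

Lemma pev_uniq (f : {rmorphism R -> S}) (h : I -> S) (theta : {rmorphism polyring R I -> S}) :
  (forall c, theta (malgC c) = f c) -> (forall i, theta (pvar R i) = h i) ->
  theta =1 pev f h.
Proof.
move=> Hf Hh p; rewrite (monalgE p) !rmorph_sum; apply: eq_bigr => m _.
transitivity (f p@_m * mev h m); last by symmetry; apply: mmapU.
rewrite -Hf.
have -> : << p@_m *g m >> = malgC p@_m * << m >> :> polyring R I.
  by rewrite malgM_def fgmulUU mulr1 mul1m.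
rewrite rmorphM; congr (_ * _).
rewrite monomE /mev rmorph_prod; apply: eq_bigr => i _.
by rewrite rmorphXn Hh.
Qed.

End Evaluation.

Lemma pevalE (R : comNzRingType) (I : choiceType) (A : comAlgType R) (h : I -> A) p :
  peval h p = pev (in_alg A) h p.
Proof.
by rewrite /peval /pev /= /mmap; apply: eq_bigr => m _; rewrite mulr_algl.
Qed.

(** * Measures as homomorphisms from the symbol ring *)

Section Naturality.

Variables (R S : comNzRingType) (theta : {rmorphism R -> S}).
Variables (g : nat -> nat -> R) (g' : nat -> nat -> S).
Hypothesis gE : forall p q, theta (g p q) = g' p q.

Lemma rmorph_mx (T : finType) (r : rel T) (D : {set T}) x :
  theta (mx g r D x) = mx g' r D x.
Proof.
rewrite /mx /mz /mob rmorph_sum; apply: eq_bigr => Y _.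
rewrite rmorphM rmorphXn rmorphN1; congr (_ * _).
by rewrite /Gz /G; case: ifP => _; [case: ifP => _|]; rewrite ?rmorph0 ?rmorph1 ?gE.
Qed.

Lemma rmorph_nue P Q (a : embedding P Q) : theta (nue g a) = nue g' a.
Proof.
rewrite /nue; elim: (enum _) [set _ | _ in _] => [|x s IH] D /=; first exact: rmorph1.
by rewrite rmorphM rmorph_mx IH.
Qed.

End Naturality.

Section Jvalue.

Variables (R : comNzRingType) (n : nat -> nat -> R).
Hypothesis Hg : rels (shift1 n).

(** By [strict_sum], the total between the two antichains exceeds the value of the new point by
    exactly the corrections in [shift1]. The bounds on p and q keep [kap] from cutting off the
    sizes. *)
Lemma nue_J p q : (p <= 2)%N -> (q <= 2)%N -> nue (shift1 n) (J_emb p q) = n p q.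
Proof.
move=> p2 q2; set g := shift1 n; set s := J_star p q.
pose r := @ple (J p q); have pr E : preo r E := preo_ple E.
have rr (i : 'I_(p + q).+1) : r i i by apply: (@ple_refl (J p q)).
have sv : val s = p by rewrite /= inordK // ltnS leq_addr.
pose A := [set i : 'I_(p + q).+1 | (i < p)%N]; pose B := [set i : 'I_(p + q).+1 | (p < i)%N].
have sE (i : 'I_(p + q).+1) : (i == s) = (i == p :> nat) by rewrite -val_eqE sv.
have rE (i j : 'I_(p + q).+1) : r i j = Jle i j by [].
have aA : antichain r A.
  move=> i j; rewrite !inE rE /Jle => ip jp /orP[/eqP //|/andP[_]].
  by rewrite leqNgt jp.
have aB : antichain r B.
  move=> i j; rewrite !inE rE /Jle => ip jp /orP[/eqP //|/andP[]].
  by rewrite leqNgt ip.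
have bAB : below r A B.
  move=> i j; rewrite !inE !rE /Jle => ip jp.
  rewrite (ltnW ip) (ltnW jp) orbT /= negb_or negb_and -!ltnNge jp /= andbT.
  by apply: contraTneq jp => ->; rewrite -leqNgt ltnW.
have DE (i : 'I_(p + q).+1) : (i \in A :|: B) = (i != s).
  by rewrite !inE sE neq_ltn.
have cA : #|A| = p.
  have -> : A = [set widen_ord (leq_trans (leq_addr q p) (leqnSn _)) i | i : 'I_p].
    apply/setP => i; rewrite inE; apply/idP/imsetP => [ip|[j _ ->] //=].
    by exists (Ordinal ip) => //; apply: val_inj.
  by rewrite card_imset ?card_ord // => i j /(congr1 val) /= /val_inj.
have cB : #|B| = q.
  have := cardsC (s |: A); rewrite cardsU1 card_ord cA.
  have -> : s \notin A by rewrite inE sv ltnn.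
  have -> : ~: (s |: A) = B.
    by apply/setP => i; rewrite in_setC in_setU1 sE !inE; case: ltngtP.
  by rewrite add1n addSn => -[/addnI].
have -> : nue g (J_emb p q) = mx g r (A :|: B) s.
  rewrite /nue (nu_uniq_sets Hg (D' := A :|: B) (s' := [:: s]) (pr setT)) /= ?mulr1 //.
  - move=> _ /imsetP[i _ ->]; exists (J_emb p q i); last by rewrite !rr.
    by rewrite DE eq_sym; exact: neq_lift.
  - move=> i; rewrite DE eq_sym => /unlift_some[j ij _]; exists i; last by rewrite !rr.
    by apply/imsetP; exists j.
  - move=> i _; exists i; last by rewrite !rr.
    by rewrite DE inE orNb.
  - by move=> i _; exists i; rewrite ?rr // mem_enum orbT.
rewrite /mx; have -> : tp r (A :|: B) s = pairs A B.
  apply/setP => -[i b]; rewrite inE /= [RHS]inE /= DE.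
  case: b => /=; rewrite rE inE /Jle.
    by rewrite [s == i]eq_sym sE sv leqnn /=; case: ltngtP.
  by rewrite sE sv leqnn andbT; case: ltngtP.
have := strict_sum (r := r) (w := mz g r (A :|: B)) (pr _) aA aB bAB.
rewrite mz_zeta //; last by rewrite pairs_subset subsetUl subsetUr.
rewrite /Gz lo_pairs hi_pairs.
have -> : G g r A B = g p q.
  rewrite /G; have -> : lea r A B by apply/leaP => i j iA jB; have /andP[] := bAB i j iA jB.
  have -> : meets r A B = false.
    by apply/meetsP => -[i [j [iA jB ji]]]; have /andP[_] := bAB i j iA jB; rewrite ji.
  rewrite (kap_basis (A1 := A) (pr setT)) ?subsetT //; last first.
    by apply/genP; split=> // i iA; exists i; rewrite ?ple_refl.
  rewrite (kap_basis (r := op r) (D := setT) (A1 := B)) ?subsetT //; last 3 first.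
  - by rewrite op_preo.
  - by apply/genP; split=> // i iA; exists i; rewrite // /op rr.
  - by move=> i j iB jB ji; symmetry; apply: aB.
  by rewrite cA cB (minn_idPl p2) (minn_idPl q2).
rewrite cA cB /g /shift1 => H; symmetry.
have {}H := H _ _; apply/(addIr (p == 1%N)%:R)/(addIr (q == 1%N)%:R); apply: H.
- by move=> Z ZD nv; apply: mz_vld0.
- move=> d dD; apply: (mx_dup g (d := d)) => //; exact: ple_refl.
Qed.

End Jvalue.

Definition nsym (R : comNzRingType) (g : nat -> nat -> R) (s : symbol) : R :=
  nue g (projT2 (projT2 s)).

Lemma pev_theta (k R : comNzRingType) (f : {rmorphism k -> R}) (g : nat -> nat -> R) :
  rels g -> forall s, theta_rel s -> pev f (nsym g) s = 0.
Proof.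
have diff (x y : polyring k symbol) : pev f (nsym g) x = pev f (nsym g) y ->
    pev f (nsym g) (x - y) = 0.
  by move=> E; rewrite rmorphB E subrr.
have var P Q (a : embedding P Q) : pev f (nsym g) (sym k a) = nue g a.
  exact: pev_var.
move=> Hg s; case.
- move=> P Q a ba; apply: diff; apply: etrans (var _ _ a) _.
  by rewrite nue_iso //; symmetry; apply: rmorph1.
- move=> P Q S a b; apply: diff; apply: etrans (var _ _ _) _; rewrite nue_comp //.
  rewrite -(var _ _ a) -(var _ _ b).
  exact: (esym (rmorphM (pev f (nsym g)) (sym k b) (sym k a))).
- move=> P Q P' a b r A allA; apply: diff; apply: etrans (var _ _ _) _.
  rewrite (nue_amalg Hg allA); symmetry.
  apply: etrans (rmorph_sum (pev f (nsym g)) _ _ _) _.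
  by apply: eq_bigr => i _; apply: var.
Qed.

Section Points.

Variables (k : fieldType) (R : idomainType) (phi : {rmorphism polyring k symbol -> R}).
Hypothesis phi0 : forall s, theta_rel s -> phi s = 0.

Let val P Q (a : embedding P Q) := phi (sym k a).

Lemma rmorph_diff (A B : comNzRingType) (f : {rmorphism A -> B}) x y :
  f (x - y) = 0 -> f x = f y.
Proof. by move/eqP; rewrite rmorphB subr_eq0 => /eqP. Qed.

Lemma phi_iso P Q (a : embedding P Q) : bijective a -> val a = 1.
Proof.
by move=> /(@Theta_iso k _ _ _)/phi0/rmorph_diff E; apply: etrans E (rmorph1 phi).
Qed.

Lemma phi_comp P Q S (a : embedding P Q) (b : embedding Q S) :
  val (comp_emb b a) = val b * val a.
Proof.
have /phi0/rmorph_diff E := Theta_comp k a b.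
exact: etrans E (rmorphM phi (sym k b) (sym k a)).
Qed.

Lemma phi_amalg P Q P' (a : embedding P Q) (b : embedding P P') r
  (A : 'I_r -> amalgamation a b) : all_amalgamations A ->
  val a = \sum_(i < r) val (am_a (A i)).
Proof.
move=> /(@Theta_amalg k _ _ _ _ _ _ _)/phi0/rmorph_diff E.
exact: etrans E (rmorph_sum phi _ _ _).
Qed.

Definition nval := nphi val.

Lemma nval_tmeas : tmeas (mphi val) nval.
Proof. exact: mphi_tmeas phi_iso phi_comp phi_amalg. Qed.

Lemma nval_comp : exists2 c, c \in comps & exists x t, entries nval = cval x t c.
Proof. exact/rels_cases/(tmeas_rels nval_tmeas). Qed.

Lemma val_nue P Q (a : embedding P Q) : phi (sym k a) = nue (shift1 nval) a.
Proof. exact: (phi_nue phi_iso phi_comp phi_amalg). Qed.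

End Points.

Lemma ideal_radical_ker (A R : comNzRingType) (S : A -> Prop) (phi : {rmorphism A -> R}) x :
  (forall s, S s -> phi s = 0) -> ideal_gen S x -> phi x = 0.
Proof.
move=> S0 [n [c [s [Ss ->]]]]; rewrite rmorph_sum big1 // => i _.
by rewrite rmorphM (S0 (s i)) ?mulr0.
Qed.

Lemma radical_ker (A : comNzRingType) (R : idomainType) (S : A -> Prop)
    (phi : {rmorphism A -> R}) x :
  (forall s, S s -> phi s = 0) -> radical (ideal_gen S) x -> phi x = 0.
Proof.
move=> S0 [n /(ideal_radical_ker S0)/eqP]; rewrite rmorphXn.
by rewrite expf_eq0 => /andP[_ /eqP].
Qed.

Section Pullback.

Variable k : fieldType.

Definition pullback : {rmorphism A33 k -> polyring k symbol} :=
  pev (in_alg (polyring k symbol)) (fun ij : 'I_3 * 'I_3 => sym k (J_emb ij.1 ij.2)).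

Lemma pullbackE f : J_pullback f = pullback f.
Proof. exact: pevalE. Qed.

Lemma pullbackC c : pullback (malgC c) = malgC c.
Proof. by apply: etrans (pevC _ _ _) _; apply: etrans (esym (mul_malgC c 1)) (mulr1 _). Qed.

Definition cap2 p : 'I_3 := inord (minn p 2).

(** The matrix of coordinates, continued beyond index 2 in the way that [cap_both] forces for
    measures in domains. *)
Definition generic p q : A33 k := pvar k (cap2 p, cap2 q).

Lemma closed_immersion : J_closed_immersion k.
Proof.
(* [back] replaces each symbol by its expression in the nine coordinates. The generic entries
   satisfy no relations; the congruence is tested after a homomorphism to a domain, where [val_nue]
   applies. *)
move=> f; pose back := pev (@malgC {cmonom ('I_3 * 'I_3)%type} k) (nsym (shift1 generic)).
exists (back f); apply: contrapT => /krull[R [phi [phi0 phif]]].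
apply: phif; rewrite rmorphB pullbackE; apply/eqP; rewrite subr_eq0; apply/eqP.
pose theta : {rmorphism polyring k symbol -> R} := phi \o (pullback \o back).
rewrite -[phi (pullback _)]/(theta f).
rewrite (pev_uniq (f := phi \o malgC) (h := fun s => phi (pvar k s)) (theta := phi)) //.
symmetry; apply: pev_uniq => [c|s] /=; first by rewrite pevC pullbackC.
rewrite pev_var /nsym; case: s => P [Q a] /=.
rewrite (val_nue phi0) -[phi (pullback _)]/((phi \o pullback) _).
apply: rmorph_nue => p q; rewrite /shift1 !rmorphD !rmorph_nat /=; congr (_ + _ + _).
rewrite /generic pev_var /= (cap_both (nval_tmeas phi0)) /nval /nphi /cap2.
by rewrite !inordK // ltnS geq_minr.
Qed.

End Pullback.

Definition code (c : seq nat) (l : nat) : nat := nth 0%N c l.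

Lemma cval_nth (R : pzRingType) (x t : R) c l :
  nth 0 (cval x t c) l = nth 0 [:: 0; 1; -1; x; t] (code c l).
Proof.
rewrite /cval /code; case: (ltnP l (size c)) => lc; first by rewrite (nth_map 0%N).
by rewrite [LHS]nth_default ?size_map // (nth_default 0%N lc).
Qed.

Lemma cval_lin (R : comNzRingType) (x t : R) c l :
  nth 0 (cval x t c) l =
  nth 0 (cval 0 0 c) l + x * (code c l == 3)%:R + t * (code c l == 4)%:R.
Proof.
rewrite !cval_nth; case: (code c l) => [|[|[|[|[|m]]]]] /=;
  by rewrite ?nth_nil ?mulr0 ?mulr1 ?addr0 ?add0r.
Qed.

Lemma comps_size c : c \in comps -> size c = 9%N.
Proof.
have : all (fun c => size c == 9)%N comps by [].
by move=> /allP H /H/eqP.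
Qed.

(** * Dimensions and intersections of the components *)

Section Components.

Variable k : fieldType.

Definition cmat (x t : k) (c : seq nat) : 'M[k]_3 := \matrix_(i, j) grid (cval x t c) i j.

Definition cdir (e : nat) (c : seq nat) : 'M[k]_3 :=
  \matrix_(i, j) (code c (3 * i + j) == e)%:R.

Definition component (c : seq nat) : affine_subspace k :=
  AffineSubspace (cmat 0 0 c) (<[cdir 3 c]> + <[cdir 4 c]>)%VS.

Lemma cmat_lin x t c : cmat x t c = cmat 0 0 c + x *: cdir 3 c + t *: cdir 4 c.
Proof. by apply/matrixP => i j; rewrite !mxE /grid cval_lin. Qed.

Lemma in_component c M : in_affine (component c) M <-> exists x t, M = cmat x t c.
Proof.
rewrite /in_affine /=; split=> [/memv_addP[_ /vlineP[x ->] [_ /vlineP[t ->] E]]|[x [t ->]]].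
  by exists x, t; rewrite cmat_lin -addrA -E addrC subrK.
by rewrite cmat_lin -[X in X - _]addrA addrC addrK memv_add ?memvZ ?memv_line.
Qed.

Lemma cmat_nth x t x' t' c c' l : cmat x t c = cmat x' t' c' -> (l < 9)%N ->
  nth 0 (cval x t c) l = nth 0 (cval x' t' c') l.
Proof.
move=> /matrixP E l9; have := E (inord (l %/ 3)) (inord (l %% 3)).
rewrite !mxE /grid !inordK ?ltn_pmod ?ltn_divLR //.
by rewrite mulnC -divn_eq.
Qed.

Lemma cdir_eq0 e c : size c = 9%N -> (cdir e c == 0) = (e \notin c).
Proof.
move=> sc; apply/eqP/idP => [/matrixP E|ec].
  apply/negP => /(nthP 0%N)[l]; rewrite sc => l9 le.
  have := E (inord (l %/ 3)) (inord (l %% 3)); rewrite !mxE !inordK ?ltn_pmod ?ltn_divLR //.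
  by rewrite mulnC -divn_eq /code le eqxx => /eqP; rewrite oner_eq0.
apply/matrixP => i j; rewrite !mxE; case: eqP => // ce; case/negP: ec.
rewrite -ce /code mem_nth // sc.
by case: i j {ce} => [[|[|[|i]]] //= _] [[|[|[|j]]] //= _].
Qed.

Lemma adim_component c : c \in comps -> adim (component c) = ((3 \in c) + (4 \in c))%N.
Proof.
move=> cc; have sc := comps_size cc.
have dl e : \dim <[cdir e c]> = (e \in c).
  by rewrite dim_vline cdir_eq0 // negbK.
rewrite /adim /= dimv_disjoint_sum ?dl //.
(* The two direction matrices have disjoint supports. *)
apply/eqP; rewrite -subv0; apply/subvP => M /memv_capP[/vlineP[x ->] /vlineP[t E]].
rewrite memv0; apply/eqP/matrixP => i j; have /matrixP/(_ i j) := E.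
rewrite !mxE; case: (eqVneq (code c (3 * i + j)) 3) => [->|] /=.
  by rewrite mulr1 mulr0.
by rewrite mulr0.
Qed.

(* [clash] and its mirror image detect contradictions that hold over every field: 1 and
   -1 are nonzero, but may be equal. *)
Definition clash (a b a' b' : nat) : bool :=
  [&& a == 0, (b == 1) || (b == 2), a' == 0 & b' == 0]%N ||
  [&& a == a', (a == 3) || (a == 4), b == 0 & (b' == 1) || (b' == 2)]%N.

Definition separated (c c' : seq nat) : bool :=
  has (fun l => has (fun l' => clash (code c l) (code c' l) (code c l') (code c' l') ||
    clash (code c' l) (code c l) (code c' l') (code c l')) (iota 0 9)) (iota 0 9).

(** Every entry of [c'] is 0 or its second parameter, and at a place with the parameter [c] has 0: a
    common point is the zero matrix. *)
Definition pinned (c c' : seq nat) : bool :=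
  all (fun e => (e == 0) || (e == 4))%N c' &&
  has (fun l => (code c l == 0) && (code c' l == 4))%N (iota 0 9).

(** The components through the origin are the first four; any other pair is disjoint over every
    field. *)
Lemma comps_meet : all (fun i => all (fun j => (i == j) ||
  let c := nth [::] comps i in let c' := nth [::] comps j in
  if (i < 4)%N && (j < 4)%N then pinned c c' || pinned c' c else separated c c')
  (iota 0 24)) (iota 0 24).
Proof. by vm_compute. Qed.

Lemma clashP (x t x' t' : k) c c' l l' :
  nth 0 (cval x t c) l = nth 0 (cval x' t' c') l ->
  nth 0 (cval x t c) l' = nth 0 (cval x' t' c') l' ->
  ~~ clash (code c l) (code c' l) (code c l') (code c' l').
Proof.
have n1 : (1 : k) = 0 -> False by move/eqP; rewrite oner_eq0.
have nN1 : (-1 : k) = 0 -> False by move/eqP; rewrite oppr_eq0 oner_eq0.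
rewrite !cval_nth => E E'; apply/negP => /orP[/and4P[/eqP a b _ _]|/and4P[/eqP a b /eqP b0 b']].
  move: E; rewrite a; case/orP: b => /eqP -> /= /esym; [exact: n1|exact: nN1].
move: E'; rewrite -a E b0.
by case/orP: b' => /eqP -> /= /esym; [exact: n1|exact: nN1].
Qed.

Lemma separatedP c c' M : separated c c' ->
  in_affine (component c) M -> in_affine (component c') M -> False.
Proof.
move=> /hasP[l]; rewrite mem_iota => l9 /hasP[l']; rewrite mem_iota => l9' H.
move=> /in_component[x [t ->]] /in_component[x' [t' E]].
have E1 := cmat_nth E l9; have E2 := cmat_nth E l9'.
by case/orP: H; apply/negP; [apply: clashP E1 E2|apply: clashP (esym E1) (esym E2)].
Qed.

Lemma pinnedP c c' M : pinned c c' ->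
  in_affine (component c) M -> in_affine (component c') M -> M = 0.
Proof.
move=> /andP[/allP c04 /hasP[l]]; rewrite mem_iota => l9 /andP[/eqP cl /eqP cl'].
move=> /in_component[x [t Ec]] /in_component[x' [t' E]].
have := cmat_nth (etrans (esym Ec) E) l9; rewrite !cval_nth cl cl' /= => t0.
rewrite E; apply/matrixP => i j; rewrite !mxE /grid cval_nth -t0.
case: (ltnP (3 * i + j) (size c')) => lc; last by rewrite /code (nth_default 0%N lc).
by case/orP: (c04 _ (mem_nth 0%N lc)) => /eqP H; rewrite /code H.
Qed.

End Components.

(** * Ideals of the components and the space of measures *)

Section Affine.

Variable I : choiceType.

Lemma mdeg_le1 (m : {cmonom I}) : (mdeg m <= 1)%N -> m = mone \/ exists i, m = ucm i.
Proof.
rewrite leq_eqVlt ltnS leqn0 => /orP[/eqP m1|/eqP/mdeg_eq0I ->]; last by left.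
right; have [i im] : exists i, i \in finsupp m.
  apply/fset0Pn; apply/eqP => f0; move: m1.
  by rewrite mdegE f0 big_seq_fset0.
have mE : m = mmul (ucm i) (divcm m (ucm i)).
  apply/eqP/cmP => j; rewrite cmM cmU divcmE cmU.
  case: eqP => [<-|_]; last by rewrite subn0.
  by rewrite subnKC // lt0n cmE_neq0.
exists i; move: m1; rewrite {1}mE mdegM mdegU => -[/mdeg_eq0I E].
by rewrite mE E mulm1.
Qed.

(** In degree at most 1 evaluation respects affine combinations, here of three points spanning a
    component. *)
Lemma pev_affine (R S : comNzRingType) (f : {rmorphism R -> S}) (h h0 h1 h2 : I -> S) (x t : S)
    (s : polyring R I) : (msize s <= 2)%N ->
  (forall i, h i = h0 i + x * (h1 i - h0 i) + t * (h2 i - h0 i)) ->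
  pev f h s = pev f h0 s + x * (pev f h1 s - pev f h0 s) + t * (pev f h2 s - pev f h0 s).
Proof.
move=> s2 hE; rewrite /pev /= /mmap -!sumrB !mulr_sumr -!big_split /= big_seq [RHS]big_seq.
apply: eq_bigr => m ms; rewrite -!mulrBr !(mulrCA _ (f _)) -!mulrDr; congr (_ * _).
have : (mdeg m <= 1)%N by rewrite -ltnS; apply: leq_trans s2; apply: msize_mdeg_lt.
case/mdeg_le1 => [->|[i ->]]; last by rewrite !mevU hE.
by rewrite !mmorph1 !subrr !mulr0 !addr0.
Qed.

Lemma pev_cong (R : comNzRingType) (A : comNzRingType) (J : A -> Prop) (f : {rmorphism R -> A})
    (h h' : I -> A) : ideal_closed J -> (forall i, J (h i - h' i)) ->
  forall p, J (pev f h p - pev f h' p).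
Proof.
move=> [J0 JD JM] hh p.
have JMM a b a' b' : J (a - b) -> J (a' - b') -> J (a * a' - b * b').
  move=> ab ab'; have -> : a * a' - b * b' = a' * (a - b) + b * (a' - b').
    by rewrite !mulrBr addrA mulrC [a' * b]mulrC subrK.
  by apply: (JD); apply: (JM).
rewrite /pev /= /mmap -sumrB; elim/big_ind: _ => // m _.
rewrite -mulrBr; apply: (JM); rewrite /mev.
apply: (big_ind2 (fun a b => J (a - b))) => [|a b a' b'|i _]; first by rewrite subrr.
  exact: JMM.
elim: (m i) => [|n IH]; first by rewrite !expr0 subrr.
by rewrite !exprS; apply: JMM.
Qed.

End Affine.

Lemma rmorph_cval (R S : comNzRingType) (f : {rmorphism R -> S}) x t c l :
  f (nth 0 (cval x t c) l) = nth 0 (cval (f x) (f t) c) l.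
Proof.
rewrite !cval_nth; case: (code c l) => [|[|[|[|[|m]]]]] /=;
  by rewrite ?nth_nil ?rmorph0 ?rmorph1 ?rmorphN1.
Qed.

Lemma pev_id (R : comNzRingType) (I : choiceType) (p : polyring R I) :
  pev malgC (@pvar R I) p = p.
Proof.
rewrite [RHS]monalgE; apply: eq_bigr => m _.
transitivity (malgC p@_m * << m >> : polyring R I).
  by congr (_ * _); symmetry; apply: monomE.
by rewrite malgM_def fgmulUU mulr1 mul1m.
Qed.

Lemma ideal_cong0 (A : zmodType) (J : A -> Prop) u v w :
  J (u - v) -> u = w -> v = 0 -> J w.
Proof. by move=> H <- v0; move: H; rewrite v0 subr0. Qed.

Lemma msize_cval (R : comNzRingType) (I : choiceType) (u v : polyring R I) c l :
  (msize u <= 2)%N -> (msize v <= 2)%N -> (msize (nth 0%R (cval u v c) l) <= 2)%N.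
Proof.
move=> u2 v2; have c1 : (msize (1 : polyring R I) <= 2)%N.
  by rewrite -mpolyC1E msizeC; case: eqP.
rewrite cval_nth; case: (code c l) => [|[|[|[|[|m]]]]] //=; first by rewrite msize0.
  by rewrite msizeN.
by rewrite nth_nil msize0.
Qed.

Lemma msize_pvar (R : comNzRingType) (I : choiceType) (i : I) : msize (pvar R i) = 2%N.
Proof. by rewrite msizeE msuppU1 big_seq_fset1 mdegU. Qed.

Section Ideals.

Variable k : fieldType.

Notation X33 := ('I_3 * 'I_3)%type.

(** The generators of the ideal vanish at the points with parameters (0,0), (1,0) and (0,1), which
    exist over every field, however small; having degree at most 1, they vanish at all points of the
    component over any ring. *)
Lemma point_ideal (R : comNzRingType) (theta : {rmorphism A33 k -> R}) (x t : R) c f :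
  (forall ij : X33, theta (pvar k ij) = grid (cval x t c) ij.1 ij.2) ->
  affine_ideal (component k c) f -> theta f = 0.
Proof.
move=> tE; apply: ideal_radical_ker => s [s2 sM].
pose kap : {rmorphism k -> R} := theta \o malgC.
pose pt (x t : R) (ij : X33) := grid (cval x t c) ij.1 ij.2.
have kE (a b : k) : pev kap (pt (kap a) (kap b)) s = 0.
  have := sM (cmat a b c); rewrite pevalE => H.
  pose ev : {rmorphism A33 k -> k} :=
    pev (in_alg k^o) (fun ij : X33 => cmat a b c ij.1 ij.2).
  have : kap (ev s) = 0.
    rewrite /ev H; first exact: rmorph0.
    by apply/in_component; exists a, b.
  have evC e : ev (malgC e) = e by apply: etrans (pevC _ _ _) _; exact: mulr1.
  move=> <-; symmetry; apply: (pev_uniq (theta := kap \o ev)) => [e|ij].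
    exact: (congr1 kap (evC e)).
  have evX : ev (pvar k ij) = grid (cval a b c) ij.1 ij.2.
    by apply: etrans (pev_var _ _ _) _; rewrite mxE.
  by apply: etrans (congr1 kap evX) _; apply: rmorph_cval.
have -> : theta s = pev kap (pt x t) s by apply: pev_uniq.
rewrite (@pev_affine _ _ _ kap (pt x t) (pt 0 0) (pt 1 0) (pt 0 1) x t s s2).
  have := kE 0 0; have := kE 1 0; have := kE 0 1; rewrite !rmorph0 !rmorph1 => -> -> ->.
  by rewrite subrr !mulr0 !addr0.
move=> ij; rewrite /pt /grid (cval_lin x) (cval_lin 1 0) (cval_lin 0 1).
rewrite !mul0r !mul1r !addr0; congr (_ + _ * _ + _ * _); by rewrite addrC addKr.
Qed.

Lemma ideal_space (f : A33 k) :
  (forall c, c \in comps -> affine_ideal (component k c) f) -> space_ideal f.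
Proof.
move=> fJ; apply: contrapT => /krull[R [phi [phi0]]]; apply.
have [c cc [x [t E]]] := nval_comp phi0.
rewrite pullbackE -[phi (pullback _ _)]/((phi \o pullback k) f).
apply: (point_ideal (x := x) (t := t) _ (fJ c cc)) => ij.
rewrite /= /pullback pev_var /grid -E.
case: ij => [[[|[|[|i]]] //= _] [[|[|[|j]]] //= _]]; by [].
Qed.

Lemma space_component (f : A33 k) c : c \in comps -> space_ideal f ->
  affine_ideal (component k c) f.
(* Evaluating at the generic point of the component shows that [f] vanishes there, and
   every variable is congruent to its value at the generic point modulo the ideal. *)
Proof.
move=> cc sf; pose R : idomainType := {poly {poly k}}.
pose f0 : {rmorphism k -> R} := polyC \o polyC.
pose x : R := 'X%:P; pose t : R := 'X.
pose n := grid (cval x t c); have Hg : rels (shift1 n) := comps_rels x t cc.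
have := radical_ker (pev_theta f0 Hg) sf; rewrite pullbackE => ps0.
have {}ps0 : pev f0 (fun ij : X33 => n ij.1 ij.2) f = 0.
  rewrite -ps0; symmetry.
  apply: (pev_uniq (theta := pev f0 (nsym (shift1 n)) \o pullback k)) => [a|ij] /=.
    by rewrite pullbackC pevC.
  rewrite /pullback pev_var; apply: etrans (pev_var _ _ _) _; rewrite /nsym /=.
  by apply: (nue_J Hg); rewrite -ltnS.
(* A coordinate equal to the parameter [e] on the component; a parameter that does not occur in [c]
   is sent to 0. *)
pose var e : A33 k := if e \in c then pvar k (inord (index e c %/ 3), inord (index e c %% 3)) else 0.
pose tau0 : {rmorphism {poly k} -> A33 k} :=
  horner_morph (fun a : k => mulrC (var 3) (malgC a)).
pose tau : {rmorphism R -> A33 k} := horner_morph (fun a => mulrC (var 4) (tau0 a)).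
pose gen (ij : X33) : A33 k := grid (cval (var 3) (var 4) c) ij.1 ij.2.
have tx : tau x = var 3 by rewrite /tau /x /= horner_morphC /tau0 /= horner_morphX.
have tt : tau t = var 4 by apply: horner_morphX.
have s0 : pev malgC gen f = 0.
  rewrite -[RHS](rmorph0 tau) -ps0; symmetry.
  apply: (pev_uniq (theta := tau \o pev f0 _)) => [a|ij].
    have tauC : tau (a%:P%:P) = malgC a.
      by apply: etrans (horner_morphC _ _) _; apply: horner_morphC.
    by apply: etrans tauC; congr (tau _); apply: pevC.
  apply: etrans (congr1 tau (pev_var _ _ _)) _.
  by apply: etrans (rmorph_cval _ _ _ _ _) _; rewrite tx tt.
suff hJ ij : affine_ideal (component k c) (pvar k ij - gen ij).
  exact: ideal_cong0 (pev_cong malgC (ideal_gen_closed _) hJ f) (pev_id f) s0.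
apply: ideal_gen_in; split.
  apply: leq_trans (msizeD_le _ _) _; rewrite msizeN geq_max msize_pvar leqnn /=.
  have v2 e : (msize (var e) <= 2)%N.
    by rewrite /var; case: (e \in c); [rewrite msize_pvar|rewrite msize0].
  exact: msize_cval (v2 3) (v2 4).
move=> M /in_component[a [b ->]]; rewrite pevalE.
set ev := pev _ _; apply/eqP; rewrite rmorphB subr_eq0; apply/eqP.
apply: etrans (pev_var _ _ _) _; rewrite mxE; symmetry.
apply: etrans (rmorph_cval ev _ _ _ _) _.
have evar e : e \in c -> ev (var e) = nth 0 [:: 0; 1; -1; a; b] e.
  move=> ec; rewrite /var ec; apply: etrans (pev_var _ _ _) _.
  have ic : (index e c < 9)%N by rewrite -(comps_size cc) index_mem.
  rewrite mxE /grid !inordK ?ltn_pmod ?ltn_divLR // mulnC -divn_eq cval_nth.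
  by rewrite /code nth_index.
rewrite /grid !cval_nth; have inc l : (0 < code c l)%N -> code c l \in c.
  rewrite /code; case: (ltnP l (size c)) => lc; first by rewrite mem_nth.
  by rewrite nth_default.
have := inc (3 * ij.1 + ij.2)%N.
by case: (code c _) => [|[|[|[|[|m]]]]] //= /(_ isT)/evar.
Qed.

End Ideals.

(** Turns the cardinalities of the theorem into counts that evaluate. *)
Lemma card_ord_count (n : nat) (P : pred nat) :
  #|[set i : 'I_n | P i]| = count P (iota 0 n).
Proof.
by rewrite cardsE cardE /enum_mem size_filter -enumT -val_enum_ord count_map.
Qed.

Theorem corollary2 (k : fieldType) :
  J_closed_immersion k /\
  exists (X : 'I_24 -> affine_subspace k) (S : {set 'I_24}) (c : 'M[k]_3),
    [/\ [/\ #|[set i | adim (X i) == 2%N]| = 1%N,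
            #|[set i | adim (X i) == 1%N]| = 8%N
          & #|[set i | adim (X i) == 0%N]| = 15%N],
        forall f : A33 k, space_ideal f <-> (forall i, affine_ideal (X i) f),
        [/\ #|[set i in S | adim (X i) == 2%N]| = 1%N,
            #|[set i in S | adim (X i) == 1%N]| = 3%N
          & #|[set i in S | adim (X i) == 0%N]| = 0%N]
      & forall i j : 'I_24, i != j -> forall M : 'M[k]_3,
          in_affine (X i) M /\ in_affine (X j) M <->
          [/\ i \in S, j \in S & M = c]].
Proof.
split; first exact: closed_immersion.
have cc (i : 'I_24) : nth [::] comps i \in comps by apply: mem_nth; apply: ltn_ord.
(* The plane and the three lines through the origin come first in [comps]. *)
exists (fun i => component k (nth [::] comps i)), [set i : 'I_24 | (i < 4)%N], 0.
have dE (i : 'I_24) d : (adim (component k (nth [::] comps i)) == d) =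
    (let c := nth [::] comps i in (3 \in c) + (4 \in c) == d)%N.
  by rewrite adim_component.
split.
- split; under eq_finset do rewrite dE.
  + by rewrite (card_ord_count 24 (fun i => let c := nth [::] comps i in (3 \in c) + (4 \in c) == 2)%N).
  + by rewrite (card_ord_count 24 (fun i => let c := nth [::] comps i in (3 \in c) + (4 \in c) == 1)%N).
  + by rewrite (card_ord_count 24 (fun i => let c := nth [::] comps i in (3 \in c) + (4 \in c) == 0)%N).
- move=> f; split=> [sf i|H]; first exact: space_component.
  apply: ideal_space => c cP; have ic : (index c comps < 24)%N by rewrite index_mem.
  by have := H (Ordinal ic); rewrite /= nth_index.
- split; under eq_finset do rewrite dE inE.
  + by rewrite (card_ord_count 24 (fun i => (i < 4) && (let c := nth [::] comps i in (3 \in c) + (4 \in c) == 2))%N).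
  + by rewrite (card_ord_count 24 (fun i => (i < 4) && (let c := nth [::] comps i in (3 \in c) + (4 \in c) == 1))%N).
  + by rewrite (card_ord_count 24 (fun i => (i < 4) && (let c := nth [::] comps i in (3 \in c) + (4 \in c) == 0))%N).
- move=> i j ij M; rewrite !inE.
  have m24 (l : 'I_24) : (l : nat) \in iota 0 24 by rewrite mem_iota /=.
  have /orP[/eqP/val_inj E|] := allP (allP comps_meet i (m24 i)) j (m24 j).
    by rewrite E eqxx in ij.
  move=> /=; case: ifP => [/andP[i4 j4] pin|nS sep]; split=> [[Mi Mj]|[Si Sj Mc]].
  + split=> //; case/orP: pin => pin; first exact: pinnedP pin Mi Mj.
    exact: pinnedP pin Mj Mi.
  (* The first four components have no constant entry other than 0, so both parameters equal to 0
     give the zero matrix. *)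
  + have M0 (l : 'I_24) : (l < 4)%N -> in_affine (component k (nth [::] comps l)) M.
      move=> l4; apply/in_component; exists 0, 0; rewrite Mc; apply/matrixP => p q.
      rewrite !mxE /grid cval_nth.
      have : all (fun c => all (fun e => e \in [:: 0; 3; 4]%N) c) (take 4 comps) by [].
      move=> /allP/(_ (nth [::] comps l)) H.
      have {}H : nth [::] comps l \in take 4 comps -> forall z, code (nth [::] comps l) z \in [:: 0; 3; 4]%N.
        move=> /H/allP Hc z; rewrite /code.
        case: (ltnP z (size (nth [::] comps l))) => lz; first exact/Hc/mem_nth.
        by rewrite nth_default.
      have /H/(_ (3 * p + q)%N) : nth [::] comps l \in take 4 comps.
        by rewrite -(nth_take [::] l4) mem_nth.
      by rewrite !inE => /or3P[] /eqP ->.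
    by split; apply: M0.
  + by case: (separatedP sep Mi Mj).
  + by rewrite Si Sj in nS.
Qed.
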